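(* For every integer $m\ge1$, the zeros of $\Phi_{mp}(z)-\Phi_{mp}^*(z)$ are at the following points: (i) the $p$ Dirichlet data points $z_j$, one in each gap (in the closed-arc sense described in the context) of the period $p$ problem; (ii) the $(m-1)p$ points $e^{i\theta}$ where $$k(e^{i\theta})=\frac{i-1}{p}+\frac{q}{mp},\qquad i=1,\dots,p;\ q=1,\dots,m-1 .$$
   Context: Let $p\ge2$ be even and let $\{\alpha_n\}_{n\ge0}$ be complex numbers with $|\alpha_n|<1$ and $\alpha_{n+p}=\alpha_n$; put $\rho_n=(1-|\alpha_n|^2)^{1/2}$. The orthonormal polynomials on the unit circle are defined by $\varphi_0\equiv1$, $\varphi_{n+1}(z)=\rho_n^{-1}(z\varphi_n(z)-\bar\alpha_n\varphi_n^*(z))$, where $\varphi_n^*(z)=z^n\overline{\varphi_n(1/\bar z)}$; $\Phi_n$ is the monic multiple of $\varphi_n$ and $\Phi_n^*(z)=z^n\overline{\Phi_n(1/\bar z)}$. Let $A_k(z)=\frac1{\rho_k}\begin{pmatrix}z&-\bar\alpha_k\\-z\alpha_k&1\end{pmatrix}$, $T_n(z)=A_{n-1}(z)\cdots A_0(z)$, $\Delta(z)=z^{-p/2}\mathrm{Tr}(T_p(z))$. The function $\Delta$ is real on $\partial\mathbb D$ (the unit circle), and $\{z:\Delta(z)\in(-2,2)\}$ consists of $p$ disjoint open arcs of $\partial\mathbb D$, $\{e^{i\theta}: x_j<\theta<y_j\}$, labelled with $x_1\in[0,2\pi)$, $\Delta(e^{ix_1})=2$, and $x_1<y_1\le x_2<y_2\le\cdots<y_p\le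 x_{p+1}:=x_1+2\pi$. The bands are the closed arcs $\{e^{i\theta}:x_j\le\theta\le y_j\}$; the gaps are $\{e^{i\theta}: y_j<\theta<x_{j+1}\}$, $j=1,\dots,p$, a gap being closed if $y_j=x_{j+1}$. The Dirichlet data points are the points $z\in\partial\mathbb D$ for which $\binom11$ is an eigenvector of $T_p(z)$, equivalently the $p$ zeros of $\varphi_p-\varphi_p^*$; there is exactly one, $z_j$, in each $\{e^{i\theta}:y_j\le\theta\le x_{j+1}\}$ (closed gaps included). $dk$ is the (probability) logarithmic-potential-theoretic equilibrium measure of the union of the bands, and $k(e^{i\theta_0})=k(\{e^{i\theta}: x_1<\theta<\theta_0\})$ for $x_1\le\theta_0<x_1+2\pi$. *)

(* Defs.v *)
From HB Require Import structures.
From mathcomp Require Import all_boot all_order all_algebra.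
From mathcomp Require Import complex.
From mathcomp Require Import all_classical all_reals all_analysis.
Import Order.TTheory GRing.Theory Num.Theory.
Import numFieldNormedType.Exports.

Set Implicit Arguments.
Unset Strict Implicit.
Unset Printing Implicit Defensive.

Local Open Scope classical_set_scope.
Local Open Scope complex_scope.
Local Open Scope ring_scope.

Definition expi (R : realType) (theta : R) : R[i] := cos theta +i* sin theta.

Section OPUC.
Variables (R : realType) (alpha : nat -> R[i]).

Definition rho (n : nat) : R[i] := sqrtC (1 - `|alpha n| ^+ 2).

(* For p of degree at most n, the polynomial z^n * conj (p (1 / conj z)),
   that is, the coefficients of p reversed and conjugated. *)
Definition revpoly (n : nat) (p : {poly R[i]}) : {poly R[i]} :=
  \poly_(i < n.+1) (p`_(n - i))^*.

Fixpoint phi (n : nat) : {poly R[i]} :=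
  if n is n'.+1 then
    (rho n')^-1 *: ('X * phi n' - (alpha n')^* *: revpoly n' (phi n'))
  else 1.

Definition Phi (n : nat) : {poly R[i]} := (lead_coef (phi n))^-1 *: phi n.

Definition transfer1 (k : nat) (z : R[i]) : 'M[R[i]]_2 :=
  (rho k)^-1 *: \matrix_(i < 2, j < 2)
    nth 0 (nth [::] [:: [:: z; - (alpha k)^*]; [:: - z * alpha k; 1]] i) j.

Fixpoint transfer (n : nat) (z : R[i]) : 'M[R[i]]_2 :=
  if n is n'.+1 then transfer1 n' z *m transfer n' z else 1%:M.

Definition discriminant (p : nat) (z : R[i]) : R[i] :=
  z ^- p./2 * \tr (transfer p z).

Definition dirichlet (p : nat) (z : R[i]) : Prop :=
  `|z| = 1 /\
  exists lambda : R[i],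
    transfer p z *m (const_mx 1 : 'cV_2) = lambda *: const_mx 1.

(* The indices of x and y run from 1.  The order on R[i] relates only numbers
   with equal imaginary parts, so -2 < w < 2 includes that w is real.  The
   point z = 0 is excluded because there z ^- p./2 is a junk value. *)
Definition band_edges (p : nat) (x y : nat -> R) : Prop :=
  [/\ 0 <= x 1%N < 2 * pi,
      discriminant p (expi (x 1%N)) = 2,
      x p.+1 = x 1%N + 2 * pi,
      (forall j, (1 <= j <= p)%N -> x j < y j /\ y j <= x j.+1) &
      forall z : R[i], z != 0 ->
        (-2 < discriminant p z < 2 <->
         exists j theta, [/\ (1 <= j <= p)%N, x j < theta < y j
                           & z = expi theta])].

End OPUC.

Section bands.
Variables (R : realType) (p : nat) (x y : nat -> R).

Definition bands : set R[i] :=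
  [set z | exists j theta,
    [/\ (1 <= j <= p)%N, x j <= theta <= y j & z = expi theta]].

Definition closed_gap (j : nat) : set R[i] :=
  [set expi theta | theta in [set t | y j <= t <= x j.+1]].

End bands.

Section equilibrium.
Variable R : realType.

Definition borelC := g_sigma_algebraType (@open (R[i])^o).

Definition log_energy (mu : probability borelC R) (E : set R[i]) : \bar R :=
  (\int[mu]_(z in E) \int[mu]_(w in E)
     - lne (complex.Re `|(z : R[i]) - (w : R[i])|)%:E)%E.

(* For compact E, mu E = 1 says that mu is supported on E; lne 0 is -oo, so
   the kernel is +oo on the diagonal. *)
Definition equilibrium_measure (E : set R[i]) (mu : probability borelC R) :=
  mu E = 1%E /\
  forall nu : probability borelC R,
    nu E = 1%E -> (log_energy mu E <= log_energy nu E)%E.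

Definition arc_mass (mu : probability borelC R) (x1 theta0 : R) : \bar R :=
  mu [set expi theta | theta in [set t | x1 < t < theta0]].

End equilibrium.

(* Main.v *)
(* On the unit circle, conjugating the transfer matrix by e^{-in theta/2} and by the Cayley
   transform makes it a real unimodular matrix N_n (theta/2).  Its trace is D = Delta, and its
   lower left entry C vanishes exactly at the Dirichlet data, respectively (for n = mp) at the
   zeros of Phi_mp - Phi_mp^*.  By Cayley-Hamilton C_mp = U_{m-1}(D/2) C_p with U the Chebyshev
   polynomials of the second kind, so the zeros are the Dirichlet data together with the points
   where D = 2 cos (pi q / m).

   Where |D| < 2, the derivative D' has the sign opposite to C and does not vanish, so D is
   monotone on each band; each closed gap contains a zero of C because D' changes sign
   across it.

   It remains to show that k = (j-1)/p + kappa_j/(p pi) on the j-th band, where kappa_j is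
   arccos (D/2) or pi - arccos (D/2).  Let X_j(u) be the point of the j-th band with
   D = 2 cos u, and let mu be the average over j of the images under X_j of the uniform
   probability on (0, pi).  Since |D(z) - 2 cos u| is a constant times the product of the
   |z - X_j(u)|, the logarithmic potential of mu at a point z with D(z) = 2 cos v is, up to a
   constant, the integral of -ln |sin ((u-v)/2) sin ((u+v)/2)| over (0, pi), which does not
   depend on v by translation invariance.  A measure on the bands with constant potential is
   the equilibrium measure: the kernel -ln (|z-w|/2) is a positive superposition of the
   products 1_c(z) 1_c(w) over the caps c of the circle, so its energy is a positive definite
   form, and two minimizers give the same mass to every cap, hence to every arc. *)
Require Import Defs.
From HB Require Import structures.
From mathcomp Require Import all_boot all_order all_algebra.
From mathcomp Require Import complex.
From mathcomp Require Import all_classical all_reals all_analysis.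
From mathcomp Require Import measurable_realfun.
From mathcomp Require Import ring lra.
Import Order.TTheory GRing.Theory Num.Theory.
Import numFieldNormedType.Exports.

Set Implicit Arguments.
Unset Strict Implicit.
Unset Printing Implicit Defensive.

Local Open Scope classical_set_scope.
Local Open Scope complex_scope.
Local Open Scope ring_scope.

(** * Prüfer form of the transfer matrices *)

(** C D' < 0 because N' = N J G, with J the rotation by a right angle and G a sum of Gram matrices
    N_k^T N_k: the trace of N J G is a sum of values of one quadratic form attached to N, which is
    definite with the sign opposite to C as soon as |D| < 2. That a gap holds only one Dirichlet
    point is a count of degrees: Phi_p - Phi_p^* has degree at most p and a zero in each of the p
    gaps. The obstacle in the potential theory is that logarithmic integrals may be infinite.
    Halving the distance makes the kernel nonnegative on the circle, so that Tonelli applies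
    throughout, and the constant ln 2 is carried separately. The given minimizer dk is compared with
    the single measure mu: the potential of mu is a constant V, hence the energy of dk - mu is I(dk)
    - V <= 0. The kernel is built from caps shorter than a half circle and yields equal masses only
    for almost every cap; monotone approximation extends this to every cap up to a half circle, and
    inclusion-exclusion to longer arcs. *)

Definition rhoR {R : realType} (a : R[i]) : R :=
  Num.sqrt (1 - complex.Re a ^+ 2 - complex.Im a ^+ 2).

(* [w = v.1 + i v.2] is mapped to [(e^{it} w - conj (a e^{it} w)) / rho]. *)
Definition prufer_step {R : realType} (a : R[i]) (t : R) (v : R * R) : R * R :=
  let u := (cos t * v.1 - sin t * v.2, sin t * v.1 + cos t * v.2) in
  ((rhoR a)^-1 * ((1 - complex.Re a) * u.1 + complex.Im a * u.2),
   (rhoR a)^-1 * (complex.Im a * u.1 + (1 + complex.Re a) * u.2)).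

Fixpoint prufer {R : realType} (alpha : nat -> R[i]) (n : nat) (t : R)
    (v : R * R) : R * R :=
  if n is k.+1 then prufer_step (alpha k) t (prufer alpha k t v) else v.

Section prufer_theory.
Variables (R : realType) (alpha : nat -> R[i]).
Hypothesis alpha_lt1 : forall n, `|alpha n| < 1.
Implicit Types (t : R) (v : R * R) (w z : R[i]).

Local Notation pa n t := (prufer alpha n t (1, 0)).1.
Local Notation pc n t := (prufer alpha n t (1, 0)).2.
Local Notation pb n t := (prufer alpha n t (0, 1)).1.
Local Notation pd n t := (prufer alpha n t (0, 1)).2.

Lemma alpha_sq_lt1 n : complex.Re (alpha n) ^+ 2 + complex.Im (alpha n) ^+ 2 < 1.
Proof.
have := alpha_lt1 n; rewrite -(ltr_pXn2r (n := 2)) ?nnegrE// -add_Re2_Im2 expr1n.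
by rewrite -[1]/(1%:C) ltcR.
Qed.

Lemma rhoR_gt0 n : 0 < rhoR (alpha n).
Proof. by rewrite sqrtr_gt0; have := alpha_sq_lt1 n; lra. Qed.

Lemma rhoR_sq n : rhoR (alpha n) ^+ 2 =
  1 - complex.Re (alpha n) ^+ 2 - complex.Im (alpha n) ^+ 2.
Proof. by rewrite sqr_sqrtr//; have := alpha_sq_lt1 n; lra. Qed.

Lemma rhoE n : rho alpha n = (rhoR (alpha n))%:C.
Proof.
have -> : rho alpha n = sqrtC ((rhoR (alpha n))%:C ^+ 2).
  congr sqrtC; rewrite -add_Re2_Im2 -[X in X - _]/(1%:C) -rmorphB -rmorphXn/=.
  by rewrite rhoR_sq; congr (_%:C); ring.
by rewrite sqrCK// ler0c ltW// rhoR_gt0.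
Qed.

Lemma expiD (s t : R) : expi (s + t) = expi s * expi t.
Proof. by rewrite /expi; simpc; rewrite cosD sinD; congr (_ +i* _); ring. Qed.

Lemma expi0 : expi 0 = 1 :> R[i].
Proof. by rewrite /expi cos0 sin0. Qed.

Lemma expi_neq0 t : expi t != 0.
Proof.
apply/eqP => h; have := expiD t (- t); rewrite h mul0r subrr expi0.
by apply/eqP; rewrite oner_eq0.
Qed.

Lemma norm_expi t : `|expi t| = 1.
Proof. by rewrite normc_def/= cos2Dsin2 sqrtr1. Qed.

Lemma prufer_lin n t v : prufer alpha n t v =
  (v.1 * pa n t + v.2 * pb n t, v.1 * pc n t + v.2 * pd n t).
Proof.
elim: n => [|n ih] /=; first by case: v => x y /=; congr (_, _); ring.
by rewrite ih /prufer_step/=; congr (_, _); ring.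
Qed.

(** A step is a rotation by [t] followed by a symmetric matrix of determinant
    [(1 - |alpha|^2) / rho^2 = 1]. *)
Lemma prufer_det n t : pa n t * pd n t - pb n t * pc n t = 1.
Proof.
elim: n => [|n ih] /=; first by ring.
have r2 : (rhoR (alpha n))^-1 ^+ 2 *
    (1 - complex.Re (alpha n) ^+ 2 - complex.Im (alpha n) ^+ 2) = 1.
  by rewrite -rhoR_sq -exprMn mulVf ?expr1n// gt_eqF// rhoR_gt0.
transitivity ((rhoR (alpha n))^-1 ^+ 2 *
    (1 - complex.Re (alpha n) ^+ 2 - complex.Im (alpha n) ^+ 2) *
    (pa n t * pd n t - pb n t * pc n t) * (cos t ^+ 2 + sin t ^+ 2)).
  by rewrite /prufer_step/=; ring.
by rewrite r2 ih cos2Dsin2 !mulr1.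
Qed.

Lemma transfer_prufer n t v :
  transfer alpha n (expi (t + t)) *m
    \matrix_(i < 2, j < 1) (if i == 0 then v.1 +i* v.2 else (v.1 +i* v.2)^*) =
  expi t ^+ n *:
    \matrix_(i < 2, j < 1) (if i == 0 then
       (prufer alpha n t v).1 +i* (prufer alpha n t v).2
       else ((prufer alpha n t v).1 +i* (prufer alpha n t v).2)^*).
Proof.
elim: n => [|n ih] /=.
  by rewrite mul1mx expr0 scale1r.
rewrite -mulmxA {}ih -scalemxAr exprS mulrC -scalerA; congr (_ *: _).
rewrite -scalemxAl rhoE.
move: (prufer _ _ _ _) => [x y] /=.
have r0 : rhoR (alpha n) != 0 by rewrite gt_eqF// rhoR_gt0.
have -> : (rhoR (alpha n))%:C^-1 = ((rhoR (alpha n))^-1)%:C by rewrite fmorphV.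
have cs := cos2Dsin2 t.
have key : (expi (t + t)) = (cos t ^+ 2 - sin t ^+ 2) +i* (2 * sin t * cos t).
  by rewrite expiD /expi; simpc; congr (_ +i* _); ring.
apply/matrixP => i j; rewrite !mxE !big_ord_recl big_ord0/= !mxE/= key.
move: (alpha n) => [p q] in r0 *; move: (_^-1) => r /=.
have [->|] := eqVneq i 0 => /=; last first.
  case: i => [[|[|//]]]//= ? _; rewrite /expi; simpc; congr (_ +i* _).
    (* The two sides agree only modulo [cos t ^+ 2 + sin t ^+ 2 = 1]; the cofactor is given
       explicitly so that [ring] can check it. *)
    apply: subr0_eq; transitivity (r * x * (1 - (cos t ^+ 2 + sin t ^+ 2))).
      by ring.
    by rewrite cs subrr mulr0.
  apply: subr0_eq; transitivity (- r * y * (1 - (cos t ^+ 2 + sin t ^+ 2))).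
    by ring.
  by rewrite cs subrr mulr0.
rewrite /expi; simpc; congr (_ +i* _).
  apply: subr0_eq; transitivity (r * (- p * x + q * y) * (1 - (cos t ^+ 2 + sin t ^+ 2))).
    by ring.
  by rewrite cs subrr mulr0.
apply: subr0_eq; transitivity (r * (q * x + p * y) * (1 - (cos t ^+ 2 + sin t ^+ 2))).
  by ring.
by rewrite cs subrr mulr0.
Qed.

End prufer_theory.

(** * Szegő recursion, trace and Dirichlet data in real form, zeros on the unit circle *)

Section opuc_theory.
Variables (R : realType) (alpha : nat -> R[i]).
Hypothesis alpha_lt1 : forall n, `|alpha n| < 1.
Implicit Types (t : R) (w z : R[i]).

Local Notation pa n t := (prufer alpha n t (1, 0)).1.
Local Notation pc n t := (prufer alpha n t (1, 0)).2.
Local Notation pb n t := (prufer alpha n t (0, 1)).1.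
Local Notation pd n t := (prufer alpha n t (0, 1)).2.

Lemma conj_complex (x y : R) : (x +i* y)^* = x -i* y.
Proof. by []. Qed.

Lemma transfer_ones n t :
  transfer alpha n (expi (t + t)) *m const_mx 1 =
  expi t ^+ n *: \matrix_(i < 2, j < 1)
    (if i == 0 then pa n t +i* pc n t else (pa n t +i* pc n t)^*).
Proof.
rewrite -transfer_prufer//; congr (_ *m _); apply/matrixP => i j.
by rewrite !mxE/=; case: ifP => // _; rewrite conj_complex oppr0.
Qed.

(** The images of the independent vectors [(1, 1)] and [(i, -i)] determine the matrix; comparing
    real and imaginary parts leaves linear equations. *)
Lemma trace_transfer n t :
  \tr (transfer alpha n (expi (t + t))) = expi t ^+ n * (pa n t + pd n t)%:C.
Proof.
have h1 := transfer_prufer alpha_lt1 n t (1, 0).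
have h2 := transfer_prufer alpha_lt1 n t (0, 1).
move: h1 h2; move: (transfer _ _ _) => T; move: (_ ^+ _) => e.
move: (prufer _ _ _ _) => [a c]; move: (prufer _ _ _ _) => [b d] /=.
move=> /matrixP h1 /matrixP h2.
have := h1 0 0; have := h1 1 0; have := h2 0 0; have := h2 1 0.
rewrite !mxE !big_ord_recl !big_ord0 /= !mxE/= !conj_complex => e4 e3 e2 e1.
rewrite /mxtrace !big_ord_recl big_ord0 addr0 /=.
have l1 : lift ord0 ord0 = 1 :> 'I_2 by apply/val_inj.
move: e1 e2 e3 e4; rewrite !l1.
have -> : ord0 = 0 :> 'I_2 by [].
rewrite !addr0; clear h1 h2; move: (T 0 0) (T 0 1) (T 1 0) (T 1 1) e => [x1 y1] [x2 y2] [x3 y3] [x4 y4] [x y].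
rewrite /=; simpc => -[h1 h2] [h3 h4] [h5 h6] [h7 h8].
by congr (_ +i* _); lra.
Qed.

Lemma discriminant_prufer n t : ~~ odd n ->
  discriminant alpha n (expi (t + t)) = (pa n t + pd n t)%:C.
Proof.
move=> n_even; rewrite /discriminant trace_transfer mulrA.
have -> : expi (t + t) = expi t ^+ 2 by rewrite expiD expr2.
rewrite -exprM mul2n (_ : n./2.*2 = n); last first.
  by rewrite -{2}(odd_double_half n) (negbTE n_even).
by rewrite mulVf ?mul1r// expf_neq0// expi_neq0.
Qed.

Lemma dirichlet_prufer n t : dirichlet alpha n (expi (t + t)) <-> pc n t = 0.
Proof.
have e0 : expi t ^+ n != 0 by rewrite expf_neq0// expi_neq0.
split=> [[_ [l]]|c0].
  rewrite transfer_ones => /matrixP h.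
  have := h 0 0; have := h 1 0; rewrite !mxE/= conj_complex mulr1 => <-.
  by move/(mulfI e0) => -[/eqP]; rewrite -addr_eq0 -mulr2n mulrn_eq0/= => /eqP.
split; first exact: norm_expi.
exists (expi t ^+ n * (pa n t)%:C); rewrite transfer_ones c0.
apply/matrixP => i j; rewrite !mxE conj_complex oppr0 mulr1.
by case: ifP.
Qed.

Lemma rho_neq0 n : rho alpha n != 0.
Proof. by rewrite rhoE// eq_complex/= eqxx andbT gt_eqF// rhoR_gt0. Qed.

Lemma rho_gt0 n : 0 < rho alpha n.
Proof. by rewrite rhoE// -[0]/(0%:C) ltcR rhoR_gt0. Qed.

Lemma conj_rhoV n : ((rho alpha n)^-1)^* = (rho alpha n)^-1.
Proof. by rewrite rhoE// -fmorphV conj_complex oppr0. Qed.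

Lemma revpolyZ n (c : R[i]) q : revpoly n (c *: q) = c^* *: revpoly n q.
Proof.
apply/polyP => i; rewrite coefZ !coef_poly; case: ifP => _; last by rewrite mulr0.
by rewrite coefZ rmorphM.
Qed.

Lemma size_phi_le n : (size (phi alpha n) <= n.+1)%N.
Proof.
elim: n => [|n ih]; first by rewrite size_poly1.
apply: leq_trans (size_scale_leq _ _) _.
apply: leq_trans (size_polyD _ _) _; rewrite geq_max size_polyN.
rewrite (leq_trans (size_polyMleq _ _))/=; last by rewrite size_polyX.
by rewrite (leq_trans (size_scale_leq _ _))// (leq_trans (size_poly _ _)).
Qed.

Lemma coef_phi_gt0 n : 0 < (phi alpha n)`_n.
Proof.
elim: n => [|n ih]; first by rewrite coef1 ltr01.
rewrite /= coefZ coefB coefXM/= coefZ coef_poly ltnn mulr0 subr0.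
by rewrite mulr_gt0// invr_gt0 rho_gt0.
Qed.

Lemma lead_coef_phi n : lead_coef (phi alpha n) = (phi alpha n)`_n.
Proof.
rewrite lead_coefE; congr (_`_ _); apply/eqP.
have := size_phi_le n; rewrite leq_eqVlt => /predU1P[->//|].
rewrite ltnS => /leq_sizeP/(_ _ (leqnn n)) h.
by have := coef_phi_gt0 n; rewrite h ltxx.
Qed.

(** The companion Szegő recursion: reversal at degree [n.+1] exchanges ['X * phi alpha n] and the
    reversed polynomial of degree [n]. *)
Lemma revpoly_phiS n : revpoly n.+1 (phi alpha n.+1) =
  (rho alpha n)^-1 *: (revpoly n (phi alpha n) - alpha n *: ('X * phi alpha n)).
Proof.
rewrite /= revpolyZ conj_rhoV; congr (_ *: _); apply/polyP => i.
rewrite !(coefB, coefZ, coef_poly, coefXM).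
rewrite ltnS; case: (leqP i n.+1) => [|ni]; last first.
  rewrite ltnNge (ltnW ni)/= sub0r; case: i ni => // i ni /=.
  rewrite nth_default ?mulr0 ?oppr0//.
  by rewrite (leq_trans (size_phi_le n)).
rewrite leq_eqVlt => /predU1P[->|].
  by rewrite subnn ltnn/= !sub0r subn0 rmorphN rmorphM/= !conjCK.
move=> ni; rewrite ni subSn//= rmorphB rmorphM/= conjCK; congr (_ - _ * _).
case: i ni => [|i] ni /=; first by rewrite subn0 ltnn conjC0.
by rewrite subnSK// ltnS leq_subr conjCK subKn// -ltnS ltnW.
Qed.

Lemma transfer_phi n z :
  transfer alpha n z *m const_mx 1 =
  \matrix_(i < 2, j < 1) (if i == 0 then (phi alpha n).[z]
                          else (revpoly n (phi alpha n)).[z]).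
Proof.
elim: n => [|n ih].
  rewrite /= mul1mx; apply/matrixP => i j; rewrite !mxE.
  case: ifP => _; first by rewrite hornerC.
  by rewrite /revpoly poly_def big_ord_recl big_ord0 addr0 coef1 conjC1
    scale1r hornerC.
rewrite [LHS]/= -mulmxA ih -scalemxAl; apply/matrixP => i j.
rewrite revpoly_phiS !mxE !big_ord_recl big_ord0/= !mxE/= !hornerE/=.
by case: i => [[|[|//]]]//= ?; congr (_ * _); ring.
Qed.

(** A_n(z) is diag(z, 1) followed by a matrix that preserves the indefinite form |v|^2 - |u|^2. *)
Lemma phi_phistar_norm n z : let u := (phi alpha n).[z] in
    let v := (revpoly n (phi alpha n)).[z] in
  let u' := (phi alpha n.+1).[z] in
  let v' := (revpoly n.+1 (phi alpha n.+1)).[z] in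
  `|v'| ^+ 2 - `|u'| ^+ 2 = `|v| ^+ 2 - `|z| ^+ 2 * `|u| ^+ 2.
Proof.
have r0 := rho_neq0 n.
have r2 : (rho alpha n)^-1 ^+ 2 * (1 - alpha n * (alpha n)^*) = 1.
  rewrite -normCK rhoE// -fmorphV -rmorphXn -add_Re2_Im2 -[X in X - _]/(1%:C).
  rewrite -rmorphB -rmorphM opprD addrA -rhoR_sq// -exprMn mulVf ?expr1n//.
  by rewrite gt_eqF// rhoR_gt0.
rewrite revpoly_phiS /= !hornerE/= !normCK !(rmorphM, rmorphB)/= conj_rhoV conjCK.
move: (_.[z]) (_.[z]) => u v.
transitivity ((rho alpha n)^-1 ^+ 2 * (1 - alpha n * (alpha n)^*) *
    (v * v^* - z * z^* * (u * u^*))); first by ring.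
by rewrite r2 mul1r -[RHS]/(_ - _) -[X in _ = _ - X]mulrA -expr2 normCK.
Qed.

(** One step turns |v|^2 - |u|^2 into |v|^2 - |z|^2 |u|^2, which is positive once [v != 0] and
    [|u| <= |v|]; both conditions then persist, and the inequality is strict from the first step
    on. *)
Lemma phi_lt_phistar n z : `|z| < 1 ->
  `|(phi alpha n).[z]| <= `|(revpoly n (phi alpha n)).[z]| ?= iff (n == 0)%N.
Proof.
move=> z1.
have step k : (revpoly k (phi alpha k)).[z] != 0 ->
    `|(phi alpha k).[z]| <= `|(revpoly k (phi alpha k)).[z]| ->
    `|(phi alpha k.+1).[z]| < `|(revpoly k.+1 (phi alpha k.+1)).[z]|.
  move=> v0 uv; rewrite -(ltr_pXn2r (n := 2)) ?nnegrE// -subr_gt0.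
  rewrite phi_phistar_norm subr_gt0 -exprMn ltr_pXn2r ?nnegrE ?mulr_ge0//.
  apply: le_lt_trans (ler_wpM2l _ uv) _ => //.
  by rewrite gtr_pMl// normr_gt0.
have rec k : (revpoly k (phi alpha k)).[z] != 0 /\
    `|(phi alpha k).[z]| <= `|(revpoly k (phi alpha k)).[z]|.
  elim: k => [|k [v0 uv]].
    rewrite /revpoly poly_def big_ord_recl big_ord0 addr0 coef1 conjC1.
    by rewrite scale1r !hornerC oner_eq0.
  have := step _ v0 uv => /[dup] /ltW -> h; split => //.
  by rewrite -normr_gt0 (le_lt_trans _ h).
split; first by case: (rec n).
case: n => [|n]; last by case: (rec n) => v0 uv; rewrite lt_eqF ?step.
rewrite /revpoly poly_def big_ord_recl big_ord0 addr0 coef1 conjC1.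
by rewrite scale1r !hornerC !eqxx.
Qed.

Lemma phistar_lt_phi n z : 1 < `|z| ->
  `|(revpoly n (phi alpha n)).[z]| <= `|(phi alpha n).[z]| ?= iff (n == 0)%N.
Proof.
move=> z1.
have step k : (phi alpha k).[z] != 0 ->
    `|(revpoly k (phi alpha k)).[z]| <= `|(phi alpha k).[z]| ->
    `|(revpoly k.+1 (phi alpha k.+1)).[z]| < `|(phi alpha k.+1).[z]|.
  move=> v0 uv; rewrite -(ltr_pXn2r (n := 2)) ?nnegrE// -subr_lt0.
  rewrite phi_phistar_norm subr_lt0 -exprMn ltr_pXn2r ?nnegrE ?mulr_ge0//.
  apply: (le_lt_trans uv).
  by rewrite ltr_pMl// normr_gt0.
have rec k : (phi alpha k).[z] != 0 /\
    `|(revpoly k (phi alpha k)).[z]| <= `|(phi alpha k).[z]|.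
  elim: k => [|k [v0 uv]].
    rewrite /revpoly poly_def big_ord_recl big_ord0 addr0 coef1 conjC1.
    by rewrite scale1r !hornerC oner_eq0.
  have := step _ v0 uv => /[dup] /ltW -> h; split => //.
  by rewrite -normr_gt0 (le_lt_trans _ h).
split; first by case: (rec n).
case: n => [|n]; last by case: (rec n) => v0 uv; rewrite lt_eqF ?step.
rewrite /revpoly poly_def big_ord_recl big_ord0 addr0 coef1 conjC1.
by rewrite scale1r !hornerC !eqxx.
Qed.

Lemma phi_eq_phistar n z : (0 < n)%N ->
  (phi alpha n).[z] = (revpoly n (phi alpha n)).[z] -> `|z| = 1.
Proof.
move=> n0 e.
have [z1|z1|//] := real_ltgtP (normr_real z) (real1 _).
  by have [_] := phi_lt_phistar n z1; rewrite e eqxx => /esym/eqP n00; rewrite n00 in n0.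
by have [_] := phistar_lt_phi n z1; rewrite e eqxx => /esym/eqP n00; rewrite n00 in n0.
Qed.

Lemma root_Phi n z : root (Phi alpha n - revpoly n (Phi alpha n)) z <->
  (phi alpha n).[z] = (revpoly n (phi alpha n)).[z].
Proof.
have c0 : lead_coef (phi alpha n) != 0.
  by rewrite lead_coef_phi gt_eqF// coef_phi_gt0.
rewrite /Phi revpolyZ; have -> : ((lead_coef (phi alpha n))^-1)^* =
    (lead_coef (phi alpha n))^-1.
  by apply: CrealP; rewrite realV lead_coef_phi gtr0_real// coef_phi_gt0.
rewrite -scalerBr rootE hornerZ mulf_eq0 invr_eq0 (negbTE c0)/= hornerD hornerN.
by rewrite subr_eq0; split => /eqP.
Qed.

Lemma root_Phi_prufer n t :
  root (Phi alpha n - revpoly n (Phi alpha n)) (expi (t + t)) <-> pc n t = 0.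
Proof.
have e0 : expi t ^+ n != 0 by rewrite expf_neq0// expi_neq0.
rewrite root_Phi; have /matrixP h := transfer_phi n (expi (t + t)).
rewrite transfer_ones in h; have := h 0 0; have := h 1 0.
rewrite !mxE/= => <- <-; rewrite conj_complex; split=> [/(mulfI e0)|->].
  by move=> -[/eqP]; rewrite -addr_eq0 -mulr2n mulrn_eq0/= => /eqP.
by rewrite oppr0.
Qed.

End opuc_theory.

(** * Derivative of the real transfer matrices and the sign of D' *)

Section prufer_derivative.
Variables (R : realType) (alpha : nat -> R[i]).
Hypothesis alpha_lt1 : forall n, `|alpha n| < 1.
Implicit Types (t : R).

Local Notation pa n t := (prufer alpha n t (1, 0)).1.
Local Notation pc n t := (prufer alpha n t (1, 0)).2.
Local Notation pb n t := (prufer alpha n t (0, 1)).1.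
Local Notation pd n t := (prufer alpha n t (0, 1)).2.

(** The three sums are the entries of G = sum of N_k^T N_k over k < n, where N_k has the columns
    [(pa, pc)] and [(pb, pd)]. *)
Definition gram11 n t := \sum_(k < n) (pa k t ^+ 2 + pc k t ^+ 2).
Definition gram12 n t := \sum_(k < n) (pa k t * pb k t + pc k t * pd k t).
Definition gram22 n t := \sum_(k < n) (pb k t ^+ 2 + pd k t ^+ 2).

Lemma gram11S n t : gram11 n.+1 t = gram11 n t + (pa n t ^+ 2 + pc n t ^+ 2).
Proof. by rewrite /gram11 big_ord_recr. Qed.

Lemma gram12S n t :
  gram12 n.+1 t = gram12 n t + (pa n t * pb n t + pc n t * pd n t).
Proof. by rewrite /gram12 big_ord_recr. Qed.

Lemma gram22S n t : gram22 n.+1 t = gram22 n t + (pb n t ^+ 2 + pd n t ^+ 2).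
Proof. by rewrite /gram22 big_ord_recr. Qed.

Lemma is_derive_prufer_step (f g : R -> R) (a : R[i]) t df dg :
  is_derive t 1 f df -> is_derive t 1 g dg ->
  is_derive t 1 (fun u => (prufer_step a u (f u, g u)).1)
    ((rhoR a)^-1 * ((1 - complex.Re a) * (cos t * df - sin t * dg - (sin t * f t + cos t * g t))
     + complex.Im a * (sin t * df + cos t * dg + (cos t * f t - sin t * g t)))) /\
  is_derive t 1 (fun u => (prufer_step a u (f u, g u)).2)
    ((rhoR a)^-1 * (complex.Im a * (cos t * df - sin t * dg - (sin t * f t + cos t * g t))
     + (1 + complex.Re a) * (sin t * df + cos t * dg + (cos t * f t - sin t * g t)))).
Proof.
move=> hf hg; set r := (rhoR a)^-1; set x := complex.Re a; set y := complex.Im a.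
have h1 := is_deriveB (is_deriveM (is_derive_cos t) hf) (is_deriveM (is_derive_sin t) hg).
have h2 := is_deriveD (is_deriveM (is_derive_sin t) hf) (is_deriveM (is_derive_cos t) hg).
have lin (k1 k2 : R) := is_deriveZ r (is_deriveD (is_deriveZ k1 h1) (is_deriveZ k2 h2)).
split.
  apply: (is_derive_eq (lin (1 - x) y)).
  by rewrite -![_ *: _]/(_ * _); ring.
apply: (is_derive_eq (lin y (1 + x))).
by rewrite -![_ *: _]/(_ * _); ring.
Qed.

(** For N = [[a, b], [c, d]] of determinant 1, N J N^T = J, so that the term J N produced by
    differentiating the new rotation equals N J (N^T N) and is absorbed into the Gram sums. The pair
    [x], [y] stands for a row of the next step. *)
Lemma gram_step (a b c d g1 g2 g3 : R) :
  a * d - b * c = 1 ->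
  let h1 := g1 + (a ^+ 2 + c ^+ 2) in
  let h2 := g2 + (a * b + c * d) in
  let h3 := g3 + (b ^+ 2 + d ^+ 2) in
  [/\ forall x y, x * (b * g1 - a * g2 - c) + y * (d * g1 - c * g2 + a) =
        x * (b * h1 - a * h2) + y * (d * h1 - c * h2) &
      forall x y, x * (b * g2 - a * g3 - d) + y * (d * g2 - c * g3 + b) =
        x * (b * h2 - a * h3) + y * (d * h2 - c * h3)].
Proof.
move=> det h1 h2 h3; split=> x y; apply: subr0_eq.
  transitivity ((y * a - x * c) * (1 - (a * d - b * c))); first by rewrite /h1 /h2; ring.
  by rewrite det subrr mulr0.
transitivity ((y * b - x * d) * (1 - (a * d - b * c))); first by rewrite /h2 /h3; ring.
by rewrite det subrr mulr0.
Qed.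

(** The product rule gives N_n' = N_n times the sum of N_k^{-1} J N_k, and N_k^{-1} J = J N_k^T by
    unimodularity; hence N_n' = N_n J G. *)
Lemma is_derive_prufer n t :
  [/\ is_derive t 1 (fun t => pa n t) (pb n t * gram11 n t - pa n t * gram12 n t),
      is_derive t 1 (fun t => pb n t) (pb n t * gram12 n t - pa n t * gram22 n t),
      is_derive t 1 (fun t => pc n t) (pd n t * gram11 n t - pc n t * gram12 n t) &
      is_derive t 1 (fun t => pd n t) (pd n t * gram12 n t - pc n t * gram22 n t)].
Proof.
elim: n => [|n [ia ib ic id]].
  rewrite /gram11 /gram12 /gram22 !big_ord0 !mulr0 subr0.
  by split; exact: is_derive_cst.
have [a' c'] := is_derive_prufer_step (alpha n) ia ic.
have [b' d'] := is_derive_prufer_step (alpha n) ib id.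
have det := prufer_det alpha_lt1 n t.
rewrite gram11S gram12S gram22S /=.
clear ia ib ic id; move: (gram11 n t) (gram12 n t) (gram22 n t) a' b' c' d' => g1 g2 g3.
rewrite /prufer_step/=; move: (prufer alpha n t _) (prufer alpha n t _) det.
move=> [b d] [a c] /= /(gram_step g1 g2 g3)/= [h1 h2] a' b' c' d'.
set r := (rhoR _)^-1 in a' b' c' d' *.
set p := complex.Re _ in a' b' c' d' *; set q := complex.Im _ in a' b' c' d' *.
have h p' q' := conj (h1 (r * (p' * cos t + q' * sin t)) (r * (q' * cos t - p' * sin t)))
  (h2 (r * (p' * cos t + q' * sin t)) (r * (q' * cos t - p' * sin t))).
have [h3 h4] := h (1 - p) q; have [h5 h6] := h q (1 + p).
split.
- apply: (is_derive_eq a'); apply: (etrans (etrans _ h3)); ring.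
- apply: (is_derive_eq b'); apply: (etrans (etrans _ h4)); ring.
- apply: (is_derive_eq c'); apply: (etrans (etrans _ h5)); ring.
- apply: (is_derive_eq d'); apply: (etrans (etrans _ h6)); ring.
Qed.

(** The second factor is the sum over k of the form B x^2 + (D - A) x y - C y^2 at the two rows of
    N_k. Its discriminant is (A + D)^2 - 4 < 0, so that it is definite with the sign of -C. *)
Lemma prufer_trace_derive_sign n t : (0 < n)%N ->
  `|pa n t + pd n t| < 2 ->
  pc n t * (pb n t * gram11 n t - pa n t * gram12 n t +
    (pd n t * gram12 n t - pc n t * gram22 n t)) < 0.
Proof.
move=> n0; rewrite ltr_norml => /andP[h1 h2].
have det := prufer_det alpha_lt1 n t.
set A := pa n t in h1 h2 det *; set B := pb n t in det *.
set C := pc n t in det *; set D := pd n t in h1 h2 det *.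
have qneg (x y : R) : C * (B * x ^+ 2 + (D - A) * (x * y) - C * y ^+ 2) =
    - (C * y - (D - A) * x / 2) ^+ 2 - (1 - ((A + D) / 2) ^+ 2) * x ^+ 2.
  have -> : C * (B * x ^+ 2 + (D - A) * (x * y) - C * y ^+ 2) =
    B * C * x ^+ 2 + C * (D - A) * (x * y) - C ^+ 2 * y ^+ 2 by ring.
  have -> : B * C = A * D - 1 by lra.
  by field.
have k0 : 0 < 1 - ((A + D) / 2) ^+ 2.
  have -> : 1 - ((A + D) / 2) ^+ 2 = (2 - (A + D)) * (2 + (A + D)) / 4 by field.
  by rewrite divr_gt0// mulr_gt0//; lra.
have qle (x y : R) : C * (B * x ^+ 2 + (D - A) * (x * y) - C * y ^+ 2) <= 0.
  by rewrite qneg subr_le0 (le_trans (y := 0))// ?oppr_le0 ?sqr_ge0// mulr_ge0 ?sqr_ge0 ?ltW.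
(* This is the summand k = 0, where N_0 = 1; it supplies the strict inequality, the other summands
   being only bounded by 0. *)
have qlt : C * (B - C) < 0.
  have -> : C * (B - C) = A * D - 1 - C ^+ 2 by rewrite -det; ring.
  have := sqr_ge0 (A - D); have := sqr_ge0 C.
  have -> : A * D = ((A + D) / 2) ^+ 2 - (A - D) ^+ 2 / 4 by field.
  lra.
suff: forall k, C * (B * gram11 k.+1 t - A * gram12 k.+1 t +
    (D * gram12 k.+1 t - C * gram22 k.+1 t)) < 0 by move=> /(_ n.-1); rewrite prednK.
elim=> [|k ih].
  rewrite /gram11 /gram12 /gram22 !big_ord_recl !big_ord0/=.
  apply: le_lt_trans qlt; rewrite le_eqVlt; apply/orP; left; apply/eqP; ring.
rewrite gram11S gram12S gram22S.
move: ih (qle (pa k.+1 t) (pb k.+1 t)) (qle (pc k.+1 t) (pd k.+1 t)).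
move: (gram11 k.+1 t) (gram12 k.+1 t) (gram22 k.+1 t) => g1 g2 g3.
move: (prufer alpha k.+1 t (1, 0)) (prufer alpha k.+1 t (0, 1)) => [a c] [b d] /= ih q1 q2.
set X := (X in X < 0); have -> : X = C * (B * g1 - A * g2 + (D * g2 - C * g3)) +
   C * (B * a ^+ 2 + (D - A) * (a * b) - C * b ^+ 2) +
   C * (B * c ^+ 2 + (D - A) * (c * d) - C * d ^+ 2) by rewrite /X; ring.
lra.
Qed.

Definition disc n (theta : R) : R := pa n (theta / 2) + pd n (theta / 2).
Definition dirf n (theta : R) : R := pc n (theta / 2).

Lemma discriminant_disc n theta : ~~ odd n ->
  discriminant alpha n (expi theta) = (disc n theta)%:C.
Proof. by move=> n_even; rewrite {1}[theta]splitr discriminant_prufer. Qed.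

Lemma dirichlet_dirf n theta : dirichlet alpha n (expi theta) <-> dirf n theta = 0.
Proof. by rewrite {1}[theta]splitr dirichlet_prufer. Qed.

Lemma root_Phi_dirf n theta :
  root (Phi alpha n - revpoly n (Phi alpha n)) (expi theta) <-> dirf n theta = 0.
Proof. by rewrite {1}[theta]splitr root_Phi_prufer. Qed.

Lemma is_derive_disc n (theta : R) :
  let t := theta / 2 in
  is_derive theta 1 (disc n) (2^-1 * (pb n t * gram11 n t - pa n t * gram12 n t +
    (pd n t * gram12 n t - pc n t * gram22 n t))).
Proof.
move=> t; have [da _ _ dd] := is_derive_prufer n t.
have h : is_derive theta 1 (fun u : R => u / 2) 2^-1.
  rewrite (_ : (fun u : R => u / 2) = 2^-1 *: id); last first.
    by apply/funext => u; rewrite mulrC.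
  by apply: is_derive_eq; rewrite -[_ *: _]/(_ * _) mulr1.
have := is_derive1_comp (g := fun u : R => u / 2) (is_deriveD da dd) h.
by rewrite mulrC.
Qed.

Lemma continuous_disc n : continuous (disc n).
Proof.
move=> t; apply/differentiable_continuous/derivable1_diffP.
by have h := is_derive_disc n t; exact: ex_derive.
Qed.

Lemma continuous_dirf n : continuous (dirf n).
Proof.
move=> t; apply: (@continuous_comp _ _ _ (fun u : R => u / 2) (fun u => pc n u)).
  exact: mulrr_continuous.
apply/differentiable_continuous/derivable1_diffP.
have [_ _ h _] := is_derive_prufer n (t / 2); exact: ex_derive.
Qed.

Lemma disc_derive_sign n theta : (0 < n)%N -> `|disc n theta| < 2 ->
  dirf n theta * derive1 (disc n) theta < 0.
Proof.
move=> n0 h; rewrite derive1E; have d := is_derive_disc n theta.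
rewrite derive_val mulrCA pmulr_rlt0 ?invr_gt0//.
exact: prufer_trace_derive_sign.
Qed.

Lemma derivable_disc n theta : derivable (disc n) theta 1.
Proof. by have h := is_derive_disc n theta; exact: ex_derive. Qed.

End prufer_derivative.

(** * Trigonometry and Chebyshev polynomials *)

Section unit_circle.
Variable R : realType.
Implicit Types s t u : R.

Lemma cos_open_itv (u : R) : 0 < u < pi -> -1 < cos u < 1.
Proof.
move=> /andP[u0 upi]; apply/andP; split.
  by rewrite -cospi ltr_cos ?in_itv/= ?lexx ?pi_ge0 ?(ltW u0) ?(ltW upi).
by rewrite -cos0 ltr_cos ?in_itv/= ?lexx ?pi_ge0 ?(ltW u0) ?(ltW upi).
Qed.

Lemma expiD2pi t : expi (t + 2 * pi) = expi t.
Proof. by rewrite /expi (mulr_natl pi 2) sinD2pi cosD2pi. Qed.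

Lemma cos_eq1 t : 0 <= t < 2 * pi -> cos t = 1 -> t = 0.
Proof.
move=> /andP[t0 t2] c1; apply: le_anti; rewrite t0 andbT leNgt; apply/negP => tp.
have : 0 < sin (t / 2) by rewrite sin_gt0_pi// divr_gt0// ltr_pdivrMr// mulrC.
have := cos_mulr2n (t / 2); rewrite -(mulr_natr (t / 2)) divfK// c1 => h.
have := cos2Dsin2 (t / 2); rewrite [cos _ ^+ 2](_ : _ = 1); last by move: h; rewrite mulr2n; lra.
rewrite -[RHS]addr0 => /addrI/eqP; rewrite sqrf_eq0 => /eqP ->.
by rewrite ltxx.
Qed.

Lemma expi_inj s t : `|s - t| < 2 * pi -> expi s = expi t -> s = t.
Proof.
move=> st [c_eq s_eq].
have : cos `|s - t| = 1.
  by rewrite cos_norm cosB c_eq s_eq -!expr2 cos2Dsin2.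
move=> /cos_eq1; rewrite normr_ge0 st => /(_ isT)/eqP.
by rewrite normr_eq0 subr_eq0 => /eqP.
Qed.

Lemma unit_expi (z : R[i]) : `|z| = 1 -> exists2 t, - pi <= t <= pi & z = expi t.
Proof.
case: z => a b; rewrite normc_def/= => -[/eqP].
rewrite -(eqrXn2 (n := 2)) ?sqrtr_ge0// sqr_sqrtr ?addr_ge0 ?sqr_ge0// expr1n => /eqP ab.
have a1 : -1 <= a <= 1.
  by rewrite -ler_norml -(ler_pXn2r (n := 2)) ?nnegrE// expr1n real_normK ?num_real// -ab lerDl sqr_ge0.
have a0 := acos_ge0 a1; have api := acos_lepi a1.
have sb : sin (acos a) = `|b|.
  by rewrite sin_acos// -ab addrC addKr sqrtr_sqr.
have [b0|b0] := leP 0 b.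
  exists (acos a); first by rewrite api andbT (le_trans _ a0)// oppr_le0 pi_ge0.
  by rewrite /expi acosK ?in_itv/= ?a1// sb ger0_norm.
exists (- acos a); first by rewrite lerN2 api/= (le_trans _ (pi_ge0 _))// oppr_le0.
by rewrite /expi sinN cosN acosK ?in_itv/= ?a1// sb ltr0_norm// opprK.
Qed.

Lemma unit_expi_period a (z : R[i]) : 0 <= a < 2 * pi -> `|z| = 1 ->
  exists2 t, a <= t < a + 2 * pi & z = expi t.
Proof.
move=> /andP[a0 a2] /unit_expi[t /andP[t1 t2] ->]; have pi0 := pi_gt0 R.
have [at_|ta] := leP a t; first by exists t => //; rewrite at_/=; lra.
have [at2|ta2] := leP a (t + 2 * pi).
  by exists (t + 2 * pi); rewrite ?expiD2pi// at2/=; lra.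
exists (t + 2 * pi + 2 * pi); rewrite ?expiD2pi//; lra.
Qed.

Lemma sin_natpi q : sin (q%:R * pi) = 0 :> R.
Proof.
elim: q => [|q ih]; first by rewrite mul0r sin0.
by rewrite -natr1 mulrDl mul1r sinDpi ih oppr0.
Qed.

Lemma sin_eq0_pos t : 0 < t -> sin t = 0 -> exists2 q, (0 < q)%N & t = q%:R * pi.
Proof.
move=> t0 st; have pi0 := pi_gt0 R.
have [n tn] : exists n, t < n%:R * pi.
  exists (Num.truncn (t / pi)).+1; rewrite -ltr_pdivrMr//.
  by apply: truncnS_gt.
elim: n t t0 st tn => [|n ih] t t0 st; first by rewrite mul0r ltNge (ltW t0).
move=> tn; have [tp|pt|->] := ltgtP t pi; last by exists 1%N; rewrite ?mul1r.
  by have := @sin_gt0_pi _ t; rewrite t0 tp st ltxx => /(_ isT).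
have [||| q q0 e] := ih (t - pi).
- by rewrite subr_gt0.
- by have := sinDpi (t - pi); rewrite subrK st => /eqP; rewrite eq_sym oppr_eq0 => /eqP.
- by move: tn; rewrite -natr1 mulrDl mul1r ltrBlDr.
by exists q.+1 => //; rewrite -natr1 mulrDl mul1r -e subrK.
Qed.

End unit_circle.

(* [U_(m-1) (x / 2)], the Chebyshev polynomial of the second kind, with [U_(-1) = 0]. *)
Fixpoint cheb2 {R : realType} (m : nat) (x : R) : R :=
  match m with
  | 0 => 0
  | 1 => 1
  | (k.+1 as l).+1 => x * cheb2 l x - cheb2 k x
  end.

Section chebyshev.
Variable R : realType.
Implicit Types x u : R.

Lemma cheb2SS m x : cheb2 m.+2 x = x * cheb2 m.+1 x - cheb2 m x.
Proof. by []. Qed.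

Lemma sin_cheb2 m u : sin u * cheb2 m (2 * cos u) = sin (m%:R * u).
Proof.
have [//] : sin u * cheb2 m (2 * cos u) = sin (m%:R * u) /\
  sin u * cheb2 m.+1 (2 * cos u) = sin (m.+1%:R * u).
elim: m => [|m [h1 h2]]; first by rewrite mulr0 mul0r sin0 mulr1 mul1r.
split => //; rewrite cheb2SS mulrBr h1 mulrCA h2 -!natr1 !mulrDl mul1r.
rewrite !(sinD, cosD); apply: subr0_eq.
transitivity (sin (m%:R * u) * (cos u ^+ 2 + sin u ^+ 2 - 1)); first by ring.
by rewrite cos2Dsin2 subrr mulr0.
Qed.

(** For [|x| >= 2] the recursion makes the absolute values grow by at least 1 at each step. *)
Lemma cheb2_neq0 m x : 2 <= `|x| -> cheb2 m.+1 x != 0.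
Proof.
move=> x2; rewrite -normr_gt0.
suff [_ h] : `|cheb2 m x| + 1 <= `|cheb2 m.+1 x| /\ 1 <= `|cheb2 m.+1 x|.
  exact: lt_le_trans h.
elim: m => [|m [h1 h2]]; first by rewrite /= normr0 normr1 add0r.
have : `|x * cheb2 m.+1 x| - `|cheb2 m x| <= `|cheb2 m.+2 x|.
  exact: lerB_dist.
rewrite normrM; move: h1 h2 x2.
move: `|_| `|_| `|_| `|_| => a b c d; nra.
Qed.

(** A root has [|x| < 2], hence x = 2 cos u with 0 < u < pi; there sin u > 0, and the roots are
    those of sin (m u). *)
Lemma cheb2_root m x : (0 < m)%N -> cheb2 m x = 0 <->
  exists2 q, (1 <= q <= m.-1)%N & x = 2 * cos (q%:R / m%:R * pi).
Proof.
case: m => // m _; have pi0 := pi_gt0 R; split=> [h|[q /andP[q1 q2] ->]].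
  have [x2|x2] := leP 2 `|x|; first by have := cheb2_neq0 m x2; rewrite h eqxx.
  have x2' : -1 < x / 2 < 1 by move: x2; rewrite ltr_norml; lra.
  have [x21 x22] := andP x2'.
  have xx : x = 2 * cos (acos (x / 2)).
    by rewrite acosK ?in_itv/= ?(ltW x21) ?(ltW x22)// mulrC divfK.
  have u0 : 0 < acos (x / 2) by rewrite acos_gt0// (ltW x21) x22.
  have upi : acos (x / 2) < pi by rewrite acos_ltpi// x21 ltW.
  move: xx u0 upi; move: (acos _) => u xx u0 upi.
  have := sin_cheb2 m.+1 u; rewrite -xx h mulr0 => /esym/sin_eq0_pos[].
    by rewrite mulr_gt0.
  move=> q q0 qe; exists q; last first.
    by rewrite mulrAC -qe mulrAC divff ?mul1r.
  rewrite q0/= -ltnS -(ltr_nat R) -(ltr_pM2r pi0) -qe ltr_pM2l//.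
have h : sin (q%:R / m.+1%:R * pi) != 0 :> R.
  rewrite gt_eqF// sin_gt0_pi// mulr_gt0// ?divr_gt0 ?ltr0n//=.
  by rewrite gtr_pMl// ltr_pdivrMr ?ltr0n// mul1r ltr_nat ltnS.
apply: (mulfI h); rewrite sin_cheb2 mulr0 mulrA [m.+1%:R * _]mulrC divfK ?pnatr_eq0//.
exact: sin_natpi.
Qed.

End chebyshev.

(** * Intervals where |D| < 2 *)

Section continuous_interval.
Variable R : realType.
Implicit Types (f : R -> R) (a b t : R).

Lemma ivt f a b v : continuous f -> a <= b -> Num.min (f a) (f b) <= v <= Num.max (f a) (f b) ->
  exists2 t, a <= t <= b & f t = v.
Proof.
move=> cf ab h; have [|t tab <-] := IVT ab _ h; last by exists t.
exact: continuous_subspaceT.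
Qed.

Lemma lt_itv_edge_le f a b k : continuous f -> a < b ->
  (forall t, a < t < b -> f t < k) -> f a <= k /\ f b <= k.
Proof.
move=> cf ab fk; pose m := (a + b) / 2.
have [am mb] : a < m /\ m < b by rewrite /m; split; lra.
have fm : f m < k by apply: fk; rewrite am.
split; rewrite leNgt; apply/negP => kf.
  have [|t /andP[at_ tm] ft] := ivt (v := (k + f a) / 2) cf (ltW am).
    by rewrite minElt maxElt; case: ifP => ?; lra.
  have ta : a < t by rewrite lt_neqAle at_ andbT; apply/eqP => e; move: ft; rewrite -e; lra.
  by have := fk t; rewrite ta (le_lt_trans tm mb) ft => /(_ isT); lra.
have [|t /andP[mt tb] ft] := ivt (v := (k + f b) / 2) cf (ltW mb).
  by rewrite minElt maxElt; case: ifP => ?; lra.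
have bt : t < b by rewrite lt_neqAle tb andbT; apply/eqP => e; move: ft; rewrite e; lra.
by have := fk t; rewrite bt (lt_le_trans am mt) ft => /(_ isT); lra.
Qed.

Lemma neq0_const_sign f a b : continuous f -> (forall t, a < t < b -> f t != 0) ->
  (forall t, a < t < b -> 0 < f t) \/ (forall t, a < t < b -> f t < 0).
Proof.
move=> cf f0; have [[s sab fs]|] := pselect (exists2 s, a < s < b & f s < 0); last first.
  move=> h; left=> t tab; rewrite lt_neqAle eq_sym f0//= leNgt.
  by apply/negP => ft; apply: h; exists t.
right=> t tab; rewrite lt_neqAle f0//= leNgt; apply/negP => ft.
have [/andP[as_ sb] /andP[at_ tb]] := (sab, tab).
have [st|ts] := leP s t.
  have [|u /andP[su ut] fu] := ivt (v := 0) cf st.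
    by rewrite minElt maxElt; case: ifP => ?; lra.
  by have := f0 u; rewrite fu eqxx (lt_le_trans as_ su) (le_lt_trans ut tb) => /(_ isT).
have [|u /andP[su ut] fu] := ivt (v := 0) cf (ltW ts).
  by rewrite minElt maxElt; case: ifP => ?; lra.
by have := f0 u; rewrite fu eqxx (lt_le_trans at_ su) (le_lt_trans ut sb) => /(_ isT).
Qed.

End continuous_interval.

Section elliptic_intervals.
Variables (R : realType) (D C : R -> R).
Hypothesis cD : continuous D.
Hypothesis cC : continuous C.
Hypothesis dD : forall t, derivable D t 1.
Hypothesis CD : forall t, `|D t| < 2 -> C t * derive1 D t < 0.
Implicit Types a b c d s t v : R.

Lemma elliptic_neq0 t : `|D t| < 2 -> C t != 0.
Proof. by move=> /CD; apply: contraTneq => ->; rewrite mul0r ltxx. Qed.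

Lemma elliptic_incr a b : (forall t, a < t < b -> `|D t| < 2) ->
  (forall t, a < t < b -> C t < 0) -> {in `[a, b] &, {homo D : s t / s < t}}.
Proof.
move=> D2 C0; apply: gtr0_derive1_lt_cc.
- by move=> t _; exact: dD.
- move=> t; rewrite in_itv/= => tab; have := CD (D2 t tab).
  by rewrite nmulr_rlt0// C0.
- exact: continuous_subspaceT.
Qed.

Lemma elliptic_decr a b : (forall t, a < t < b -> `|D t| < 2) ->
  (forall t, a < t < b -> 0 < C t) -> {in `[a, b] &, {homo D : s t /~ s < t}}.
Proof.
move=> D2 C0; apply: ltr0_derive1_lt_cc.
- by move=> t _; exact: dD.
- move=> t; rewrite in_itv/= => tab; have := CD (D2 t tab).
  by rewrite pmulr_rlt0// C0.
- exact: continuous_subspaceT.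
Qed.

(* The sign of [C] is the opposite of that of [D']: if [C] had no zero between the two
   intervals, [D] would be monotone in the same direction on both of them, so that it
   would have to cross [-2, 2] in between. *)
Lemma zero_between_elliptic a b c d : a < b -> b <= c -> c < d ->
  (forall t, a < t < b -> `|D t| < 2) -> (forall t, c < t < d -> `|D t| < 2) ->
  (forall t, b <= t <= c -> 2 <= `|D t|) -> exists2 t, b <= t <= c & C t = 0.
Proof.
move=> ab bc cd Dab Dcd Dbc.
have [//|noz] := pselect (exists2 t, b <= t <= c & C t = 0).
have C0 t : a < t < d -> C t != 0.
  move=> /andP[at_ td]; have [tb|bt] := ltP t b.
    by apply: elliptic_neq0; apply: Dab; rewrite at_.
  have [ct|tc] := ltP c t; first by apply: elliptic_neq0; apply: Dcd; rewrite ct.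
  by apply/eqP => Ct; apply: noz; exists t => //; rewrite bt.
have no_cross : ~ exists2 t, b <= t <= c & D t = 0.
  by move=> [t /Dbc + Dt]; rewrite Dt normr0; lra.
have Db := Dbc b; have Dc := Dbc c; rewrite !lexx bc in Db Dc.
have {Db}Db := Db isT; have {Dc}Dc := Dc isT.
pose m := (a + b) / 2; pose n := (c + d) / 2.
have [am mb cn nd] : [/\ a < m, m < b, c < n & n < d] by rewrite /m /n; split; lra.
have := Dab m; rewrite am mb => /(_ isT); rewrite ltr_norml => /andP[Dm1 Dm2].
have := Dcd n; rewrite cn nd => /(_ isT); rewrite ltr_norml => /andP[Dn1 Dn2].
have [Cp|Cn] := neq0_const_sign cC C0.
  have Dmb : D b < D m.
    apply: (elliptic_decr Dab) => //; rewrite ?in_itv/= ?lexx ?(ltW ab) ?(ltW am) ?(ltW mb)//.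
    by move=> t /andP[at_ tb]; apply: Cp; rewrite at_ (lt_trans tb)// (le_lt_trans bc).
  have Dcn : D n < D c.
    apply: (elliptic_decr Dcd) => //; rewrite ?in_itv/= ?lexx ?(ltW cd) ?(ltW cn) ?(ltW nd)//.
    by move=> t /andP[ct td]; apply: Cp; rewrite td (lt_trans _ ct)// (lt_le_trans ab).
  have Db' : D b <= -2 by move: Db; rewrite lerNr ler_normr; lra.
  have Dc' : 2 <= D c by move: Dc; rewrite ler_normr; lra.
  exfalso; apply: no_cross; apply: ivt => //.
  by rewrite minElt maxElt; case: ifP => ?; lra.
have Dmb : D m < D b.
  apply: (elliptic_incr Dab) => //; rewrite ?in_itv/= ?lexx ?(ltW ab) ?(ltW am) ?(ltW mb)//.
  by move=> t /andP[at_ tb]; apply: Cn; rewrite at_ (lt_trans tb)// (le_lt_trans bc).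
have Dcn : D c < D n.
  apply: (elliptic_incr Dcd) => //; rewrite ?in_itv/= ?lexx ?(ltW cd) ?(ltW cn) ?(ltW nd)//.
  by move=> t /andP[ct td]; apply: Cn; rewrite td (lt_trans _ ct)// (lt_le_trans ab).
have Db' : 2 <= D b by move: Db; rewrite ler_normr; lra.
have Dc' : D c <= -2 by move: Dc; rewrite lerNr ler_normr; lra.
exfalso; apply: no_cross; apply: ivt => //.
by rewrite minElt maxElt; case: ifP => ?; lra.
Qed.

(** By continuity [|D| <= 2] at both ends, which together with the reverse bounds makes them 2 or
    -2; monotonicity makes the two values different. *)
Lemma elliptic_mono a b : a < b -> (forall t, a < t < b -> `|D t| < 2) ->
  2 <= `|D a| -> 2 <= `|D b| ->
  [/\ D a = 2, D b = -2 & {in `[a, b] &, {homo D : s t /~ s < t}}] \/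
  [/\ D a = -2, D b = 2 & {in `[a, b] &, {homo D : s t / s < t}}].
Proof.
move=> ab Dab Da Db.
have [Da1 Db1] : D a <= 2 /\ D b <= 2.
  by apply: lt_itv_edge_le => // t /Dab; rewrite ltr_norml => /andP[].
have [Da2 Db2] : - D a <= 2 /\ - D b <= 2.
  apply: (@lt_itv_edge_le _ (\- D)) => //.
    by move=> t; apply: continuousN; exact: cD.
  by move=> t /Dab; rewrite ltr_norml ltrNl => /andP[].
have a_in : a \in `[a, b] by rewrite in_itv/= lexx ltW.
have b_in : b \in `[a, b] by rewrite in_itv/= lexx ltW.
have [Cp|Cn] := neq0_const_sign cC (fun t h => elliptic_neq0 (Dab t h)).
  left; have h := elliptic_decr Dab Cp; have := h _ _ b_in a_in ab.
  by move: Da Db; rewrite !ler_normr => Da Db Dlt; split => //; lra.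
right; have h := elliptic_incr Dab Cn; have := h _ _ a_in b_in ab.
by move: Da Db; rewrite !ler_normr => Da Db Dlt; split => //; lra.
Qed.

End elliptic_intervals.

(** * Bands, gaps and Dirichlet data *)

Section band_geometry.
Variables (R : realType) (p : nat) (alpha : nat -> R[i]) (x y : nat -> R).
Hypothesis p_ge2 : (2 <= p)%N.
Hypothesis p_even : ~~ odd p.
Hypothesis alpha_lt1 : forall n, `|alpha n| < 1.
Hypothesis alpha_periodic : forall n, alpha (n + p)%N = alpha n.
Hypothesis edges : band_edges alpha p x y.
Implicit Types (s t : R) (i j : nat).

Local Notation D := (disc alpha p).
Local Notation C := (dirf alpha p).

Let p_gt0 : (0 < p)%N. Proof. exact: leq_trans p_ge2. Qed.

Lemma disc_periodic t : D (t + 2 * pi) = D t.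
Proof. by apply: complexI; rewrite -!discriminant_disc// expiD2pi. Qed.

Lemma x1_itv : 0 <= x 1 < 2 * pi. Proof. by case: edges. Qed.

Lemma disc_x1 : D (x 1) = 2.
Proof.
by case: edges => _ h _ _ _; apply: complexI; rewrite -discriminant_disc// h rmorph_nat.
Qed.

Lemma x_last : x p.+1 = x 1 + 2 * pi. Proof. by case: edges. Qed.

Lemma x_lt_y j : (1 <= j <= p)%N -> x j < y j.
Proof. by case: edges => _ _ _ h _ /h[]. Qed.

Lemma y_le_x j : (1 <= j <= p)%N -> y j <= x j.+1.
Proof. by case: edges => _ _ _ h _ /h[]. Qed.

Lemma y_le_x_lt i j : (1 <= i)%N -> (i < j)%N -> (j <= p.+1)%N -> y i <= x j.
Proof.
move=> i1; elim: j => // j ih; rewrite ltnS leq_eqVlt => /predU1P[<-|ij] jp.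
  by apply: y_le_x; rewrite i1.
have j1 : (1 <= j)%N by exact: leq_ltn_trans ij.
apply: le_trans (ih ij (ltnW jp)) _.
by rewrite (le_trans (ltW (x_lt_y _)) (y_le_x _))// j1 -ltnS.
Qed.

Lemma x_ge_x1 j : (1 <= j <= p.+1)%N -> x 1 <= x j.
Proof.
move=> /andP[]; rewrite leq_eqVlt => /predU1P[<-//|j1 jp].
by apply: le_trans (ltW (x_lt_y _)) (y_le_x_lt _ j1 jp).
Qed.

Lemma y_le_xlast j : (1 <= j <= p)%N -> y j <= x 1 + 2 * pi.
Proof. by move=> /andP[j1 jp]; rewrite -x_last; apply: y_le_x_lt. Qed.

Lemma band_sub j t : (1 <= j <= p)%N -> x j <= t <= y j -> x 1 <= t <= x 1 + 2 * pi.
Proof.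
move=> jp /andP[xt ty]; rewrite (le_trans _ xt) ?(le_trans ty) ?y_le_xlast//.
by apply: x_ge_x1; case/andP: jp => -> /leqW.
Qed.

Lemma gap_sub j t : (1 <= j <= p)%N -> y j <= t <= x j.+1 -> x 1 < t <= x 1 + 2 * pi.
Proof.
move=> jp /andP[yt tx]; have xy := x_lt_y jp; case/andP: (jp) => j1 jp1.
rewrite (lt_le_trans _ yt)/=; last first.
  by rewrite (le_lt_trans _ xy)// x_ge_x1// j1 leqW.
apply: (le_trans tx); move: (jp1); rewrite leq_eqVlt => /predU1P[->|jp2].
  by rewrite x_last.
have jp' : (1 <= j.+1 <= p)%N by [].
exact: le_trans (ltW (x_lt_y jp')) (y_le_xlast jp').
Qed.

Lemma disc_ellipticP t : `|D t| < 2 <->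
  exists j s, [/\ (1 <= j <= p)%N, x j < s < y j & expi t = expi s].
Proof.
case: edges => _ _ _ _ /(_ _ (expi_neq0 t)); rewrite discriminant_disc// => <-.
have two : (2 : R[i]) = (2 : R)%:C by rewrite rmorph_nat.
by rewrite ltr_norml two -rmorphN !ltcR.
Qed.

Lemma band_elliptic j t : (1 <= j <= p)%N -> x j < t < y j -> `|D t| < 2.
Proof. by move=> jp tj; apply/disc_ellipticP; exists j, t. Qed.

Lemma elliptic_band t : x 1 <= t <= x 1 + 2 * pi -> `|D t| < 2 ->
  exists2 j, (1 <= j <= p)%N & x j < t < y j.
Proof.
move=> /andP[xt tx] /[dup] Dt /disc_ellipticP[j [s [jp /andP[xs sy] e]]].
exists j => //; suff -> : t = s by rewrite xs.
apply: expi_inj e; have := @x_ge_x1 j; have := y_le_xlast jp.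
case/andP: jp => -> /leqW -> /= h1 /(_ isT) h2.
rewrite ltr_norml; apply/andP; split; last by lra.
have : t != x 1 by apply/eqP => tx1; move: Dt; rewrite tx1 disc_x1 ger0_norm ?ltxx.
by rewrite neq_lt => /orP[|]; lra.
Qed.

Lemma gap_hyperbolic j t : (1 <= j <= p)%N -> y j <= t <= x j.+1 -> 2 <= `|D t|.
Proof.
move=> jp yt; rewrite leNgt; apply/negP => Dt.
have := gap_sub jp yt => /andP[/ltW h1 h2].
have [|i ip /andP[xt ty]] := elliptic_band _ Dt; first by rewrite h1.
case/andP: yt => yt tx; case/andP: jp => j1 jp; case/andP: ip => i1 ip.
have [ij|ji] := leqP i j.
  suff : y i <= y j by rewrite leNgt (le_lt_trans yt ty).
  move: ij; rewrite leq_eqVlt => /predU1P[->//|ij].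
  by rewrite (le_trans (y_le_x_lt _ ij _))// ?(leqW jp)// ltW// x_lt_y// j1.
suff : x j.+1 <= x i by rewrite leNgt (lt_le_trans xt tx).
move: ji; rewrite leq_eqVlt => /predU1P[->//|ji].
have jj : (1 <= j.+1 <= p)%N by rewrite /= (leq_trans _ ip)// ltnW.
by rewrite (le_trans (ltW (x_lt_y jj)))// y_le_x_lt// leqW.
Qed.

Lemma gap_hyperbolic_y j : (1 <= j <= p)%N -> 2 <= `|D (y j)|.
Proof. by move=> jp; apply: (gap_hyperbolic jp); rewrite lexx y_le_x. Qed.

Lemma gap_hyperbolic_x j : (1 <= j <= p.+1)%N -> 2 <= `|D (x j)|.
Proof.
case: j => // -[_|j jp]; first by rewrite disc_x1 ger0_norm.
by apply: (@gap_hyperbolic j.+1) => //; rewrite lexx y_le_x.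
Qed.

Lemma circle_cover t : x 1 <= t <= x 1 + 2 * pi ->
  (exists2 j, (1 <= j <= p)%N & x j <= t < y j) \/
  (exists2 j, (1 <= j <= p)%N & y j <= t <= x j.+1).
Proof.
move=> /andP[xt]; rewrite -x_last => tx.
have : forall k, (k <= p)%N -> t <= x k.+1 ->
  (exists2 j, (1 <= j <= p)%N & x j <= t < y j) \/
  (exists2 j, (1 <= j <= p)%N & y j <= t <= x j.+1).
  elim=> [_ t1|k ih kp tk].
    left; exists 1%N => //; rewrite xt (le_lt_trans t1)// x_lt_y//.
  have [tx1|xt1] := leP t (x k.+1); first by apply: ih => //; exact: ltnW.
  have [ty|yt] := ltP t (y k.+1); first by left; exists k.+1 => //; rewrite (ltW xt1).
  by right; exists k.+1 => //; rewrite yt.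
by move=> /(_ p (leqnn p) tx).
Qed.

Lemma band_mono j : (1 <= j <= p)%N ->
  [/\ D (x j) = 2, D (y j) = -2 & {in `[x j, y j] &, {homo D : s t /~ s < t}}] \/
  [/\ D (x j) = -2, D (y j) = 2 & {in `[x j, y j] &, {homo D : s t / s < t}}].
Proof.
move=> jp; apply: (elliptic_mono (C := C)).
- exact: continuous_disc.
- exact: continuous_dirf.
- by move=> t; exact: derivable_disc.
- by move=> t; exact: disc_derive_sign.
- exact: x_lt_y.
- by move=> t; exact: band_elliptic.
- by apply: gap_hyperbolic_x; case/andP: jp => -> /leqW.
- exact: gap_hyperbolic_y.
Qed.

Lemma next_band j : (1 <= j <= p)%N ->
  exists2 d, x j.+1 < d & forall t, x j.+1 < t < d -> `|D t| < 2.
Proof.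
move=> /andP[j1]; rewrite leq_eqVlt => /predU1P[->|jp].
  (* After the last gap comes the first band, one turn later. *)
  rewrite x_last; exists (y 1 + 2 * pi); first by rewrite ltrD2r x_lt_y.
  move=> t ht; rewrite -(subrK (2 * pi) t) disc_periodic.
  by apply: (@band_elliptic 1); rewrite // ltrBrDr ltrBlDr.
exists (y j.+1); first by rewrite x_lt_y.
by move=> t; exact: band_elliptic.
Qed.

Lemma gap_dirichlet j : (1 <= j <= p)%N -> exists2 t, y j <= t <= x j.+1 & C t = 0.
Proof.
move=> jp; have [d xd Dd] := next_band jp.
apply: (@zero_between_elliptic _ D C _ _ _ _ (x j) (y j) (x j.+1) d) => //.
- exact: continuous_disc.
- exact: continuous_dirf.
- by move=> t; exact: derivable_disc.
- by move=> t; exact: disc_derive_sign.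
- exact: x_lt_y.
- exact: y_le_x.
- by move=> t; exact: band_elliptic.
- by move=> t; exact: gap_hyperbolic.
Qed.

Lemma dirichlet_hyperbolic t : C t = 0 -> 2 <= `|D t|.
Proof.
move=> Ct; rewrite leNgt; apply/negP => /(disc_derive_sign alpha_lt1 p_gt0).
by rewrite Ct mul0r ltxx.
Qed.

Lemma dirichlet_gap z : dirichlet alpha p z ->
  exists2 j, (1 <= j <= p)%N & closed_gap x y j z.
Proof.
move=> /[dup] -[z1 _]; have [t /andP[xt tx] ->] := unit_expi_period x1_itv z1.
move=> /(dirichlet_dirf alpha_lt1)/dirichlet_hyperbolic Dt.
have [|[j jp /andP[xj tj]]|[j jp jt]] := @circle_cover t.
- by rewrite xt ltW.
- move: xj; rewrite le_eqVlt => /predU1P[xj|xj]; last first.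
    by have := @band_elliptic j t jp; rewrite xj tj ltNge Dt => /(_ isT).
  (* A left band edge is the right end of the preceding gap; for [x 1] this is gap [p], reached at
     the angle [x 1 + 2 * pi]. *)
  case: j jp xj tj => // -[_|j jp] xj tj.
    exists p; first by rewrite p_gt0 leqnn.
    exists (x 1 + 2 * pi); rewrite ?expiD2pi -?xj// -x_last/= lexx y_le_x//.
    by rewrite p_gt0 leqnn.
  have jp' : (1 <= j.+1 <= p)%N by case/andP: jp => _ /ltnW ->.
  by exists j.+1 => //; exists t => //=; rewrite xj lexx -xj y_le_x.
- by exists j => //; exists t.
Qed.

Lemma gaps_disjoint i j s t : (1 <= i <= p)%N -> (1 <= j <= p)%N ->
  y i <= s <= x i.+1 -> y j <= t <= x j.+1 -> expi s = expi t -> i = j.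
Proof.
move=> ip jp si tj e.
have /andP[s1 s2] := gap_sub ip si; have /andP[t1 t2] := gap_sub jp tj.
have st : s = t by apply: expi_inj e; rewrite ltr_norml; apply/andP; split; lra.
wlog ij : i j s t ip jp si tj s1 s2 t1 t2 e st / (i < j)%N.
  move=> h; have [ij|ji|//] := ltngtP i j; first exact: (h i j s t).
  by apply/esym; apply: (h j i t s).
case/andP: si => _ sx; case/andP: tj => yt _; case/andP: ip => i1 _; case/andP: (jp) => j1 jp1.
have : x j <= s.
  by rewrite st (le_trans (ltW (x_lt_y jp))).
have : x i.+1 <= x j.
  move: ij; rewrite leq_eqVlt => /predU1P[->//|ij].
  have ii : (1 <= i.+1 <= p)%N by rewrite /= (leq_trans _ jp1)// ltnW.
  by rewrite (le_trans (ltW (x_lt_y ii)))// y_le_x_lt// leqW.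
by have := x_lt_y jp; rewrite st in sx * => h1 h2 h3; exfalso; lra.
Qed.

(** Degree count: [Q] has degree at most [p] and a root in each of the [p] disjoint gaps, so a
    second root in one gap would be one too many. [Q] is not zero since all its roots lie on the
    unit circle. *)
Lemma dirichlet_unique j z z' : (1 <= j <= p)%N ->
  dirichlet alpha p z -> closed_gap x y j z ->
  dirichlet alpha p z' -> closed_gap x y j z' -> z = z'.
Proof.
move=> jp dz gz dz' gz'; apply/eqP; apply/negPn/negP => zz'.
pose Q := Phi alpha p - revpoly p (Phi alpha p).
have rootQ w : dirichlet alpha p w -> root Q w.
  move=> /[dup] -[w1 _]; have [t _ ->] := unit_expi w1.
  by move=> /(dirichlet_dirf alpha_lt1)/(root_Phi_dirf alpha_lt1).
have Q0 : Q != 0.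
  apply/eqP => Q0; have /(root_Phi alpha_lt1) : root Q 0 by rewrite Q0 root0.
  by move=> /(phi_eq_phistar alpha_lt1 p_gt0)/eqP; rewrite normr0 eq_sym oner_eq0.
have [f hf] : exists f : nat -> R[i], forall i, (1 <= i <= p)%N ->
    dirichlet alpha p (f i) /\ closed_gap x y i (f i).
  have h i : exists w, (1 <= i <= p)%N -> dirichlet alpha p w /\ closed_gap x y i w.
    have [ip|ip] := boolP (1 <= i <= p)%N; last by exists 0.
    have [t ty Ct] := gap_dirichlet ip; exists (expi t) => _; split.
      exact/dirichlet_dirf.
    by exists t.
  by have [f hf] := choice h; exists f.
(* One of [z], [z'] differs from the root chosen in gap [j], and it serves as the extra root. *)
wlog fz : z z' zz' dz gz dz' gz' / f j != z.
  move=> h; have [e|ne] := eqVneq (f j) z; last exact: (h z z').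
  by apply: (h z' z) => //; rewrite ?e// eq_sym.
have [dj gj] := hf _ jp.
have : (size (z :: [seq f i | i <- iota 1 p]) < size Q)%N.
  apply: max_poly_roots => //=.
    rewrite rootQ//= all_map; apply/allP => i; rewrite mem_iota add1n ltnS => ip.
    by apply: rootQ; case: (hf i ip).
  apply/andP; split.
    apply/mapP => -[k]; rewrite mem_iota add1n ltnS => ip zi.
    have [_] := hf _ ip; rewrite -zi => -[s hs es]; case: gz => t ht et.
    have kj := gaps_disjoint ip jp hs ht (etrans es (esym et)).
    by move: fz; rewrite zi kj eqxx.
  rewrite map_inj_in_uniq ?iota_uniq// => a b; rewrite !mem_iota add1n !ltnS => ap bp fab.
  have [_ [s hs es]] := hf _ ap; have [_ [t ht et]] := hf _ bp.
  by apply: (gaps_disjoint ap bp hs ht); rewrite es et.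
apply/negP; rewrite -leqNgt /= size_map size_iota.
rewrite (leq_trans (size_polyD _ _))// size_polyN geq_max size_poly andbT.
by rewrite (leq_trans (size_scale_leq _ _))// size_phi_le.
Qed.

Lemma band_inverse j v : (1 <= j <= p)%N -> -2 < v < 2 ->
  exists2 t, x j < t < y j & D t = v.
Proof.
move=> jp /andP[v1 v2]; have xy := x_lt_y jp.
have cD : continuous D by exact: continuous_disc.
have [|t /andP[xt ty] Dt] := @ivt _ D (x j) (y j) v cD (ltW xy).
  by rewrite minElt maxElt; have [[-> ->]|[-> ->]] := band_mono jp; case: ifP => ?; lra.
exists t => //; rewrite !lt_neqAle xt ty !andbT; apply/andP; split; apply/eqP => e.
  by move: Dt; rewrite -e; have [[-> _]|[-> _]] := band_mono jp; lra.
by move: Dt; rewrite e; have [[_ ->]|[_ ->]] := band_mono jp; lra.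
Qed.

Lemma band_inj j : (1 <= j <= p)%N -> {in `[x j, y j] &, injective D}.
Proof.
move=> jp s t hs ht e.
by have [[_ _ h]|[_ _ h]] := band_mono jp; have [st|ts|//] := ltgtP s t;
  [have := h _ _ ht hs st | have := h _ _ hs ht ts | have := h _ _ hs ht st | have := h _ _ ht hs ts];
  rewrite e ltxx.
Qed.

End band_geometry.

(** * Iteration over several periods *)

Section periodic_prufer.
Variables (R : realType) (p : nat) (alpha : nat -> R[i]).
Hypothesis alpha_lt1 : forall n, `|alpha n| < 1.
Hypothesis alpha_periodic : forall n, alpha (n + p)%N = alpha n.
Implicit Types (t : R) (v : R * R).

Lemma prufer_addp n t v :
  prufer alpha (n + p) t v = prufer alpha n t (prufer alpha p t v).
Proof. by elim: n => //= n ->; rewrite alpha_periodic. Qed.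

(* Cayley-Hamilton for the unimodular monodromy matrix. *)
Lemma prufer_mul m t v (w := prufer alpha p t v) (x := disc alpha p (t + t)) :
  prufer alpha (m.+1 * p) t v =
  (cheb2 m.+1 x * w.1 - cheb2 m x * v.1, cheb2 m.+1 x * w.2 - cheb2 m x * v.2).
Proof.
elim: m v @w => [|m ih] v w.
  by rewrite mul1n /= !mul1r !mul0r !subr0 -surjective_pairing.
rewrite mulSn addnC prufer_addp ih -/w cheb2SS.
move: (cheb2 m.+1 x) (cheb2 m x) => s1 s0.
rewrite (prufer_lin alpha p t w) /= /x /disc (_ : (t + t) / 2 = t); last lra.
rewrite /w (prufer_lin alpha p t v)/=.
have := prufer_det alpha_lt1 p t.
move: (prufer alpha p t (1, 0)) (prufer alpha p t (0, 1)) => [a c] [b d] /= det.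
move: v {w} => [v1 v2] /=.
congr (_, _); apply: subr0_eq.
  by transitivity (s1 * v1 * (1 - (a * d - b * c))); [ring | rewrite det subrr mulr0].
by transitivity (s1 * v2 * (1 - (a * d - b * c))); [ring | rewrite det subrr mulr0].
Qed.

(** The initial vector [(1, 0)] has second component 0, so only the term with the monodromy matrix
    survives. *)
Lemma dirf_mul m theta : (0 < m)%N ->
  dirf alpha (m * p) theta = cheb2 m (disc alpha p theta) * dirf alpha p theta.
Proof.
case: m => // m _; rewrite /dirf prufer_mul -splitr /= mulr0 subr0.
by [].
Qed.

End periodic_prufer.

(** * Factorization of D - 2 cos u over the points of the bands *)

Section discriminant_factorization.
Variables (R : realType) (p : nat) (alpha : nat -> R[i]) (x y : nat -> R).
Hypothesis p_ge2 : (2 <= p)%N.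
Hypothesis p_even : ~~ odd p.
Hypothesis alpha_lt1 : forall n, `|alpha n| < 1.
Hypothesis alpha_periodic : forall n, alpha (n + p)%N = alpha n.
Hypothesis edges : band_edges alpha p x y.

Local Notation D := (disc alpha p).

Lemma transfer_poly n : exists2 M : 'I_2 -> 'I_2 -> {poly R[i]},
  (forall i j, (size (M i j) <= n.+1)%N) &
  (forall z i j, transfer alpha n z i j = (M i j).[z]).
Proof.
elim: n => [|n [M sM hM]].
  exists (fun i j => (i == j)%:R%:P) => [i j|z i j]; first exact: size_polyC_leq1.
  by rewrite mxE hornerC.
exists (fun i j => (rho alpha n)^-1 *: (if i == 0 then 'X * M 0 j - (alpha n)^* *: M 1 j
                    else M 1 j - alpha n *: ('X * M 0 j))) => [i j|z i j].
  apply: leq_trans (size_scale_leq _ _) _.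
  have h1 : (size ('X * M 0 j)%R <= n.+2)%N.
    by rewrite (leq_trans (size_polyMleq _ _))// size_polyX add2n/= ltnS sM.
  have h2 : (size (M 1 j)%R <= n.+2)%N by rewrite leqW.
  case: ifP => _; rewrite (leq_trans (size_polyD _ _))// size_polyN geq_max.
    by rewrite h1 (leq_trans (size_scale_leq _ _)).
  by rewrite h2 (leq_trans (size_scale_leq _ _)).
rewrite /= -scalemxAl mxE !mxE !big_ord_recl big_ord0/= !mxE/= !hM.
have -> : lift ord0 ord0 = 1 :> 'I_2 by apply/val_inj.
have -> : ord0 = 0 :> 'I_2 by [].
by case: i => [[|[|//]]]//= ?; rewrite !hornerE/=; congr (_ * _); ring.
Qed.

Lemma bands_disjoint i j s t : (1 <= i <= p)%N -> (1 <= j <= p)%N ->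
  x i < s < y i -> x j < t < y j -> expi s = expi t -> i = j.
Proof.
move=> ip jp /andP[xs sy] /andP[xt ty] e.
have h1 : x 1 <= x i by apply: (x_ge_x1 p_ge2 edges); case/andP: ip => -> /leqW.
have h2 : x 1 <= x j by apply: (x_ge_x1 p_ge2 edges); case/andP: jp => -> /leqW.
have h3 := y_le_xlast edges ip; have h4 := y_le_xlast edges jp.
have st : s = t.
  by apply: expi_inj e; rewrite ltr_norml; apply/andP; split; lra.
wlog ij : i j s t ip jp xs sy xt ty e st {h1 h2 h3 h4} / (i < j)%N.
  move=> h; have [ij|ji|//] := ltngtP i j; first exact: (h i j s t).
  by apply/esym; apply: (h j i t s).
case/andP: ip => i1 _; case/andP: jp => _ jp.
have := y_le_x_lt edges i1 ij (leqW jp); rewrite st in xs sy * => h1; exfalso; lra.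
Qed.

Definition cnorm (z : R[i]) : R := complex.Re `|z|.

Lemma cnormE z : (cnorm z)%:C = `|z|.
Proof. by rewrite /cnorm RRe_real// normr_real. Qed.

(** On the circle z^(p/2) (D - 2 cos u) is a polynomial of degree [p] with one root in each band.
    Since p/2 < p, the subtracted monomial does not touch the leading coefficient, whose modulus [k]
    is therefore the same for all [u]. *)
Lemma disc_factorization : exists2 k : R, 0 < k &
  forall (u : R) (theta : nat -> R), 0 < u < pi ->
    (forall j, (1 <= j <= p)%N -> x j < theta j < y j /\ D (theta j) = 2 * cos u) ->
  forall t, `|D t - 2 * cos u| =
    k * \prod_(1 <= j < p.+1) cnorm (expi t - expi (theta j)).
Proof.
have pi0 := pi_gt0 R.
have half : [/\ -1 <= 2^-1 :> R, -1 < 2^-1 :> R & 2^-1 < 1 :> R] by split; lra.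
have halfpi : 0 < (pi : R) / 2 < pi by lra.
have [M sM hM] := transfer_poly p.
pose P := M 0 0 + M 1 1.
have sP : (size P <= p.+1)%N by rewrite (leq_trans (size_polyD _ _))// geq_max !sM.
have PE t : P.[expi t] = expi t ^+ p./2 * (D t)%:C.
  rewrite -discriminant_disc// /discriminant mulrA divff ?mul1r; last first.
    by rewrite expf_neq0// expi_neq0.
  rewrite hornerD -!hM /mxtrace !big_ord_recl big_ord0 addr0.
  by congr (_ + transfer _ _ _ _ _); apply/val_inj.
pose Q (u : R) := P - (2 * cos u)%:C *: 'X^(p./2).
have p2p : (p./2 < p)%N by rewrite ltn_half_double -addnn -[X in (X < _)%N]addn0 ltn_add2l (leq_trans _ p_ge2).
have sQ u : (size (Q u) <= p.+1)%N.
  rewrite (leq_trans (size_polyD _ _))// size_polyN geq_max sP/=.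
  by rewrite (leq_trans (size_scale_leq _ _))// size_polyXn ltnS ltnW.
have QE u t : (Q u).[expi t] = expi t ^+ p./2 * (D t - 2 * cos u)%:C.
  rewrite hornerD hornerN hornerZ hornerXn PE rmorphB/= mulrBr; congr (_ - _).
  by rewrite mulrC.
have cQ u : (Q u)`_p = P`_p.
  by rewrite coefB coefZ coefXn gtn_eqF// mulr0 subr0.
pose rs (theta : nat -> R) := [seq expi (theta j) | j <- iota 1 p].
have all_roots u theta : (forall j, (1 <= j <= p)%N ->
    x j < theta j < y j /\ D (theta j) = 2 * cos u) -> all (root (Q u)) (rs theta).
  move=> h; rewrite all_map; apply/allP => j; rewrite mem_iota add1n ltnS => jp.
  by rewrite /= rootE QE; have [_ ->] := h j jp; rewrite subrr mulr0.
have uniq_rs u theta : (forall j, (1 <= j <= p)%N ->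
    x j < theta j < y j /\ D (theta j) = 2 * cos u) -> uniq (rs theta).
  move=> h; rewrite map_inj_in_uniq ?iota_uniq// => a b; rewrite !mem_iota add1n !ltnS => ap bp.
  by apply: bands_disjoint => //; [have [] := h a ap | have [] := h b bp].
have szrs theta : size (rs theta) = p by rewrite size_map size_iota.
(* If the coefficient of degree [p] vanished, every [Q u] would have [p] roots and degree below [p],
   hence be 0; then the middle coefficient of [P] would equal 2 cos u for all [u], which two values
   of [u] refute. *)
have Pp0 : P`_p != 0.
  apply/eqP => Pp.
  have Q0 u : 0 < u < pi -> Q u = 0.
    move=> u0pi; apply/eqP/negPn/negP => Qu.
    have [th hth] : exists th : nat -> R, forall j, (1 <= j <= p)%N ->
        x j < th j < y j /\ D (th j) = 2 * cos u.
      have h j : exists t, (1 <= j <= p)%N -> x j < t < y j /\ D t = 2 * cos u.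
        have [jp|jp] := boolP (1 <= j <= p)%N; last by exists 0.
        have [|t t1 t2] := band_inverse p_ge2 p_even alpha_lt1 edges jp (v := 2 * cos u).
          have /andP[c1 c2] := cos_open_itv u0pi.
          lra.
        by exists t.
      by have [th hth] := choice h; exists th.
    have := max_poly_roots Qu (all_roots _ _ hth) (uniq_rs _ _ hth).
    rewrite szrs; apply/negP; rewrite -leqNgt.
    have := sQ u; rewrite leq_eqVlt => /predU1P[|//] sQu.
    have : lead_coef (Q u) != 0 by rewrite lead_coef_eq0.
    by rewrite lead_coefE sQu/= cQ Pp eqxx.
  have cc u : 0 < u < pi -> P`_(p./2) = (2 * cos u)%:C.
    move=> /Q0/(congr1 (fun q : {poly R[i]} => q`_(p./2))).
    by rewrite coefB coefZ coefXn eqxx mulr1 coef0 => /subr0_eq.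
  have [h1 h2 h3] := half; have := cc _ halfpi; have := cc (acos 2^-1).
  rewrite acosK ?in_itv/= ?h1 ?(ltW h3)// acos_gt0 ?h1// acos_ltpi ?h2 ?(ltW h3)//.
  move=> /(_ isT) ->; rewrite cos_pihalf mulr0 divff// => /complexI/eqP.
  by rewrite oner_eq0.
exists (cnorm P`_p).
  by rewrite -ltcR cnormE normr_gt0.
move=> u theta u0 h t.
have sQu : size (Q u) = p.+1.
  apply/eqP; rewrite eqn_leq sQ/= ltnNge; apply/negP => /leq_sizeP/(_ p (leqnn p)).
  by rewrite cQ => /eqP; rewrite (negbTE Pp0).
have := all_roots_prod_XsubC _ (all_roots _ _ h).
rewrite sQu szrs uniq_rootsE => /(_ erefl (uniq_rs _ _ h)) QF.
have := congr1 (fun q => `|q.[expi t]|) QF; rewrite QE normrM normrX norm_expi expr1n mul1r.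
rewrite hornerZ horner_prod normrM lead_coefE sQu/= cQ normr_prod big_map.
move=> e; apply: complexI; rewrite rmorphM/= cnormE rmorph_prod/=.
rewrite normc_def/= expr0n/= addr0 sqrtr_sqr in e; rewrite e; congr (_ * _).
rewrite /index_iota subSS subn0; apply: eq_bigr => j _.
by rewrite cnormE !hornerE.
Qed.

End discriminant_factorization.

(** * Integral-geometric form of the logarithmic kernel *)

Section translation.
Variable R : realType.
Local Notation mu := (@lebesgue_measure R).
Implicit Types (a b c d x : R) (f : R -> \bar R).

Lemma measurable_addr c : measurable_fun [set: measurableTypeR R]
  ((fun x : R => x + c) : measurableTypeR R -> measurableTypeR R).
Proof. by apply: measurable_funD => //; exact: measurable_cst. Qed.

Lemma measurable_oppr : measurable_fun [set: measurableTypeR R]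
  (-%R : measurableTypeR R -> measurableTypeR R).
Proof. exact: oppr_measurable. Qed.

Lemma lebesgue_measure_shift c (A : set R) : measurable A ->
  pushforward mu ((fun x => x + c) : R -> measurableTypeR R) A = mu A.
Proof.
move=> mA.
have mc := measurable_addr c.
apply/esym/lebesgue_measure_unique => //= _ [[a b]] _ <-.
rewrite /pushforward (_ : _ @^-1` _ = `]a - c, b - c]%classic); last first.
  by apply/seteqP; split=> x /=; rewrite !in_itv/= ltrBlDr lerBrDr.
rewrite /= !lebesgue_measure_itv/= !lte_fin ltrD2r; case: ifP => // _.
by rewrite -!EFinB; congr EFin; ring.
Qed.

Lemma ge0_integral_shift c (A : set R) f : measurable A -> measurable_fun [set: R] f ->
  (forall x, 0 <= f x)%E ->
  (\int[mu]_(x in (fun x => x + c)%R @^-1` A) f (x + c)%R = \int[mu]_(x in A) f x)%E.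
Proof.
move=> mA mf f0.
rewrite -(@ge0_integral_pushforward _ _ _ _ _ _ (measurable_addr c) mu A f)//=; last exact: measurable_funTS.
have mc := measurable_addr c.
by apply: eq_measure_integral => //= B mB BA; exact: lebesgue_measure_shift.
Qed.

Lemma ge0_integral_oppr (A : set R) f : measurable A -> measurable_fun [set: R] f ->
  (forall x, 0 <= f x)%E ->
  (\int[mu]_(x in -%R @^-1` A) f (- x)%R = \int[mu]_(x in A) f x)%E.
Proof.
move=> mA mf f0.
rewrite -(@ge0_integral_pushforward _ _ _ _ _ _ measurable_oppr mu A f)//=; last exact: measurable_funTS.
have mo := measurable_oppr.
by apply: eq_measure_integral => //= B mB BA; exact: lebesgue_measureN.
Qed.

Lemma ge0_integral_oc_split a b c f : a <= b -> b <= c -> measurable_fun [set: R] f ->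
  (forall x, 0 <= f x)%E ->
  (\int[mu]_(x in `]a, c]) f x =
   \int[mu]_(x in `]a, b]) f x + \int[mu]_(x in `]b, c]) f x)%E.
Proof.
move=> ab bc mf f0.
have -> : `]a, c]%classic = `]a, b] `|` `]b, c] :> set R.
  by rewrite (itv_bndbnd_setU (x := BRight b)) ?bnd_simp.
rewrite ge0_integral_setU//; first exact: measurable_funTS.
rewrite disj_set2E; apply/eqP/seteqP; split => x //= []; rewrite !in_itv/=; lra.
Qed.

(** Both windows share the piece from [c + d] to [c + T]; the remaining pieces are translates of
    each other by [T]. *)
Lemma ge0_integral_period_step T c d f : 0 <= d <= T -> measurable_fun [set: R] f ->
  (forall x, 0 <= f x)%E -> (forall x, f (x + T) = f x) ->
  (\int[mu]_(x in `](c + d)%R, (c + d + T)%R]) f x = \int[mu]_(x in `]c, (c + T)%R]) f x)%E.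
Proof.
move=> /andP[d0 dT] mf f0 fT.
rewrite (@ge0_integral_oc_split _ (c + T)); [|lra|lra|by []|by []].
rewrite [RHS](@ge0_integral_oc_split _ (c + d)); [|lra|lra|by []|by []].
rewrite addeC; congr (_ + _)%E.
rewrite -(@ge0_integral_shift T)// (_ : _ @^-1` _ = `]c, c + d]%classic); last first.
  by apply/seteqP; split=> x /=; rewrite !in_itv/=; lra.
by apply: eq_integral => x _; rewrite fT.
Qed.

Lemma ge0_integral_period T c c' f : 0 < T -> measurable_fun [set: R] f ->
  (forall x, 0 <= f x)%E -> (forall x, f (x + T) = f x) ->
  (\int[mu]_(x in `]c, (c + T)%R]) f x = \int[mu]_(x in `]c', (c' + T)%R]) f x)%E.
Proof.
move=> T0 mf f0 fT; wlog cc : c c' / c <= c'.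
  by move=> h; have [/h//|/ltW/h//] := leP c c'.
(* The distance from [c] to [c'] is cut into equal steps no longer than the period. *)
have [n [d [dT ->]]] : exists (n : nat) d, 0 <= d <= T /\ c' = c + n%:R * d.
  exists (Num.truncn ((c' - c) / T)).+1.
  exists ((c' - c) / (Num.truncn ((c' - c) / T)).+1%:R); split; last first.
    by rewrite mulrC divfK ?pnatr_eq0// addrC subrK.
  rewrite divr_ge0 ?subr_ge0//= ler_pdivrMr ?ltr0n// mulrC -ler_pdivrMr//.
  exact/ltW/truncnS_gt.
elim: n => [|k ih]; first by rewrite mul0r addr0.
rewrite ih -natr1 mulrDl mul1r addrA.
by apply/esym; exact: ge0_integral_period_step.
Qed.

End translation.

(** * The function - ln sin (d / 2) as a weighted integral of tents *)

Section log_sine_kernel.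
Variable R : realType.
Local Notation mu := (@lebesgue_measure R).
Implicit Types (a b c d t s : R).

(* The second derivative of [t |-> - ln (sin (t / 2))].  Since this function and its
   derivative vanish at [pi], Taylor's formula gives [tent_integral]. *)
Definition arc_weight t : R := (4 * sin (t / 2) ^+ 2)^-1.

Lemma arc_weight_ge0 t : 0 <= arc_weight t.
Proof. by rewrite invr_ge0 mulr_ge0// sqr_ge0. Qed.

Lemma sin_half_gt0 t : 0 < t <= pi -> 0 < sin (t / 2).
Proof. by have := pi_gt0 R => pi0 /andP[t0 tp]; apply: sin_gt0_pi; lra. Qed.

(** Integration by parts: - cot (t/2) / 2 is a primitive of [arc_weight], and ln sin (t/2) is one of
    cot (t/2) / 2. *)
Definition tent_primitive d t : R :=
  - ((t - d) / 2 * (cos (t / 2) / sin (t / 2))) + ln (sin (t / 2)).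

Lemma is_derive_tent d t : 0 < t <= pi ->
  is_derive t 1 (tent_primitive d) (arc_weight t * (t - d)).
Proof.
move=> /sin_half_gt0 s0.
have h : is_derive t 1 (fun u : R => u / 2) 2^-1.
  rewrite (_ : (fun u : R => u / 2) = 2^-1 *: id); last first.
    by apply/funext => u; rewrite mulrC.
  by apply: is_derive_eq; rewrite -[_ *: _]/(_ * _) mulr1.
have hs : is_derive t 1 (fun u : R => sin (u / 2)) (cos (t / 2) * 2^-1).
  exact: (is_derive1_comp (f := sin) (g := fun u : R => u / 2) (is_derive_sin _) h).
have hc : is_derive t 1 (fun u : R => cos (u / 2)) (- sin (t / 2) * 2^-1).
  exact: (is_derive1_comp (f := cos) (g := fun u : R => u / 2) (is_derive_cos _) h).
have hl : is_derive t 1 (fun u : R => ln (sin (u / 2))) ((sin (t / 2))^-1 * (cos (t / 2) * 2^-1)).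
  exact: (is_derive1_comp (f := @ln R) (g := fun u : R => sin (u / 2)) (is_derive1_ln s0) hs).
have hv := is_deriveV (lt0r_neq0 s0) hs.
have hd : is_derive t 1 (fun u : R => (u - d) / 2) 2^-1.
  rewrite (_ : (fun u : R => (u - d) / 2) = 2^-1 *: (id - cst d)); last first.
    by apply/funext => u; rewrite mulrC.
  by apply: is_derive_eq; rewrite -[_ *: _]/(_ * _) subr0 mulr1.
apply: (is_derive_eq (is_deriveD (is_deriveN (is_deriveM hd (is_deriveM hc hv))) hl)).
rewrite -![_ *: _]/(_ * _) /arc_weight.
have cs := cos2Dsin2 (t / 2).
apply: subr0_eq; transitivity ((t - d) / (4 * sin (t / 2) ^+ 2) * ((cos (t / 2) ^+ 2 + sin (t / 2) ^+ 2) - 1)).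
  rewrite (_ : ((fun u : R => cos (u / 2)) * (fun u => (sin (u / 2))^-1)) t =
    cos (t / 2) * (sin (t / 2))^-1)//.
  by field; rewrite lt0r_neq0.
by rewrite cs subrr mulr0.
Qed.

Lemma continuous_arc_weight d t : 0 < t <= pi ->
  {for t, continuous (fun u => arc_weight u * (u - d))}.
Proof.
move=> /sin_half_gt0 s0.
apply: cvgM; last by apply: cvgB => //; exact: cvg_cst.
apply: cvgV; first by rewrite mulf_neq0// expf_neq0// lt0r_neq0.
apply: cvgM; first exact: cvg_cst.
apply: cvgM;
  by apply: (@continuous_comp _ _ _ (fun u : R => u / 2) sin);
     [exact: mulrr_continuous | exact: continuous_sin].
Qed.

Lemma tent_integral d : 0 < d < pi ->
  (\int[mu]_(t in `[d, pi]) (arc_weight t * (t - d))%:E = (- ln (sin (d / 2)))%:E)%E.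
Proof.
move=> /andP[d0 dpi].
have tpos t : t \in `[d, pi] -> 0 < t <= pi.
  by rewrite in_itv/= => /andP[dt ->]; rewrite (lt_le_trans d0).
have cF t : t \in `[d, pi] -> {for t, continuous (tent_primitive d)}.
  move=> /tpos/(is_derive_tent d) h.
  by apply/differentiable_continuous/derivable1_diffP; exact: ex_derive.
rewrite (@continuous_FTC2 _ _ (tent_primitive d))//.
- rewrite /tent_primitive subrr !mul0r oppr0 add0r sin_pihalf cos_pihalf ln1 mul0r mulr0.
  by rewrite oppr0 addr0 sub0e.
- apply: continuous_in_subspaceT => t; rewrite inE => /tpos.
  exact: continuous_arc_weight.
- split.
  + move=> t td; have h : 0 < t <= pi by apply: tpos; exact: subset_itv_oo_cc.
    by have := is_derive_tent d h => h'; exact: ex_derive.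
  + apply: cvg_at_right_filter; apply: cF; rewrite in_itv/= lexx ltW//.
  + apply: cvg_at_left_filter; apply: cF; rewrite in_itv/= lexx ltW//.
- move=> t td; have h : 0 < t <= pi by apply: tpos; exact: subset_itv_oo_cc.
  by have h' := is_derive_tent d h; rewrite derive1E derive_val.
Qed.

End log_sine_kernel.

(** * Caps containing two given points *)

Section arc_kernel.
Variable R : realType.
Local Notation mu := (@lebesgue_measure R).
Implicit Types (a b c d t s : R).

Lemma measurable_set_bool disp (T : measurableType disp) (f : T -> bool) :
  measurable_fun [set: T] f -> measurable [set x | f x].
Proof. by move=> mf; rewrite -[X in measurable X]setTI; exact: (mf measurableT [set true]). Qed.

Lemma measurable_cosB a : measurable_fun [set: R] (fun s : R => cos (a - s)).
Proof.
apply: continuous_measurable_fun => s.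
apply: (@continuous_comp _ _ _ (fun u : R => a - u) cos); last exact: continuous_cos.
by apply: cvgB; [exact: cvg_cst | exact: cvg_id].
Qed.

(** The centres of the caps of angular length [t] that contain both e^{ia} and e^{ib}. *)
Definition two_caps a b t : set R :=
  [set s | cos (t / 2) < cos (a - s)] `&` [set s | cos (t / 2) < cos (b - s)].

Lemma measurable_two_caps a b t : measurable (two_caps a b t).
Proof.
by apply: measurableI; apply: measurable_set_bool; apply: measurable_fun_ltr;
  [exact: measurable_cst | exact: measurable_cosB | exact: measurable_cst | exact: measurable_cosB].
Qed.

(** Past [pi] both sides are false, as cos u <= 0 < cos (t/2). The range up to 3 pi / 2 is what
    [two_capsE] requires, where u is at most pi / 2 + pi. *)
Lemma cos_gt_half u t : 0 < t < pi -> 0 <= u <= 3 / 2 * pi ->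
  (cos (t / 2) < cos u) = (u < t / 2).
Proof.
move=> /andP[t0 tp] /andP[u0 u3]; have pi0 := pi_gt0 R.
have [up|pu] := leP u pi.
  by rewrite ltr_cos// in_itv/= ?u0 ?up//; lra.
have h : cos u <= 0.
  rewrite -[u](subrK pi) cosDpi oppr_le0 cos_ge0_pihalf//; lra.
have h' : 0 < cos (t / 2) by apply: cos_gt0_pihalf; lra.
by rewrite !ltNge (le_trans h (ltW h'))/=; apply/esym/negbTE; rewrite negbK; lra.
Qed.

(** Seen from the midpoint the two points lie at d and -d, and the larger of |d - u| and |d + u| is
    |d| + |u|. *)
Lemma two_capsE a b t s : 0 < t < pi -> `|a - b| <= pi ->
  `|s - (a + b) / 2| <= pi ->
  two_caps a b t s <-> `|s - (a + b) / 2| < (t - `|a - b|) / 2.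
Proof.
move=> tp ab spi; have pi0 := pi_gt0 R; rewrite /two_caps /=.
set u := s - (a + b) / 2 in spi *; set d := (a - b) / 2.
have -> : a - s = d - u by rewrite /d /u; lra.
have -> : b - s = - (d + u) by rewrite /d /u; lra.
have -> : (t - `|a - b|) / 2 = t / 2 - `|d|.
  by rewrite /d normrM [`|2^-1|]ger0_norm ?invr_ge0//; lra.
have dpi : `|d| <= pi / 2.
  by rewrite /d normrM [`|2^-1|]ger0_norm ?invr_ge0// ler_pM2r.
rewrite cosN -(cos_norm (d - u)) -(cos_norm (d + u)).
rewrite !cos_gt_half//; last 2 first.
- rewrite normr_ge0/=; have := ler_normD d u; lra.
- rewrite normr_ge0/=; have := ler_normB d u; lra.
split=> [[]|]; rewrite !ltr_norml => h; last first.
  by split; move: h; have := ler_norm d; have := ler_norm (- d); rewrite normrN; lra.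
by move=> /andP[h1 h2]; case/andP: h => h3 h4; have [d0|d0] := ger0P d; lra.
Qed.

Lemma two_caps_measure a b t : 0 < t < pi -> `|a - b| <= pi ->
  (\int[mu]_(s in `](- pi)%R, pi]) (\1_(two_caps a b t) s)%:E =
  (Num.max 0 (t - `|a - b|))%:E)%E.
Proof.
move=> tp ab; have pi0 := pi_gt0 R; pose c := (a + b) / 2.
have -> : `]- pi, pi]%classic = `]- pi, - pi + 2 * pi]%classic :> set R.
  by rewrite (_ : - pi + 2 * pi = pi :> R)//; lra.
have m1 : measurable_fun [set: R] (fun s => (\1_(two_caps a b t) s)%:E : \bar R).
  by apply/measurable_EFinP; apply: measurable_indic; exact: measurable_two_caps.
(* By periodicity the window is recentred at the midpoint [c], the range in which [two_capsE]
   applies. *)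
rewrite (@ge0_integral_period _ (2 * pi) (- pi) (c - pi))//; [|lra|]; last first.
  move=> s; congr EFin; rewrite !indicE.
  have cs u : cos (u - (s + 2 * pi)) = cos (u - s).
    by rewrite -[LHS]cosD2pi; congr cos; rewrite -(mulr_natl pi 2); lra.
  suff -> : (s + 2 * pi \in two_caps a b t) = (s \in two_caps a b t) by [].
  by apply/idP/idP; rewrite !inE /two_caps/= !cs.
rewrite integral_indic//; last exact: measurable_two_caps.
pose r := (t - `|a - b|) / 2.
have -> : two_caps a b t `&` `]c - pi, c - pi + 2 * pi] = `]c - r, c + r[%classic.
  apply/seteqP; split => s /=; rewrite !in_itv/=.
    move=> [h /andP[s1 s2]]; have : `|s - c| <= pi by rewrite ler_norml; lra.
    by move=> /(two_capsE tp ab)[/(_ h) + _]; rewrite ltr_norml -/r -/c; lra.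
  move=> sr; have rp : r < pi / 2 by rewrite /r; have := normr_ge0 (a - b); lra.
  have sc : `|s - c| < r by rewrite ltr_norml; lra.
  split; last lra.
  by apply/(two_capsE tp ab) => //; rewrite ltW// (lt_trans sc)//; lra.
rewrite /= lebesgue_measure_itv/= lte_fin; case: ifPn => h.
  by rewrite -EFinB; congr EFin; rewrite /Num.max; case: ifPn; move: h; rewrite /r; lra.
by congr EFin; rewrite /Num.max; case: ifPn => //; move: h; rewrite /r; lra.
Qed.

Lemma measurable_arc_weight : measurable_fun [set: R] ((@arc_weight R) \_ `]0, pi[).
Proof.
apply: (measurable_restrictT _ _).1 => //.
apply: open_continuous_measurable_fun; first exact: interval_open.
move=> t; rewrite inE/= in_itv/= => /andP[t0 tp].
have /sin_half_gt0 s0 : 0 < t <= pi by rewrite t0 ltW.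
apply: cvgV; first by rewrite mulf_neq0// expf_neq0// lt0r_neq0.
apply: cvgM; first exact: cvg_cst.
by apply: cvgM;
  apply: (@continuous_comp _ _ _ (fun u : R => u / 2) sin);
     [exact: mulrr_continuous | exact: continuous_sin | exact: mulrr_continuous | exact: continuous_sin].
Qed.

Lemma measurable_tent d : measurable_fun [set: R] (fun t : R => Num.max 0 (t - d)).
Proof.
apply: measurable_maxr; first exact: measurable_cst.
by apply: measurable_funB; [exact: measurable_id | exact: measurable_cst].
Qed.

Definition arc_tent d t : R := ((@arc_weight R) \_ `]0, pi[) t * Num.max 0 (t - d).

Lemma measurable_arc_tent d : measurable_fun [set: R] (arc_tent d).
Proof. by apply: measurable_funM; [exact: measurable_arc_weight | exact: measurable_tent]. Qed.

Lemma arc_tent_ge0 d t : 0 <= arc_tent d t.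
Proof.
rewrite mulr_ge0//; last by rewrite le_max lexx.
by rewrite /patch; case: ifP => // _; exact: arc_weight_ge0.
Qed.

Lemma arc_tent_integral_pos d : 0 < d <= pi ->
  (\int[mu]_t (arc_tent d t)%:E = (- ln (sin (d / 2)))%:E)%E.
Proof.
move=> /andP[d0]; have pi0 := pi_gt0 R; rewrite le_eqVlt => /predU1P[->|dp].
  rewrite sin_pihalf ln1 oppr0 integral0_eq// => t _.
  rewrite /arc_tent /patch; case: ifPn => [|_]; last by rewrite mul0r.
  rewrite inE/= in_itv/= => /andP[_ tp].
  by rewrite /Num.max ltNge subr_le0 (ltW tp)/= mulr0.
rewrite -tent_integral ?d0// integral_itv_bndoo; last first.
  apply/measurable_EFinP.
  apply: open_continuous_measurable_fun; first exact: interval_open.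
  move=> t; rewrite inE/= in_itv/= => /andP[dt tp].
  by apply: continuous_arc_weight; rewrite (lt_trans d0 dt) ltW.
rewrite [RHS]integral_mkcond; apply: eq_integral => t _.
rewrite /arc_tent /patch !mem_setE !in_itv/=.
have [dt|td] := ltP d t; last first.
  by rewrite max_l ?subr_le0// mulr0.
rewrite (lt_trans d0 dt)/=; case: ifP => _; last by rewrite mul0r.
by rewrite /Num.max ltNge subr_le0 leNgt dt.
Qed.

(** The diagonal of the kernel: this integral dominates those for all d > 0, which are unbounded. *)
Lemma arc_tent_integral0 : (\int[mu]_t (arc_tent 0 t)%:E = +oo)%E.
Proof.
have pi0 := pi_gt0 R.
have key (v : R) : (v%:E <= \int[mu]_t (arc_tent 0 t)%:E)%E.
  pose e := expR (- `|v|); have e0 : 0 < e by exact: expR_gt0.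
  have e1 : e <= 1 by rewrite -expR0 ler_expR oppr_le0.
  have ein : -1 <= e <= 1 by rewrite e1 andbT (le_trans _ (ltW e0))// oppr_le0.
  (* This makes [sin (d / 2) = e], so that the integral for [d] is |v|. *)
  pose d := pi - 2 * acos e.
  have ce : cos (acos e) = e by rewrite acosK// in_itv.
  have d0 : 0 < d.
    rewrite subr_gt0 -ltr_pdivlMl// mulrC ltNge; apply/negP => h.
    have : cos (acos e) <= cos (pi / 2).
      by rewrite leNgt ltr_cos ?in_itv/= ?acos_ge0 ?acos_lepi// -?leNgt//; lra.
    by rewrite ce cos_pihalf leNgt e0.
  have dp : d <= pi by rewrite /d lerBlDr lerDl mulr_ge0// acos_ge0.
  have sd : sin (d / 2) = e.
    by rewrite (_ : d / 2 = - acos e + pi / 2) ?sinDpihalf ?cosN// /d; lra.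
  apply: (@le_trans _ _ (\int[mu]_t (arc_tent d t)%:E)%E).
    by rewrite arc_tent_integral_pos ?d0// sd expRK opprK lee_fin ler_norm.
  apply: ge0_le_integral => //.
  - by move=> t _; rewrite lee_fin arc_tent_ge0.
  - by apply/measurable_EFinP; exact: measurable_arc_tent.
  - by apply/measurable_EFinP; exact: measurable_arc_tent.
  move=> t _; rewrite lee_fin ler_wpM2l//.
    by rewrite /patch; case: ifP => // _; exact: arc_weight_ge0.
  by rewrite ge_max le_max lexx/= le_max; apply/orP; right; lra.
case: (integral _ _ _) key => [r| |] key //.
  by have := key (r + 1); rewrite lee_fin gerDl ler10.
by have := key 0.
Qed.

Lemma arc_tent_integral d : 0 <= d <= pi ->
  (\int[mu]_t (arc_tent d t)%:E = - lne (sin (d / 2))%:E)%E.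
Proof.
have pi0 := pi_gt0 R; move=> /andP[]; rewrite le_eqVlt => /predU1P[<- _|d0 dp].
  by rewrite arc_tent_integral0 mul0r sin0 /lne lexx.
rewrite arc_tent_integral_pos ?d0// lne_EFin//.
by apply: sin_half_gt0; rewrite d0.
Qed.

End arc_kernel.

(** * Borel sets of the plane, arcs and caps *)

Section borel_complex.
Variable R : realType.
Local Notation C := (borelC R).
Implicit Types (z w : R[i]) (a b s t : R).

Lemma cnormE' z : cnorm z = Num.sqrt (complex.Re z ^+ 2 + complex.Im z ^+ 2).
Proof. by rewrite /cnorm normc_def. Qed.

Lemma lipschitz_open (f : R[i] -> R) r :
  (forall z w, (`|f z - f w|)%:C <= `|z - w|) ->
  open ([set z | r < f z] : set (R[i])^o).
Proof.
move=> fl; rewrite openE => z /= rz; apply/nbhs_ballP.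
exists (f z - r)%:C; first by rewrite /= -[0]/(0%:C) ltcR subr_gt0.
move=> w; rewrite -ball_normE/= => zw.
have := le_lt_trans (fl z w) zw; rewrite ltcR => /(le_lt_trans (ler_norm _)); lra.
Qed.

Lemma lipschitz_measurable (f : R[i] -> R) :
  (forall z w, (`|f z - f w|)%:C <= `|z - w|) ->
  measurable_fun [set: C] (f : C -> R).
Proof.
move=> fl; apply: (measurability _ (RGenOInfty.measurableE R)) => //.
move=> _ [_ [r ->] <-]; rewrite setTI; apply: sub_sigma_algebra.
rewrite (_ : _ @^-1` _ = [set z | r < f z]); first exact: lipschitz_open.
by apply/seteqP; split => z /=; rewrite in_itv/= andbT.
Qed.

Lemma measurable_Re : measurable_fun [set: C] ((@complex.Re R) : C -> R).
Proof.
apply: lipschitz_measurable => z w; apply: le_trans (normc_ge_Re _).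
by case: z w => [z1 z2] [w1 w2].
Qed.

Lemma measurable_Im : measurable_fun [set: C] ((@complex.Im R) : C -> R).
Proof.
apply: lipschitz_measurable => -[z1 z2] [w1 w2] /=.
rewrite normc_def/= lecR -sqrtr_sqr ler_wsqrtr// lerDr sqr_ge0//.
Qed.

Lemma sqrt_le_normD (u v : R) : Num.sqrt (u ^+ 2 + v ^+ 2) <= `|u| + `|v|.
Proof.
rewrite -[leRHS]ger0_norm ?addr_ge0// -sqrtr_sqr ler_wsqrtr//.
by rewrite sqrrD !real_normK ?num_real// addrAC lerDl mulrn_wge0// mulr_ge0.
Qed.

Lemma continuous_expi : continuous (@expi R : R -> (R[i])^o).
Proof.
move=> t; apply/cvgrPdist_lt => -[e e'] /=; rewrite ltcE/= => /andP[/eqP-> e0].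
have c1 := @continuous_cos R t; have c2 := @continuous_sin R t.
move/cvgrPdist_lt : c1 => /(_ (e / 2)); rewrite divr_gt0// => /(_ isT) c1.
move/cvgrPdist_lt : c2 => /(_ (e / 2)); rewrite divr_gt0// => /(_ isT) c2.
near=> s.
have h1 : `|cos t - cos s| < e / 2 by near: s.
have h2 : `|sin t - sin s| < e / 2 by near: s.
rewrite normc_def/= complexr0 ltcR.
apply: (@le_lt_trans _ _ (`|cos t - cos s| + `|sin t - sin s|)); last by lra.
exact: sqrt_le_normD.
Unshelve. all: by end_near.
Qed.

Lemma measurable_expi : measurable_fun [set: R] (@expi R : R -> C).
Proof.
apply: (@measurability _ _ R C setT (@expi R) (@open (R[i])^o) erefl).
move=> _ [U oU <-]; rewrite setTI.
apply: open_measurable; move/continuousP : continuous_expi; exact.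
Qed.

Lemma measurable_arc a b : measurable ([set expi t | t in `[a, b]%classic] : set C).
Proof.
rewrite -[X in measurable X]setCK; apply: measurableC; apply: sub_sigma_algebra.
rewrite openC; apply: compact_closed; first exact: norm_hausdorff.
apply: continuous_compact; last exact: segment_compact.
by apply: continuous_subspaceT; exact: continuous_expi.
Qed.

Lemma measurable_arc1 a : measurable ([set expi a] : set C).
Proof.
by have := measurable_arc a a; rewrite set_itv1 image_set1.
Qed.

(* [v.1] is the angle of the centre of the cap and [v.2] its angular length. *)
Definition cap_height z (v : R * R) : R :=
  complex.Re z * cos v.1 + complex.Im z * sin v.1 - cos (v.2 / 2).

Definition cap (v : R * R) : set C := [set z | 0 < cap_height z v].

Lemma measurable_cap_height :
  measurable_fun [set: C * (R * R)] (fun u : C * (R * R) => cap_height u.1 u.2).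
Proof.
have m1 : measurable_fun [set: C * (R * R)] (fun u : C * (R * R) => u.2.1).
  by apply: measurableT_comp => //; exact: measurableT_comp.
have m2 : measurable_fun [set: C * (R * R)] (fun u : C * (R * R) => u.2.2).
  by apply: measurableT_comp => //; exact: measurableT_comp.
have mcos : measurable_fun [set: R] (@cos R).
  by apply: continuous_measurable_fun; exact: continuous_cos.
have msin : measurable_fun [set: R] (@sin R).
  by apply: continuous_measurable_fun; exact: continuous_sin.
apply: measurable_funB.
  apply: measurable_funD; apply: measurable_funM.
  - by apply: measurableT_comp => //; exact: measurable_Re.
  - exact: measurableT_comp.
  - by apply: measurableT_comp => //; exact: measurable_Im.
  - exact: measurableT_comp.
apply: measurableT_comp => //.
by apply: measurable_funM => //; exact: measurable_cst.
Qed.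

Lemma measurable_cap v : measurable (cap v).
Proof.
apply: measurable_set_bool; apply: measurable_fun_ltr; first exact: measurable_cst.
apply: (@measurableT_comp _ _ _ _ _ _ (fun u : C * (R * R) => cap_height u.1 u.2) _ (fun z : C => (z, v))).
  exact: measurable_cap_height.
by apply/measurable_fun_pair => //; exact: measurable_cst.
Qed.

(** Density of the superposition of caps: the centres run over one turn, and only caps shorter than
    a half circle count. *)
Definition cap_weight (v : R * R) : R :=
  \1_(`]- pi, pi]%classic : set R) v.1 * ((@arc_weight R) \_ `]0, pi[) v.2.

Lemma cap_weight_ge0 v : 0 <= cap_weight v.
Proof.
by rewrite mulr_ge0//= /patch; case: ifP => // _; exact: arc_weight_ge0.
Qed.

Lemma measurable_cap_weight : measurable_fun [set: R * R] cap_weight.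
Proof.
apply: measurable_funM.
  by apply: measurableT_comp => //; exact: measurable_indic.
by apply: measurableT_comp => //; exact: measurable_arc_weight.
Qed.

Lemma cnorm_expiB a b : `|a - b| <= pi ->
  cnorm (expi a - expi b) = 2 * sin (`|a - b| / 2).
Proof.
move=> ab; have pi0 := pi_gt0 R.
have s0 : 0 <= sin (`|a - b| / 2) by apply: sin_ge0_pi; have := normr_ge0 (a - b); lra.
rewrite cnormE' /=; rewrite -[RHS]ger0_norm ?mulr_ge0// -sqrtr_sqr; congr Num.sqrt.
have h : cos `|a - b| = 1 - 2 * sin (`|a - b| / 2) ^+ 2.
  have e : `|a - b| = (`|a - b| / 2) *+ 2 by rewrite -mulr_natr divfK.
  by rewrite {1}e cos_mulr2n cos2sin2; ring.
move: h; rewrite cos_norm cosB exprMn => h.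
have c1 := cos2Dsin2 a; have c2 := cos2Dsin2 b.
have -> : 2 ^+ 2 * sin (`|a - b| / 2) ^+ 2 =
  2 * (1 - (1 - 2 * sin (`|a - b| / 2) ^+ 2)) by ring.
rewrite -h.
transitivity ((cos a ^+ 2 + sin a ^+ 2) + (cos b ^+ 2 + sin b ^+ 2) -
  2 * (cos a * cos b + sin a * sin b)); first by ring.
by rewrite c1 c2; ring.
Qed.

Lemma unit_pair z w : `|z| = 1 -> `|w| = 1 ->
  exists a b, [/\ `|a - b| <= pi, z = expi a & w = expi b].
Proof.
move=> z1 /[dup] w1 /unit_expi[b _ wb].
have [d dpi zw] : exists2 d, - pi <= d <= pi & z / w = expi d.
  by apply: unit_expi; rewrite normrM normfV z1 w1 invr1 mulr1.
exists (b + d), b; split => //; first by rewrite addrC addKr ler_norml.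
by rewrite expiD -zw -wb mulrC divfK// wb expi_neq0.
Qed.

End borel_complex.

Section plane_measure.
Variable R : realType.
Local Notation mu := (@lebesgue_measure R).

Lemma plane_sigma_finite : sigma_finite [set: measurableTypeR R * measurableTypeR R]
  (mu \x mu)%E.
Proof.
pose I (n : nat) : set (measurableTypeR R) := `[- n%:R, n%:R]%classic.
exists (fun n => I n `*` I n) => [|k].
  apply/seteqP; split => // -[x y] _.
  exists (Num.truncn (Num.max `|x| `|y|)).+1 => //=.
  have h := truncnS_gt (Num.max `|x| `|y|).
  by rewrite /I /= !in_itv/= -!ler_norml; split; apply: le_trans (ltW h); rewrite le_max lexx ?orbT.
have Ik : (mu (I k) < +oo)%E.
  by rewrite /I lebesgue_measure_itv/=; case: ifP; rewrite -?EFinB ltry.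
split; first by apply: measurableX; exact: measurable_itv.
rewrite product_measure1E//; [|exact: measurable_itv|exact: measurable_itv].
by rewrite lte_mul_pinfty// ge0_fin_numE.
Qed.

(** Packed as a sigma-finite measure so that Tonelli applies to its product with a probability on
    the plane. *)
Definition plane_measure :
  {sigma_finite_measure set (measurableTypeR R * measurableTypeR R)%type -> \bar R} :=
  HB.pack (mu \x mu)%E (Measure_isSigmaFinite.Build _ _ _ (mu \x mu)%E plane_sigma_finite).

End plane_measure.

(** * Energies and potentials as integrals over caps *)

Section capacity_kernel.
Variable R : realType.
Local Notation C := (borelC R).
Local Notation mu := (@lebesgue_measure R).
Local Notation omega := (plane_measure R).
Implicit Types (z w : R[i]) (a b s t : R) (v : R * R).

Lemma cap_expi a v : (expi a \in (cap v : set C)) = (cos (v.2 / 2) < cos (a - v.1)).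
Proof. by apply/idP/idP; rewrite inE /cap /cap_height /= subr_gt0 cosB. Qed.

(** With d the angular distance of the points, the centres of the caps of length t containing both
    have measure max (0, t - d). Integrating over t against [arc_weight] gives - ln sin (d/2), and
    sin (d/2) is half the chord. On the diagonal both sides are [+oo]. *)
Lemma lne_kernel z w : `|z| = 1 -> `|w| = 1 ->
  (\int[omega]_v (cap_weight v * (\1_(cap v : set C) z * \1_(cap v : set C) w))%:E =
   - lne (cnorm (z - w) / 2)%:E)%E.
Proof.
move=> z1 w1; have [a [b [ab -> ->]]] := unit_pair z1 w1.
have pi0 := pi_gt0 R.
have d0 : 0 <= `|a - b| <= pi by rewrite normr_ge0.
rewrite cnorm_expiB// [2 * _]mulrC mulfK// -arc_tent_integral//.
have ind u v : \1_(cap v : set C) (expi u) = \1_[set s | cos (v.2 / 2) < cos (u - s)] v.1 :> R.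
  by rewrite !indicE cap_expi mem_setE.
rewrite [LHS](fubini_tonelli2 (m1 := mu) (m2 := mu))/=; last 2 first.
- apply/measurable_EFinP; apply: measurable_funM; first exact: measurable_cap_weight.
  have mc u : measurable_fun [set: R * R] (fun v : R * R => \1_(cap v : set C) (expi u) : R).
    rewrite (_ : (fun v => _) = \1_[set v : R * R | 0 < cap_height (expi u) v]); last first.
      by apply/funext => v; rewrite !indicE.
    apply: measurable_indic; apply: measurable_set_bool.
    apply: measurable_fun_ltr; first exact: measurable_cst.
    apply: (@measurableT_comp _ _ _ _ _ _ (fun u : C * (R * R) => cap_height u.1 u.2) _ (fun v => (expi u : C, v))).
      exact: measurable_cap_height.
    exact: pair1_measurable.
  by apply: measurable_funM; exact: mc.
- move=> v; rewrite lee_fin mulr_ge0 ?cap_weight_ge0// mulr_ge0//.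
apply: eq_integral => t _; rewrite /fubini_G /cap_weight/= /arc_tent.
have [tp|tp] := boolP (t \in `]0, pi[); last first.
  rewrite /patch mem_setE (negbTE tp) mul0r integral0_eq// => s _.
  by rewrite mulr0 mul0r.
rewrite /patch mem_setE tp EFinM -two_caps_measure; [|by rewrite in_itv/= in tp|by []].
rewrite -ge0_integralZl_EFin ?arc_weight_ge0//; last first.
  by apply/measurable_EFinP; apply: measurable_funTS; apply: measurable_indic; exact: measurable_two_caps.
rewrite [RHS]integral_mkcond; apply: eq_integral => s _.
rewrite /patch mem_setE indicE mem_setE; case: ifP => _; last by rewrite !mul0r.
rewrite mul1r !ind/= -EFinM; congr (_ * _)%:E.
by rewrite !indicE /two_caps in_setI; case: (_ \in _); case: (_ \in _); rewrite ?(mulr0, mul0r, mulr1).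
Qed.

(** The incidence relation between points and caps; its measurability in the product is what Tonelli
    uses. *)
Definition cap_graph (E : set C) : set (C * (R * R)) :=
  [set u | E u.1 /\ 0 < cap_height u.1 u.2].

Lemma measurable_cap_graph (E : set C) : measurable E -> measurable (cap_graph E).
Proof.
move=> mE; rewrite (_ : cap_graph E = (fst @^-1` E) `&` [set u | 0 < cap_height u.1 u.2]).
  apply: measurableI; first by rewrite -[X in measurable X]setTI; exact: measurable_fst.
  apply: measurable_set_bool; apply: measurable_fun_ltr; first exact: measurable_cst.
  exact: measurable_cap_height.
by apply/seteqP; split.
Qed.

Lemma ysection_cap_graph (E : set C) v : ysection (cap_graph E) v = E `&` cap v.
Proof. by apply/seteqP; split => z; rewrite /ysection/= inE. Qed.

Section swap.
Variables (m : probability C R) (E : set C).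
Hypothesis mE : measurable E.

Lemma measurable_cap_measure : measurable_fun [set: R * R] (fun v => m (E `&` cap v)).
Proof.
rewrite (_ : (fun v => _) = m \o ysection (cap_graph E)).
  by apply: measurable_fun_ysection; exact: measurable_cap_graph.
by apply/funext => v /=; rewrite ysection_cap_graph.
Qed.

Lemma measurable_cap_kernel (h : R * R -> \bar R) : measurable_fun [set: R * R] h ->
  measurable_fun [set: C * (R * R)] (fun u => h u.2 * (\1_(cap_graph E) u)%:E)%E.
Proof.
move=> mh; apply: emeasurable_funM; first exact: measurableT_comp.
by apply/measurable_EFinP; apply: measurable_indic; exact: measurable_cap_graph.
Qed.

Lemma indic_cap_graph z v : \1_(cap_graph E) (z, v) = \1_E z * \1_(cap v : set C) z :> R.
Proof.
rewrite !indicE (_ : ((z, v) \in cap_graph E) = (z \in E) && (z \in (cap v : set C))).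
  by rewrite -mulnb natrM.
by apply/idP/andP; rewrite !inE.
Qed.

Lemma integral_cap_swap (h : R * R -> \bar R) : measurable_fun [set: R * R] h ->
  (forall v, 0 <= h v)%E ->
  (\int[m]_(z in E) \int[omega]_v (h v * (\1_(cap v : set C) z)%:E) =
   \int[omega]_v (h v * m (E `&` cap v)))%E.
Proof.
move=> mh h0; have mk := measurable_cap_kernel mh.
have k0 u : (0 <= h u.2 * (\1_(cap_graph E) u)%:E)%E by rewrite mule_ge0// lee_fin.
rewrite integral_mkcond.
transitivity (\int[m]_z \int[omega]_v (h v * (\1_(cap_graph E) (z, v))%:E))%E.
  apply: eq_integral => z _; rewrite /patch; case: ifPn => zE.
    by apply: eq_integral => v _; rewrite indic_cap_graph (indicE _ E) zE mul1r.
  rewrite integral0_eq// => v _.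
  by rewrite indic_cap_graph (indicE _ E) (negbTE zE) mul0r mule0.
transitivity (\int[omega]_v \int[m]_z (h v * (\1_(cap_graph E) (z, v))%:E))%E.
  pose f (u : C * (R * R)) := (h u.2 * (\1_(cap_graph E) u)%:E)%E.
  exact: (@fubini_tonelli _ _ _ _ _ m omega f mk k0).
apply: eq_integral => v _.
rewrite ge0_integralZl//=.
- rewrite -ysection_cap_graph -[X in m X]setIT -integral_indic//; last first.
    by apply: measurable_ysection; exact: measurable_cap_graph.
  congr (_ * _)%E; apply: eq_integral => z _; congr (_%:E).
  by rewrite !indicE mem_ysection.
- apply/measurable_EFinP; apply: (@measurableT_comp _ _ _ _ _ _ (\1_(cap_graph E) : _ -> R) _ (fun z : C => (z, v))).
    by apply: measurable_indic; exact: measurable_cap_graph.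
  exact: pair2_measurable.
Qed.

Lemma measurable_cap_integral (h : R * R -> \bar R) : measurable_fun [set: R * R] h ->
  (forall v, 0 <= h v)%E ->
  measurable_fun E (fun z => \int[omega]_v (h v * (\1_(cap v : set C) z)%:E))%E.
Proof.
move=> mh h0; have mk := measurable_cap_kernel mh.
have k0 u : (0 <= h u.2 * (\1_(cap_graph E) u)%:E)%E by rewrite mule_ge0// lee_fin.
have hF : measurable_fun [set: C]
    (fubini_F omega (fun u => h u.2 * (\1_(cap_graph E) u)%:E)%E).
  exact: measurable_fun_fubini_tonelli_F.
move: (measurable_funTS (D := E) hF); apply: eq_measurable_fun => z; rewrite inE => Ez; rewrite /fubini_F.
apply: eq_integral => v _ /=.
by rewrite indic_cap_graph (indicE _ E) mem_set// mul1r.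
Qed.

End swap.

Section mutual_energy.
Variable E : set C.
Hypothesis mE : measurable E.
Hypothesis E1 : forall z, E z -> `|z : R[i]| = 1.
Implicit Types m n : probability C R.

Lemma lne_kernel_ge0 z w : E z -> E w -> (0 <= - lne (cnorm (z - w) / 2)%:E)%E.
Proof.
move=> /E1 z1 /E1 w1; rewrite -lne_kernel//; apply: integral_ge0 => v _.
by rewrite lee_fin mulr_ge0 ?cap_weight_ge0// mulr_ge0.
Qed.

Lemma lne_potential n z : E z ->
  (\int[n]_(w in E) - lne (cnorm (z - (w : R[i])) / 2)%:E =
   \int[omega]_v ((cap_weight v)%:E * n (E `&` cap v) * (\1_(cap v : set C) z)%:E))%E.
Proof.
move=> Ez.
pose h v := ((cap_weight v)%:E * (\1_(cap v : set C) z)%:E)%E.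
have mh : measurable_fun [set: R * R] h.
  apply: emeasurable_funM; first by apply/measurable_EFinP; exact: measurable_cap_weight.
  apply/measurable_EFinP; rewrite (_ : (fun v => _) = \1_(cap_graph setT) \o pair z).
    apply: measurableT_comp; last exact: pair1_measurable.
    by apply: measurable_indic; exact: measurable_cap_graph.
  by apply/funext => v /=; rewrite indic_cap_graph indicT mul1r.
have h0 v : (0 <= h v)%E by rewrite mule_ge0// lee_fin// cap_weight_ge0.
transitivity (\int[n]_(w in E) \int[omega]_v (h v * (\1_(cap v : set C) w)%:E))%E.
  apply: eq_integral => w; rewrite inE => Ew.
  rewrite -lne_kernel ?E1//; apply: eq_integral => v _.
  by rewrite /h !EFinM muleA.
rewrite integral_cap_swap//; apply: eq_integral => v _.
by rewrite /h muleAC.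
Qed.

(** The energy becomes a weighted inner product of the cap masses of the two measures, from which
    definiteness is read off. *)
Lemma mutual_energyE m n :
  (\int[m]_(z in E) \int[n]_(w in E) - lne (cnorm ((z : R[i]) - (w : R[i])) / 2)%:E =
   \int[omega]_v ((cap_weight v)%:E * (m (E `&` cap v) * n (E `&` cap v))))%E.
Proof.
transitivity (\int[m]_(z in E) \int[omega]_v
   ((cap_weight v)%:E * n (E `&` cap v) * (\1_(cap v : set C) z)%:E))%E.
  by apply: eq_integral => z; rewrite inE => Ez; rewrite lne_potential.
rewrite integral_cap_swap//.
- by apply: eq_integral => v _; rewrite -muleA [X in (_ * X)%E]muleC.
- apply: emeasurable_funM; last exact: measurable_cap_measure.
  by apply/measurable_EFinP; exact: measurable_cap_weight.
- by move=> v; rewrite mule_ge0// lee_fin cap_weight_ge0.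
Qed.

End mutual_energy.

End capacity_kernel.

(** * Uniqueness of the equilibrium measure *)

Section integral_shift.
Context d (T : measurableType d) (R : realType) (m : {measure set T -> \bar R}).
Local Open Scope ereal_scope.

(** Needed for c = - ln 2 < 0 with an integral of [f] that may be infinite, where linearity for
    integrable functions fails to apply. The negative part of [f + c] is at most -c, hence has a
    finite integral that can be cancelled. *)
Lemma ge0_integral_addc (D : set T) (f : T -> \bar R) (c : R) : measurable D ->
  m D < +oo -> measurable_fun D f -> (forall x, D x -> 0 <= f x) ->
  \int[m]_(x in D) (f x + c%:E) = \int[m]_(x in D) f x + c%:E * m D.
Proof.
move=> mD mDy mf f0.
have mfin : m D \is a fin_num by rewrite ge0_fin_numE.
have mg : measurable_fun D (fun x => f x + c%:E).
  by apply: emeasurable_funD => //; exact: measurable_cst.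
have [c0|c0] := leP 0%R c.
  by rewrite ge0_integralD//= integral_cst//.
have cpos : (0 <= - c)%R by rewrite oppr_ge0 ltW.
set g := fun x => f x + c%:E.
(* Pointwise f + g^- = g^+ + (-c), an identity between nonnegative functions. *)
have sum_eq : \int[m]_(x in D) f x + \int[m]_(x in D) g^\- x =
    \int[m]_(x in D) g^\+ x + (- c)%:E * m D.
  rewrite -ge0_integralD//; last exact: measurable_funeneg.
  rewrite -(integral_cst _ mD) -ge0_integralD//.
  - apply: eq_integral => x; rewrite inE => Dx.
    have := f0 x Dx; rewrite funenegE funeposE /g.
    case: (f x) => [r| |] //= r0; last by rewrite !maxEge/= ?leey ?addye.
    rewrite -!EFinD -!EFin_max -EFinD; congr EFin.
    have [h|h] : (0 <= r + c \/ r + c < 0)%R by case: leP; [left | right].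
      rewrite (@max_l _ _ (r + c)%R)// (@max_r _ _ (- (r + c))%R) ?oppr_le0//; lra.
    by rewrite (@max_r _ _ (r + c)%R) ?(ltW h)// (@max_l _ _ (- (r + c))%R) ?oppr_ge0 ?(ltW h)//; lra.
  - exact: measurable_funepos.
have neg_fin : \int[m]_(x in D) g^\- x \is a fin_num.
  rewrite ge0_fin_numE ?integral_ge0//.
  apply: (@le_lt_trans _ _ (\int[m]_(x in D) (- c)%:E)).
    apply: ge0_le_integral => //; first exact: measurable_funeneg.
    move=> x Dx; rewrite funenegE /g; have := f0 x Dx.
    case: (f x) => [r| |] //= r0; last by rewrite max_r ?leNye// lee_fin.
    rewrite ?EFinN -?EFin_max !lee_fin ge_max cpos andbT; move: r0; rewrite lee_fin; lra.
  by rewrite integral_cst// lte_mul_pinfty// ?lee_fin.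
rewrite [LHS]integralE -/g.
have -> : \int[m]_(x in D) g^\+ x =
    \int[m]_(x in D) f x + \int[m]_(x in D) g^\- x + c%:E * m D.
  by rewrite sum_eq EFinN mulNe subeK// fin_numM.
by rewrite addeAC addeK.
Qed.

End integral_shift.

Section equilibrium_uniqueness.
Variable R : realType.
Local Notation C := (borelC R).
Local Notation mu := (@lebesgue_measure R).
Local Notation omega := (plane_measure R).
Implicit Types (z w : R[i]) (a b s t : R) (v : R * R).
Variable E : set C.
Hypothesis mE : measurable E.
Hypothesis E1 : forall z, E z -> `|z : R[i]| = 1.
Local Open Scope ereal_scope.

Definition mutual_energy (m n : probability C R) :=
  \int[m]_(z in E) \int[n]_(w in E) - lne (cnorm ((z : R[i]) - (w : R[i])) / 2)%:E.

Lemma lne_half (x : R) : (0 <= x)%R -> - lne x%:E = - lne (x / 2)%:E + (- ln 2)%:E.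
Proof.
rewrite le_eqVlt => /predU1P[<-|x0]; first by rewrite mul0r /lne lexx.
by rewrite !lne_EFin ?divr_gt0// ln_div ?posrE// -!EFinN -EFinD; congr EFin; lra.
Qed.

Lemma cnorm_ge0 z : (0 <= cnorm z)%R.
Proof. by rewrite cnormE' sqrtr_ge0. Qed.

Lemma measurable_lne_kernel z : E z ->
  measurable_fun E (fun w : C => - lne (cnorm (z - (w : R[i])) / 2)%:E).
Proof.
move=> Ez.
pose h v := (cap_weight v)%:E * (\1_(cap v : set C) z)%:E.
have mh : measurable_fun [set: R * R] h.
  apply: emeasurable_funM; first by apply/measurable_EFinP; exact: measurable_cap_weight.
  apply/measurable_EFinP; rewrite (_ : (fun v => _) = \1_(cap_graph setT) \o pair (z : C)).
    apply: measurableT_comp; last exact: pair1_measurable.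
    by apply: measurable_indic; exact: measurable_cap_graph.
  by apply/funext => v /=; rewrite indic_cap_graph indicT mul1r.
have h0 v : 0 <= h v by rewrite mule_ge0// lee_fin// cap_weight_ge0.
have := measurable_cap_integral mE mh h0.
apply: eq_measurable_fun => w; rewrite inE => Ew.
rewrite -lne_kernel ?E1//; apply: eq_integral => v _.
by rewrite /h !EFinM muleA.
Qed.

Lemma measurable_lne_potential (n : probability C R) :
  measurable_fun E (fun z : C => \int[n]_(w in E) - lne (cnorm ((z : R[i]) - (w : R[i])) / 2)%:E).
Proof.
have := measurable_cap_integral mE (h := fun v => (cap_weight v)%:E * n (E `&` cap v)).
have mh : measurable_fun [set: R * R] (fun v => (cap_weight v)%:E * n (E `&` cap v)).
  apply: emeasurable_funM; last exact: measurable_cap_measure.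
  by apply/measurable_EFinP; exact: measurable_cap_weight.
have h0 v : 0 <= (cap_weight v)%:E * n (E `&` cap v) by rewrite mule_ge0// lee_fin cap_weight_ge0.
move=> /(_ mh h0); apply: eq_measurable_fun => z; rewrite inE => Ez.
by rewrite lne_potential.
Qed.

Lemma log_energyE (m : probability C R) : m E = 1 ->
  log_energy m E = mutual_energy m m + (- ln 2)%:E.
Proof.
move=> mE1; rewrite /log_energy /mutual_energy.
have mEy : m E < +oo by rewrite mE1 ltry.
have inner z : E z -> \int[m]_(w in E) - lne (complex.Re `|z - (w : R[i])|)%:E =
    \int[m]_(w in E) - lne (cnorm (z - (w : R[i])) / 2)%:E + (- ln 2)%:E.
  move=> Ez; rewrite -[X in _ + X]mule1 -mE1 -ge0_integral_addc//.
  - by apply: eq_integral => w _; rewrite -lne_half ?cnorm_ge0.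
  - exact: measurable_lne_kernel.
  - by move=> w Ew; exact: (lne_kernel_ge0 E1).
under eq_integral => z do (rewrite inE => Ez; rewrite inner//).
rewrite ge0_integral_addc// ?mE1 ?mule1//.
- by congr (_ + _); rewrite -[RHS]mule1; congr (_ * _); exact: mE1.
- exact: measurable_lne_potential.
- by move=> z Ez; apply: integral_ge0 => w Ew; exact: (lne_kernel_ge0 E1).
Qed.

Section comparison.
Variables (m n : probability C R) (V : R).
Hypothesis m_equilibrium : equilibrium_measure E m.
Hypothesis nE1 : n E = 1.
Hypothesis n_potential : forall z, E z ->
  \int[n]_(w in E) - lne (cnorm (z - (w : R[i])) / 2)%:E = V%:E.

Lemma mutual_energy_potential (k : probability C R) : k E = 1 -> mutual_energy k n = V%:E.
Proof.
move=> kE1; rewrite /mutual_energy.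
transitivity (\int[k]_(z in E) V%:E).
  by apply: eq_integral => z; rewrite inE => /n_potential.
by rewrite integral_cst// -[RHS]mule1 -kE1.
Qed.

Lemma equilibrium_energy_le : mutual_energy m m <= V%:E.
Proof.
have [mE1 /(_ _ nE1)] := m_equilibrium.
rewrite !log_energyE// (mutual_energy_potential nE1).
by rewrite leeD2rE.
Qed.

(* The integral of [cap_weight v * (m (cap v) - n (cap v)) ^+ 2] is the energy of [m - n],
   namely [mutual_energy m m - V <= 0]. *)
Lemma cap_measures_ae_eq :
  omega.-negligible [set v | (0 < cap_weight v)%R /\ m (E `&` cap v) <> n (E `&` cap v)].
Proof.
have [mE1 _] := m_equilibrium.
pose f v := fine (m (E `&` cap v)); pose g v := fine (n (E `&` cap v)).
have fE v : m (E `&` cap v) = (f v)%:E by rewrite fineK// fin_num_measure//; apply: measurableI => //; exact: measurable_cap.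
have gE v : n (E `&` cap v) = (g v)%:E by rewrite fineK// fin_num_measure//; apply: measurableI => //; exact: measurable_cap.
have f0 v : (0 <= f v)%R by rewrite fine_ge0.
have g0 v : (0 <= g v)%R by rewrite fine_ge0.
have mf : measurable_fun [set: R * R] f.
  by apply: measurableT_comp => //; exact: measurable_cap_measure.
have mg : measurable_fun [set: R * R] g.
  by apply: measurableT_comp => //; exact: measurable_cap_measure.
have mw := @measurable_cap_weight R.
have w0 := @cap_weight_ge0 R.
have energy (k l : probability C R) (h h' : R * R -> R) :
    (forall v, k (E `&` cap v) = (h v)%:E) -> (forall v, l (E `&` cap v) = (h' v)%:E) ->
    mutual_energy k l = \int[omega]_v (cap_weight v * (h v * h' v))%:E.
  by move=> kh lh; rewrite /mutual_energy mutual_energyE//; apply: eq_integral => v _; rewrite kh lh -!EFinM.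
have e1 := equilibrium_energy_le; rewrite (energy _ _ f f)// in e1.
have e2 := mutual_energy_potential mE1; rewrite (energy _ _ f g)// in e2.
have e3 := mutual_energy_potential nE1; rewrite (energy _ _ g g)// in e3.
(* The square is expanded in additive form, with nonnegative integrands only, so that no integral
   has to be known finite in advance. *)
have split_eq : \int[omega]_v (cap_weight v * (f v - g v) ^+ 2)%:E +
    \int[omega]_v (cap_weight v * (f v * g v))%:E + \int[omega]_v (cap_weight v * (f v * g v))%:E =
    \int[omega]_v (cap_weight v * (f v * f v))%:E + \int[omega]_v (cap_weight v * (g v * g v))%:E.
  have m1 : measurable_fun [set: R * R] (fun v => cap_weight v * (f v - g v) ^+ 2)%R.
    by apply: measurable_funM => //; apply: measurable_funX; exact: measurable_funB.
  have m2 (h h' : R * R -> R) : measurable_fun [set: R * R] h -> measurable_fun [set: R * R] h' ->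
      measurable_fun [set: R * R] (fun v => cap_weight v * (h v * h' v))%R.
    by move=> ? ?; apply: measurable_funM => //; exact: measurable_funM.
  have intD (h h' : R * R -> R) : measurable_fun [set: R * R] h -> measurable_fun [set: R * R] h' ->
      (forall v, 0 <= h v)%R -> (forall v, 0 <= h' v)%R ->
      \int[omega]_v (h v)%:E + \int[omega]_v (h' v)%:E = \int[omega]_v (h v + h' v)%:E.
    move=> mh mh' h0 h0'; under [RHS]eq_integral do rewrite EFinD.
    by rewrite ge0_integralD//; [move=> v _; rewrite lee_fin | exact/measurable_EFinP |
      move=> v _; rewrite lee_fin | exact/measurable_EFinP].
  have p1 v : (0 <= cap_weight v * (f v - g v) ^+ 2)%R by rewrite mulr_ge0 ?sqr_ge0.
  have p2 (h h' : R * R -> R) v : (0 <= h v)%R -> (0 <= h' v)%R -> (0 <= cap_weight v * (h v * h' v))%R.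
    by move=> ? ?; rewrite mulr_ge0// mulr_ge0.
  rewrite intD//; [|exact: m2|by move=> v; exact: p2].
  rewrite intD//; [|by apply: measurable_funD => //; exact: m2|exact: m2|by move=> v; rewrite addr_ge0// p2|by move=> v; exact: p2].
  rewrite intD//; [|exact: m2|exact: m2|by move=> v; exact: p2|by move=> v; exact: p2].
  by apply: eq_integral => v _; congr EFin; ring.
have sq0 : \int[omega]_v (cap_weight v * (f v - g v) ^+ 2)%:E = 0.
  apply/eqP; rewrite eq_le integral_ge0 ?andbT; last first.
    by move=> v _; rewrite lee_fin mulr_ge0 ?sqr_ge0.
  (* Adding the finite [V] twice reduces the claim to I(m, m) + V <= V + V. *)
  rewrite -(leeD2rE (x := V%:E))// -(leeD2rE (x := V%:E))// add0e.
  by move: split_eq; rewrite e2 e3 => ->; rewrite leeD2rE.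
have m1 : measurable_fun [set: R * R] (fun v => cap_weight v * (f v - g v) ^+ 2)%R.
  by apply: measurable_funM => //; apply: measurable_funX; exact: measurable_funB.
have : \int[omega]_v `|(cap_weight v * (f v - g v) ^+ 2)%:E| = 0.
  by rewrite -[RHS]sq0; apply: eq_integral => v _; rewrite gee0_abs// lee_fin mulr_ge0 ?sqr_ge0.
have mE0 : measurable_fun [set: R * R] (fun v => (cap_weight v * (f v - g v) ^+ 2)%:E).
  exact/measurable_EFinP.
move/((ae_eq_integral_abs omega measurableT mE0).1) => -[].
move=> N [mN N0 sub]; exists N; split => // v /= [wv mn]; apply: sub => /= h.
apply: mn; rewrite fE gE; congr EFin.
have := h I => /= -[/eqP]; rewrite mulf_eq0 gt_eqF//= sqrf_eq0 subr_eq0 => /eqP //.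
Qed.

End comparison.

End equilibrium_uniqueness.

(** * From almost every cap to every arc *)

Section arc_measures.
Variable R : realType.
Local Notation C := (borelC R).
Local Notation mu := (@lebesgue_measure R).
Local Notation omega := (plane_measure R).
Implicit Types (z w : R[i]) (a b s t : R) (v : R * R).
Variable E : set C.
Hypothesis mE : measurable E.
Hypothesis E1 : forall z, E z -> `|z : R[i]| = 1.

Definition open_arc a b : set C := [set expi t | t in [set t | a < t < b]].

Lemma unit_expi_near z s : `|z| = 1 -> exists2 u, `|u| <= pi & z = expi (u + s).
Proof.
move=> z1; have [u upi zu] : exists2 u, - pi <= u <= pi & z * expi (- s) = expi u.
  by apply: unit_expi; rewrite normrM z1 norm_expi mulr1.
exists u; first by rewrite ler_norml.
by rewrite expiD -zu -mulrA -expiD addrC subrr expi0 mulr1.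
Qed.

Lemma cos_lt_norm t u : 0 <= t <= 2 * pi -> `|u| <= pi -> (cos (t / 2) < cos u) = (`|u| < t / 2).
Proof.
move=> t02 u_pi; rewrite -(cos_norm u) ltr_cos//; first by rewrite in_itv/= normr_ge0.
by rewrite in_itv/=; lra.
Qed.

Lemma cap_expi_near u s t : 0 <= t <= 2 * pi -> `|u| <= pi ->
  cap (s, t) (expi (u + s) : C) <-> `|u| < t / 2.
Proof.
move=> tp up; rewrite -(cos_lt_norm tp up).
have := cap_expi (u + s) (s, t); rewrite /= addrK => <-.
by split; rewrite inE.
Qed.

Lemma cap_subset s t s' t' : 0 <= t -> t' <= 2 * pi -> t / 2 + `|s - s'| <= t' / 2 ->
  E `&` cap (s, t) `<=` E `&` cap (s', t').
Proof.
move=> t0 t'2 h z [Ez cz]; split => //.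
have [u up zu] := unit_expi_near s (E1 Ez); have ss := normr_ge0 (s - s').
move: cz; rewrite zu => /cap_expi_near ut; have {ut}ut : `|u| < t / 2 by apply: ut => //; lra.
have h2 : `|u + (s - s')| < t' / 2 by have := ler_normD u (s - s'); lra.
have -> : u + s = u + (s - s') + s' by lra.
by apply/cap_expi_near => //; have := normr_ge0 u; lra.
Qed.

Section one_side.
Variables m n : probability C R.
Hypothesis mn : omega.-negligible
  [set v | 0 < cap_weight v /\ m (E `&` cap v) <> n (E `&` cap v)].

(** An open rectangle inside the support of the weight has positive measure, so the exceptional set
    cannot contain it. *)
Lemma cap_rectangle a b c d : - pi <= a -> a < b -> b <= pi -> 0 <= c -> c < d -> d <= pi ->
  exists s t, [/\ a < s < b, c < t < d & m (E `&` cap (s, t)) = n (E `&` cap (s, t))].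
Proof.
move=> pa ab bp c0 cd dp; apply: contrapT => h.
have [N [mN N0 sub]] := mn.
pose I1 : set (measurableTypeR R) := `]a, b[%classic.
pose I2 : set (measurableTypeR R) := `]c, d[%classic.
have L1 : mu I1 = (b - a)%:E by rewrite /I1 lebesgue_measure_itv/= lte_fin ab EFinB.
have L2 : mu I2 = (d - c)%:E by rewrite /I2 lebesgue_measure_itv/= lte_fin cd EFinB.
have mI : measurable (I1 `*` I2).
  by apply: measurableX; exact: measurable_itv.
have IN : I1 `*` I2 `<=` N.
  move=> [s t] [/=]; rewrite /I1 /I2 /= !in_itv/= => sab tcd; apply: sub; split.
    rewrite /cap_weight /= indicE mem_set/= ?in_itv/=; last by lra.
    rewrite mul1r /patch mem_setE in_itv/= ifT; last by lra.
    rewrite /arc_weight invr_gt0 mulr_gt0// exprn_gt0// sin_half_gt0//; lra.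
  by move=> e; apply: h; exists s, t.
have : (omega (I1 `*` I2) <= omega N)%E by apply: le_measure; rewrite ?inE.
have -> : omega (I1 `*` I2) = ((b - a) * (d - c))%:E.
  rewrite /plane_measure /= product_measure1E//; [|exact: measurable_itv|exact: measurable_itv].
  by rewrite [X in (X * _)%E]L1 [X in (_ * X)%E]L2.
rewrite N0 lee_fin.
by rewrite leNgt mulr_gt0// subr_gt0.
Qed.

(** The cap is the increasing union of the concentric caps [F k], and between [F k] and the cap
    there is room for a cap on which the two measures agree. The hypothesis being symmetric in [m]
    and [n], one inequality suffices. *)
Lemma cap_measure_le s t : - pi < s <= pi -> 0 < t <= pi ->
  (m (E `&` cap (s, t)) <= n (E `&` cap (s, t)))%E.
Proof.
move=> /andP[s1 s2] /andP[t0 tp]; have pi0 := pi_gt0 R.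
have mcap v : measurable (E `&` cap v) by apply: measurableI => //; exact: measurable_cap.
pose r (k : nat) : R := t * (k%:R / k.+1%:R).
have r0 k : 0 <= r k by rewrite mulr_ge0// ltW.
have rt k : r k < t by rewrite gtr_pMr// ltr_pdivrMr ?ltr0n// mul1r ltr_nat.
have r_mono j k : (j <= k)%N -> r j <= r k.
  move=> jk; rewrite ler_pM2l// ler_pdivrMr ?ltr0n// mulrAC ler_pdivlMr ?ltr0n//.
  by rewrite -!natrM ler_nat !mulnS [(k * j)%N]mulnC leq_add2r.
pose F k := E `&` cap (s, r k).
have F_mono : nondecreasing_seq F.
  move=> j k jk; apply/subsetPset; apply: cap_subset => //.
    by have := rt k; lra.
  by rewrite subrr normr0 addr0 ler_pM2r// r_mono.
have F_cup : \bigcup_k F k = E `&` cap (s, t).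
  apply/seteqP; split => z.
    move=> [k _]; apply: cap_subset => //; first by lra.
    by rewrite subrr normr0 addr0 ler_pM2r// ltW.
  move=> [Ez cz]; have [u up zu] := unit_expi_near s (E1 Ez).
  have ut : `|u| < t / 2 by apply/(@cap_expi_near u s t) => //; [lra | rewrite -zu].
  (* As r k = t - t / (k + 1), the index with t / (k + 1) < d gives r k > 2 |u|. *)
  pose d := t - 2 * `|u|; have d0 : 0 < d by rewrite /d; lra.
  exists (Num.truncn (t / d)) => //; split => //; rewrite zu.
  apply/cap_expi_near => //; first by have := rt (Num.truncn (t / d)); rewrite r0; lra.
  have := truncnS_gt (t / d); rewrite ltr_pdivrMr// /r.
  set k := Num.truncn _ => h.
  have k0 : 0 < k.+1%:R :> R by rewrite ltr0n.
  rewrite mulrA -ltr_pdivrMr ?invr_gt0// invrK ltr_pdivlMr//.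
  move: h; rewrite -natr1 /d; move: (k%:R : R) k0 => q; rewrite -natr1; nra.
have Fk k : (m (F k) <= n (E `&` cap (s, t)))%E.
  (* Centres are taken in (s - e, s), which stays in the support of the weight even for s = pi; the
     bound [s + pi] keeps s - e >= - pi. The first bound leaves room for lengths between r k + 2 e
     and t - 2 e, for which both inclusions hold. *)
  pose e := Num.min ((t - r k) / 8) (s + pi).
  have e0 : 0 < e by rewrite lt_min; have := rt k; lra.
  have e1 : e <= (t - r k) / 8 by rewrite ge_min lexx.
  have e2 : e <= s + pi by rewrite ge_min lexx orbT.
  have rk := rt k; have rk0 := r0 k.
  have [|||||| s' [t' [ss tt e']]] := @cap_rectangle (s - e) s (r k + 2 * e) (t - 2 * e);
    [lra|lra|lra|lra|lra|lra|].
  have sub1 : F k `<=` E `&` cap (s', t').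
    apply: cap_subset => //; first by lra.
    by rewrite ger0_norm; lra.
  have sub2 : E `&` cap (s', t') `<=` E `&` cap (s, t).
    apply: cap_subset => //; [lra|lra|].
    by rewrite ler0_norm; lra.
  apply: (@le_trans _ _ (m (E `&` cap (s', t')))).
    by apply: le_measure; rewrite ?inE//; exact: mcap.
  by rewrite e'; apply: le_measure; rewrite ?inE//; exact: mcap.
have Fm k : measurable (F k) by exact: mcap.
have := nondecreasing_cvg_mu Fm (bigcup_measurable (fun k _ => Fm k)) F_mono (mu := m).
rewrite F_cup => cv.
by rewrite -(cvg_lim _ cv)//; apply: lime_le; [apply/cvg_ex; exists (m (E `&` cap (s, t))) | near=> k; exact: Fk].
Unshelve. all: by end_near.
Qed.

End one_side.

Variables m n : probability C R.
Hypothesis mn : omega.-negligible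
  [set v | 0 < cap_weight v /\ m (E `&` cap v) <> n (E `&` cap v)].

Lemma cap_measure_eq s t : 0 < t <= pi -> m (E `&` cap (s, t)) = n (E `&` cap (s, t)).
Proof.
move=> tp; have pi0 := pi_gt0 R.
have [s' s'pi es] : exists2 s', - pi < s' <= pi & expi s = expi s'.
  have [s' /andP[s1 s2] es] := unit_expi (norm_expi s).
  move: s1; rewrite le_eqVlt => /predU1P[s1|s1]; last by exists s' => //; rewrite s1.
  by exists pi; [lra | rewrite es -s1 -expiD2pi; congr expi; lra].
have -> : cap (s, t) = cap (s', t) :> set C.
  by case: es => ec es; rewrite /cap /cap_height /= ec es.
apply/eqP; rewrite eq_le !cap_measure_le//.
by apply: negligibleS mn => v [? ?]; split => //; exact: nesym.
Qed.

Lemma open_arc_cap a b : a < b -> b <= a + pi ->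
  E `&` open_arc a b = E `&` cap ((a + b) / 2, b - a).
Proof.
move=> ab ba; have pi0 := pi_gt0 R.
apply/seteqP; split => z [Ez]; split => //.
  case: b0 => t /andP[at_ tb] <-.
  have -> : t = (t - (a + b) / 2) + (a + b) / 2 by rewrite subrK.
  by apply/cap_expi_near; [lra | rewrite ler_norml; lra | rewrite ltr_norml; lra].
have [u up zu] := unit_expi_near ((a + b) / 2) (E1 Ez).
move: b0; rewrite zu => /cap_expi_near h.
have {h} : `|u| < (b - a) / 2 by apply: h => //; lra.
rewrite ltr_norml => uab; exists (u + (a + b) / 2) => //=; lra.
Qed.

(** An arc longer than a half circle is the union of its first and last half circles, whose overlap
    is an arc shorter than a half circle. *)
Lemma open_arc_measure_eq a b : a < b -> b < a + 2 * pi ->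
  m (E `&` open_arc a b) = n (E `&` open_arc a b).
Proof.
move=> ab ba; have pi0 := pi_gt0 R.
have short c d : c < d -> d <= c + pi -> m (E `&` open_arc c d) = n (E `&` open_arc c d).
  by move=> cd dc; rewrite open_arc_cap// cap_measure_eq//; lra.
have mshort c d : c < d -> d <= c + pi -> measurable (E `&` open_arc c d).
  by move=> cd dc; rewrite open_arc_cap//; apply: measurableI => //; exact: measurable_cap.
have [bp|pb] := leP b (a + pi); first exact: short.
pose c := b - pi; pose d := a + pi.
have cd : c < d by rewrite /c /d; lra.
have -> : E `&` open_arc a b = (E `&` open_arc a d) `|` (E `&` open_arc c b).
  rewrite -setIUr; congr (_ `&` _); apply/seteqP; split => z.
    move=> [t /andP[at_ tb] <-]; have [td|dt] := ltP t d.
      by left; exists t => //=; rewrite at_.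
    by right; exists t => //=; rewrite tb andbT (lt_le_trans cd).
  by move=> [] [t tt <-]; exists t => //=; move: tt => /=; rewrite /c /d; lra.
have EI : (E `&` open_arc a d) `&` (E `&` open_arc c b) = E `&` open_arc c d.
  apply/seteqP; split => z.
    move=> [[Ez [t /= tt tz]] [_ [u /= uu uz]]]; split => //; exists t => //=.
    have e : t = u.
      apply: expi_inj; last by rewrite tz uz.
      by move: tt uu; rewrite /c /d ltr_norml; lra.
    by move: tt uu; rewrite e; lra.
  move=> [Ez [t /= tt tz]]; rewrite /c /d in tt.
  by apply: conj; apply: conj => //; exists t => //=; rewrite /c /d; lra.
have fin (k : probability C R) x y : x < y -> y <= x + pi -> (k (E `&` open_arc x y) < +oo)%E.
  by move=> xy yx; rewrite ltey_eq fin_num_measure//; exact: mshort.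
have [h1 h2 h3 h4] : [/\ a < d, d <= a + pi, c < b & b <= c + pi] by rewrite /c /d; split; lra.
have h5 : d <= c + pi by rewrite /c /d; lra.
rewrite !measureUfinl//; [|exact: mshort|exact: mshort|exact: fin|exact: mshort|exact: mshort|exact: fin].
rewrite EI; congr (_ + _ - _)%E; exact: short.
Qed.

End arc_measures.

(** * The equilibrium measure of the bands *)

Section log_sine_integral.
Variable R : realType.
Local Notation mu := (@lebesgue_measure R).
Implicit Types (s t u v : R).
Local Open Scope ereal_scope.

Definition log_sine u : \bar R := - lne `|sin (u / 2)|%:E.

Lemma log_sine_ge0 u : 0 <= log_sine u.
Proof. by rewrite /log_sine oppe_ge0 lne_le0 lee_fin sin_max. Qed.

Lemma measurable_lne_EFin d (T : measurableType d) (f : T -> R) :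
  measurable_fun [set: T] f -> (forall x, 0 <= f x)%R ->
  measurable_fun [set: T] (fun x => lne (f x)%:E).
Proof.
move=> mf f0.
rewrite (_ : (fun x => _) = (fun x => if (f x <= 0)%R then -oo else (ln (f x))%:E))//.
apply: measurable_fun_ifT.
- by apply: measurable_fun_ler => //; exact: measurable_cst.
- exact: measurable_cst.
- by apply/measurable_EFinP; apply: measurableT_comp => //; exact: measurable_ln.
Qed.

Lemma measurable_log_sine : measurable_fun [set: R] log_sine.
Proof.
apply: measurableT_comp; first exact: oppe_measurable.
apply: measurable_lne_EFin => //; apply: measurableT_comp => //.
apply: continuous_measurable_fun => u.
by apply: (@continuous_comp _ _ _ (fun u : R => u / 2)%R sin);
  [exact: mulrr_continuous | exact: continuous_sin].
Qed.

Lemma sin_half_shift u : sin ((u + 2 * pi) / 2) = (- sin (u / 2))%R :> R.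
Proof. by rewrite -sinDpi; congr sin; lra. Qed.

Lemma log_sine_period u : log_sine (u + 2 * pi) = log_sine u.
Proof. by rewrite /log_sine sin_half_shift normrN. Qed.

Lemma log_sineN u : log_sine (- u) = log_sine u.
Proof. by rewrite /log_sine mulNr sinN normrN. Qed.

(** A crude Jordan inequality: the mean value theorem with cos >= c up to pi / 4, then monotonicity
    of the sine at the cost of a factor 2. *)
Lemma sin_ge_linear : exists2 k, (0 < k)%R & forall s, (0 <= s <= pi / 2 -> k * s <= sin s)%R.
Proof.
have pi0 := pi_gt0 R; pose c := cos (pi / 4 : R).
have c0 : (0 < c)%R by apply: cos_gt0_pihalf; lra.
have small s : (0 <= s <= pi / 4 -> c * s <= sin s)%R.
  move=> /andP[]; rewrite le_eqVlt => /predU1P[<- _|s0 s4]; first by rewrite mulr0 sin0.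
  have [|t /[!in_itv]/= /andP[t0 ts]] := @MVT R sin cos 0%R s s0 (fun t _ => is_derive_sin t).
    by apply: continuous_subspaceT; exact: continuous_sin.
  rewrite sin0 !subr0 => ->; rewrite ler_pM2r//.
  by rewrite /c leNgt ltr_cos ?in_itv/= -?leNgt//; lra.
exists (c / 2)%R; first by lra.
move=> s /andP[s0 s2]; have [s4|s4] := leP s (pi / 4)%R.
  by apply: le_trans (small s _); [rewrite ler_wpM2r//; lra | lra].
have h1 : (sin (pi / 4 : R) <= sin s)%R.
  by rewrite leNgt ltr_sin ?in_itv/= -?leNgt//; lra.
have h2 : (c * (pi / 4) <= sin (pi / 4 : R))%R by apply: small; lra.
by apply: le_trans h1; apply: le_trans h2; rewrite -mulrA ler_pM2l//; lra.
Qed.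

Lemma arc_weight_bound : exists2 k, (0 <= k)%R &
  forall t, (0 < t < pi -> @arc_weight R t * (t * t) <= k)%R.
Proof.
have pi0 := pi_gt0 R; have [k k0 hk] := sin_ge_linear.
exists ((k ^+ 2)^-1)%R; first by rewrite invr_ge0 sqr_ge0.
move=> t /andP[t0 tp]; have s0 : (0 < sin (t / 2))%R by apply: sin_half_gt0; rewrite t0 ltW.
rewrite /arc_weight ler_pdivrMl ?mulr_gt0 ?exprn_gt0//.
rewrite ler_pdivlMr ?exprn_gt0//.
have h : (k * (t / 2) <= sin (t / 2))%R by apply: hk; lra.
have -> : (t * t * k ^+ 2 = 4 * (k * (t / 2)) ^+ 2)%R by field.
rewrite ler_pM2l// ler_pXn2r// nnegrE; last exact: ltW.
by apply: mulr_ge0; [exact: ltW | rewrite divr_ge0// ltW].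
Qed.

Definition log_sine_mass : \bar R := \int[mu]_(u in `](- pi)%R, pi]) log_sine u.

(** Writing the integrand as a tent integral and exchanging, the inner integral over u is at most 2
    t^2 [arc_weight t], which is bounded on (0, pi). *)
Lemma log_sine_mass_fin : log_sine_mass \is a fin_num.
Proof.
have pi0 := pi_gt0 R.
rewrite ge0_fin_numE; last by apply: integral_ge0 => u _; exact: log_sine_ge0.
pose f (z : R * R) : R := (\1_(`]- pi, pi]%classic : set R) z.1 * arc_tent `|z.1| z.2)%R.
have mf : measurable_fun [set: R * R] (EFin \o f).
  apply/measurable_EFinP; apply: measurable_funM.
    by apply: measurableT_comp => //; exact: measurable_indic.
  apply: measurable_funM.
    by apply: measurableT_comp => //; exact: measurable_arc_weight.
  apply: measurable_maxr; first exact: measurable_cst.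
  by apply: measurable_funB => //; apply: measurableT_comp => //.
have f0 z : 0 <= (EFin \o f) z by rewrite lee_fin mulr_ge0 ?arc_tent_ge0.
have -> : log_sine_mass = \int[mu]_u \int[mu]_t (f (u, t))%:E.
  rewrite /log_sine_mass integral_mkcond; apply: eq_integral => u _.
  rewrite /patch /f/= mem_setE indicE mem_setE; case: ifPn => upi; last first.
    by rewrite integral0_eq// => t _; rewrite mul0r.
  under eq_integral do rewrite mul1r.
  have un : (`|u| <= pi)%R by rewrite ler_norml; move: upi; rewrite in_itv/=; lra.
  rewrite arc_tent_integral ?normr_ge0//.
  rewrite /log_sine; congr (- lne _%:E).
  have [u0|u0] := ger0P u.
    by rewrite ger0_norm// sin_ge0_pi//; move: un; rewrite ger0_norm//; lra.
  rewrite mulNr sinN ler0_norm// -oppr_ge0 -sinN sin_ge0_pi//.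
  by move: un; rewrite ltr0_norm//; lra.
rewrite (@fubini_tonelli _ _ _ _ _ mu mu (EFin \o f) mf f0)/=.
have [k k0 hk] := arc_weight_bound.
apply: (@le_lt_trans _ _ (\int[mu]_(t in `]0%R, pi[) (2 * k)%:E)); last first.
  by rewrite integral_cst//= lebesgue_measure_itv/= lte_fin pi0 -EFinB -EFinM ltry.
have mG : measurable_fun [set: R] (fun t => \int[mu]_u (f (u, t))%:E).
  exact: (@measurable_fun_fubini_tonelli_G _ _ _ _ _ mu _ mf f0).
rewrite [leRHS]integral_mkcond; apply: ge0_le_integral => //.
- by move=> t _; apply: integral_ge0 => u _; rewrite lee_fin mulr_ge0 ?arc_tent_ge0.
- by apply: (measurable_restrictT _ _).1 => //; exact: measurable_cst.
move=> t _; rewrite /patch mem_setE; case: ifPn => tpi; last first.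
  rewrite integral0_eq// => u _; rewrite /f /arc_tent /patch mem_setE (negbTE tpi).
  by rewrite mul0r mulr0.
have tp : (0 < t < pi)%R by move: tpi; rewrite in_itv.
have [t0 tpi'] := andP tp.
apply: (@le_trans _ _ (\int[mu]_u ((@arc_weight R t * t) * \1_(`[- t, t]%classic : set R) u)%:E)).
  apply: ge0_le_integral => //.
  - by move=> u _; rewrite lee_fin mulr_ge0 ?arc_tent_ge0.
  - exact: (measurableT_comp mf (pair2_measurable _)).
  - by apply/measurable_EFinP; apply: measurable_funM; [exact: measurable_cst | exact: measurable_indic].
  move=> u _; rewrite lee_fin /f /arc_tent /patch mem_setE tpi/=.
  rewrite !indicE !mem_setE !in_itv/= -ler_norml.
  have aw := arc_weight_ge0 t.
  have [ut|tu] := leP (`|u : R|)%R (t : R); last first.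
    by rewrite max_l ?mulr0// subr_le0 ltW.
  rewrite max_r ?subr_ge0// mulr1.
  case: (_ && _); rewrite ?mul0r ?mul1r ?mulr_ge0// ?(ltW t0)//.
  by rewrite ler_wpM2l// lerBlDr lerDl.
under eq_integral do rewrite EFinM.
rewrite ge0_integralZl_EFin; last 4 first.
- exact: measurableT.
- by move=> u _; rewrite lee_fin.
- by apply/measurable_EFinP; exact: measurable_indic.
- by rewrite mulr_ge0 ?arc_weight_ge0 ?ltW.
rewrite integral_indic// setIT /= lebesgue_measure_itv/= lte_fin ifT; last by lra.
rewrite -EFinB -EFinM lee_fin; have := hk t tp; lra.
Qed.

Lemma log_sine_translate v :
  \int[mu]_(u in `](- pi)%R, pi]) log_sine (u + v) = log_sine_mass.
Proof.
have pi0 := pi_gt0 R.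
pose A : set R := `](v - pi)%R, (v - pi + 2 * pi)%R]%classic.
have -> : `](- pi)%R, pi]%classic = (fun u : R => u + v)%R @^-1` A.
  by apply/seteqP; split => u; rewrite /A /= !in_itv/=; lra.
rewrite (@ge0_integral_shift R v A log_sine)//; last 3 first.
- exact: measurable_itv.
- exact: measurable_log_sine.
- exact: log_sine_ge0.
rewrite /A (@ge0_integral_period R (2 * pi)%R (v - pi)%R (- pi)%R log_sine)//.
- by rewrite (_ : (- pi + 2 * pi)%R = pi :> R)//; lra.
- by lra.
- exact: measurable_log_sine.
- exact: log_sine_ge0.
- exact: log_sine_period.
Qed.

(** The reflection u -> -u carries the first integral to (-pi, 0), so that the sum is the integral
    of a translate over a full period. *)
Lemma log_sine_pair v :
  \int[mu]_(u in `]0%R, pi[) log_sine (u - v) + \int[mu]_(u in `]0%R, pi[) log_sine (u + v) =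
  log_sine_mass.
Proof.
have pi0 := pi_gt0 R.
have ml w : measurable_fun [set: R] (fun u => log_sine (u + w)).
  by apply: (measurableT_comp measurable_log_sine); exact: measurable_addr.
rewrite -(log_sine_translate v) (@ge0_integral_oc_split _ (- pi)%R 0%R pi); [|lra|lra|exact: ml|by move=> u; exact: log_sine_ge0].
congr (_ + _); last first.
  by rewrite integral_itv_bndoo//; exact: measurable_funTS.
rewrite [RHS]integral_itv_bndoo; last exact: measurable_funTS.
rewrite -(@ge0_integral_oppr _ `]0%R, pi[%classic (fun u => log_sine (u - v)))//.
- rewrite (_ : -%R @^-1` _ = `](- pi)%R, 0%R[%classic); last first.
    by apply/seteqP; split => u /=; rewrite !in_itv/=; lra.
  by apply: eq_integral => u _; rewrite -opprD log_sineN.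
- by move=> u; exact: log_sine_ge0.
Qed.

End log_sine_integral.

(** * Average of image measures *)

Section average_distribution.
Context d (T : measurableType d) (R : realType) (p : nat) (X : nat -> measurableTypeR R -> T).
Hypothesis p_gt0 : (0 < p)%N.
Hypothesis mX : forall j, measurable_fun [set: measurableTypeR R] (X j).
Local Notation mu := (@lebesgue_measure R).
Local Open Scope ereal_scope.

Lemma average_distribution : exists n : probability T R,
  forall f : T -> \bar R, measurable_fun [set: T] f -> (forall x, 0 <= f x) ->
  \int[n]_x f x = ((p%:R * pi)^-1)%:E *
    \sum_(1 <= j < p.+1) \int[mu]_(u in `]0%R, pi[) f (X j u).
Proof.
have pi0 := pi_gt0 R; have p0 : (0 < p%:R :> R)%R by rewrite ltr0n.
have p1 : (0 <= p%:R^-1 :> R)%R by rewrite invr_ge0 ltW.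
pose P := uniform_prob pi0.
pose Xm j : {mfun measurableTypeR R >-> T} :=
  HB.pack (X j) (isMeasurableFun.Build _ _ _ _ _ (mX j)).
pose m_ j := distribution P (Xm j.+1).
pose m := mscale (NngNum p1) (msum m_ p).
have m1 : m [set: T] = 1.
  rewrite /m /mscale/= /msum (eq_bigr (fun=> 1)); last by move=> j _; exact: probability_setT.
  rewrite sumEFin sumr_const card_ord -EFinM mulVf// gt_eqF//.
pose n : probability T R := HB.pack m (Measure_isProbability.Build _ _ _ m m1).
exists n => f mf f0.
transitivity (\int[m]_x f x); first by [].
rewrite ge0_integral_mscale// ge0_integral_measure_sum//.
rewrite (eq_bigr (fun j : 'I_p => (pi^-1)%:E * \int[mu]_(u in `]0%R, pi[) f (X j.+1 u))).
  rewrite -ge0_sume_distrr; last by move=> j _; exact: integral_ge0.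
  by rewrite muleA -EFinM -invfM big_add1/= big_mkord.
move=> j _; rewrite ge0_integral_pushforward//= preimage_setT.
rewrite integral_uniform// ?subr0; last exact: measurableT_comp.
by rewrite integral_itv_bndoo//; apply: measurable_funTS; exact: (measurableT_comp mf (mX j.+1)).
Qed.

End average_distribution.

Section nonneg_logarithm.
Variable R : realType.
Implicit Types (a b : R).
Local Open Scope ereal_scope.

(** Zero factors are allowed: both sides are then [+oo]. *)
Lemma oppe_lneM a b : (0 <= a)%R -> (0 <= b)%R ->
  - lne (a * b)%:E = - lne a%:E + - lne b%:E.
Proof.
rewrite le_eqVlt => /predU1P[<- b0|a0].
  by rewrite mul0r /= lexx/=; case: ifP.
rewrite le_eqVlt => /predU1P[<-|b0]; first by rewrite mulr0 /= lexx leNgt a0.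
by rewrite !lne_EFin ?mulr_gt0// lnM ?posrE// EFinD oppeD.
Qed.

Lemma oppe_lne_prod (I : Type) (r : seq I) (a : I -> R) : (forall i, 0 <= a i)%R ->
  - lne (\prod_(i <- r) a i)%:E = \sum_(i <- r) - lne (a i)%:E.
Proof.
move=> a0; elim: r => [|i r IH]; first by rewrite !big_nil lne_EFin// ln1 oppe0.
by rewrite !big_cons oppe_lneM ?IH//; apply: prodr_ge0.
Qed.

End nonneg_logarithm.

(** * Parametrization of the bands by the angle u with D = 2 cos u *)

Section band_measure.
Variables (R : realType) (p : nat) (alpha : nat -> R[i]) (x y : nat -> R).
Hypothesis p_ge2 : (2 <= p)%N.
Hypothesis p_even : ~~ odd p.
Hypothesis alpha_lt1 : forall n, `|alpha n| < 1.
Hypothesis edges : band_edges alpha p x y.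
Implicit Types (s t u : R) (i j : nat).

Local Notation D := (disc alpha p).
Local Notation C := (borelC R).
Local Notation mu := (@lebesgue_measure R).

Lemma band_lt j s t : (1 <= j <= p)%N -> x j <= s <= y j -> x j <= t <= y j ->
  (s < t) = if D (x j) == 2 then D t < D s else D s < D t.
Proof.
move=> jp sj tj; have [[-> _ /le_nmono_in/leW_nmono_in h]|[-> _ /le_mono_in/leW_mono_in h]] := band_mono p_ge2 p_even alpha_lt1 edges jp.
  by rewrite eqxx h ?in_itv.
by rewrite ifF ?h ?in_itv//; apply/negbTE/eqP; lra.
Qed.

Lemma band_disc_norm j t : (1 <= j <= p)%N -> x j <= t <= y j -> -2 <= D t <= 2.
Proof.
move=> jp /andP[]; rewrite le_eqVlt => /predU1P[<- _|xt].
  by have [[-> _ _]|[-> _ _]] := band_mono p_ge2 p_even alpha_lt1 edges jp; lra.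
rewrite le_eqVlt => /predU1P[->|ty].
  by have [[_ -> _]|[_ -> _]] := band_mono p_ge2 p_even alpha_lt1 edges jp; lra.
have := band_elliptic p_even alpha_lt1 edges jp (t := t); rewrite xt ty => /(_ isT).
by rewrite ltr_norml => /andP[h1 h2]; rewrite !ltW.
Qed.

(** The angle kappa_j: it increases from 0 to pi along the band, whichever way D runs. *)
Definition band_angle j t := if D (x j) == 2 then acos (D t / 2) else pi - acos (D t / 2).

(** The points come from choice; measurability holds because monotonicity of D on the band turns
    [r < th j u] into a comparison of 2 cos u with D r. *)
Lemma band_param : exists th : nat -> R -> R,
  (forall j, measurable_fun [set: measurableTypeR R] (th j)) /\
  (forall j u, (1 <= j <= p)%N -> 0 < u < pi ->
     x j < th j u < y j /\ D (th j u) = 2 * cos u).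
Proof.
have h (ju : nat * R) : exists t, (1 <= ju.1 <= p)%N -> 0 < ju.2 < pi ->
    x ju.1 < t < y ju.1 /\ D t = 2 * cos ju.2.
  case: ju => j u /=.
  have [jp|_] := boolP (1 <= j <= p)%N; last by exists 0.
  have [u0|_] := boolP (0 < u < pi); last by exists 0.
  have [|t t1 t2] := band_inverse p_ge2 p_even alpha_lt1 edges jp (v := 2 * cos u).
    have /andP[c1 c2] := cos_open_itv u0.
    lra.
  by exists t.
have [th0 hth] := choice h; pose th1 j u := th0 (j, u).
have {}hth j u : (1 <= j <= p)%N -> 0 < u < pi ->
    x j < th1 j u < y j /\ D (th1 j u) = 2 * cos u by exact: (hth (j, u)).
pose I : set (measurableTypeR R) := `]0, pi[%classic.
exists (fun j => if (1 <= j <= p)%N then th1 j \_ I else cst 0); split; last first.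
  by move=> j u jp u0; rewrite jp /patch mem_setE in_itv/= u0; exact: hth.
move=> j; case: ifPn => jp; last exact: measurable_cst.
have mI : measurable I by exact: measurable_itv.
apply/(measurable_restrictT _ mI).
apply: (measurability _ (RGenOInfty.measurableE R)) => //.
have mcos : measurable_fun [set: measurableTypeR R] (fun u : R => 2 * cos u).
  apply: measurable_funM; first exact: measurable_cst.
  by apply: continuous_measurable_fun; exact: continuous_cos.
move=> _ [_ [r ->] <-].
have [rx|xr] := ltP r (x j).
  rewrite (_ : _ `&` _ = I)//; apply/seteqP; split => [u []//|u Iu]; split => //=.
  have [|/andP[h1 _] _] := hth j u jp _; first by move: Iu; rewrite /I /= in_itv.
  by rewrite in_itv/= andbT (lt_trans rx).
have [yr|ry] := leP (y j) r.
  rewrite (_ : _ `&` _ = set0)//; apply/seteqP; split => // u [Iu /=].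
  have [|/andP[_ h1] _] := hth j u jp _; first by move: Iu; rewrite /I /= in_itv.
  by rewrite in_itv/= andbT ltNge (le_trans (ltW h1)).
have rlt u : I u -> (r < th1 j u) = if D (x j) == 2 then 2 * cos u < D r else D r < 2 * cos u.
  rewrite /I /= in_itv/= => u0; have [/andP[h1 h2] <-] := hth j u jp u0.
  by rewrite (band_lt jp)// ?xr ?(ltW ry)// !ltW.
have [Dx|Dx] := boolP (D (x j) == 2).
  rewrite (_ : _ `&` _ = I `&` (fun u : R => 2 * cos u) @^-1` `]-oo, D r[).
    by rewrite -[X in measurable (_ `&` X)]setTI; apply: measurableI => //; apply: mcos.
  by apply/seteqP; split => u [Iu] /=; rewrite !in_itv/= ?andbT rlt// Dx.
rewrite (_ : _ `&` _ = I `&` (fun u : R => 2 * cos u) @^-1` `]D r, +oo[).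
  by rewrite -[X in measurable (_ `&` X)]setTI; apply: measurableI => //; apply: mcos.
by apply/seteqP; split => u [Iu] /=; rewrite !in_itv/= !andbT rlt// (negbTE Dx).
Qed.

Lemma band_angle_itv j t : (1 <= j <= p)%N -> x j <= t <= y j -> 0 <= band_angle j t <= pi.
Proof.
move=> jp tj; have h := band_disc_norm jp tj.
have a0 : 0 <= acos (D t / 2) by apply: acos_ge0; lra.
have a1 : acos (D t / 2) <= pi by apply: acos_lepi; lra.
by rewrite /band_angle; case: ifP => _; lra.
Qed.

Lemma band_below_measure (th : R -> R) j t : (1 <= j <= p)%N -> x j <= t <= y j ->
  (forall u, 0 < u < pi -> x j < th u < y j /\ D (th u) = 2 * cos u) ->
  mu [set u | 0 < u < pi /\ th u < t] = (band_angle j t)%:E.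
Proof.
move=> jp tj hth; have pi0 := pi_gt0 R; have h := band_disc_norm jp tj.
have a0 : 0 <= acos (D t / 2) by apply: acos_ge0; lra.
have a1 : acos (D t / 2) <= pi by apply: acos_lepi; lra.
have Dt : D t = 2 * cos (acos (D t / 2)) by rewrite acosK ?in_itv/=; lra.
have tlt u : 0 < u < pi -> (th u < t) = if D (x j) == 2 then u < acos (D t / 2) else acos (D t / 2) < u.
  move=> u0; have [/andP[h1 h2] Du] := hth u u0.
  rewrite (@band_lt j)// ?(ltW h1) ?(ltW h2)// Du {1 2}Dt !ltr_pM2l//.
  by rewrite !ltr_cos ?in_itv/= ?a0 ?a1//; move/andP: u0 => [/ltW -> /ltW ->].
rewrite /band_angle; case: ifP tlt => Dx tlt.
  rewrite (_ : [set u | _] = `]0, acos (D t / 2)[%classic).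
    rewrite lebesgue_measure_itv/= lte_fin oppr0 adde0; case: ifPn => //.
    by rewrite -leNgt => a0'; congr EFin; apply/le_anti; rewrite a0 a0'.
  apply/seteqP; split => u /=; rewrite in_itv/=; first by move=> [u0]; rewrite tlt// => ->; case/andP: u0 => ->.
  by move=> /andP[u0 ua]; have upi : 0 < u < pi; [rewrite u0 (lt_le_trans ua) | rewrite tlt].
rewrite (_ : [set u | _] = `]acos (D t / 2), pi[%classic).
  rewrite lebesgue_measure_itv/= lte_fin; case: ifPn => //.
  by rewrite -leNgt => a1'; rewrite -(@le_anti _ _ pi (acos (D t / 2))) ?subrr// a1 a1'.
apply/seteqP; split => u /=; rewrite in_itv/=; first by move=> [u0]; rewrite tlt// => ->; case/andP: u0 => _ ->.
by move=> /andP[ua u1]; have upi : 0 < u < pi; [rewrite u1 (le_lt_trans a0) | rewrite tlt].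
Qed.

End band_measure.

(** * Potential of the averaged measure and equilibrium mass of arcs *)

Section band_equilibrium.
Variables (R : realType) (p : nat) (alpha : nat -> R[i]) (x y : nat -> R).
Hypothesis p_ge2 : (2 <= p)%N.
Hypothesis p_even : ~~ odd p.
Hypothesis alpha_lt1 : forall n, `|alpha n| < 1.
Hypothesis edges : band_edges alpha p x y.
Implicit Types (s t u : R) (i j : nat).

Local Notation D := (disc alpha p).
Local Notation C := (borelC R).
Local Notation mu := (@lebesgue_measure R).
Local Notation E := (bands p x y : set C).

Let p_gt0 : (0 < p)%N. Proof. exact: leq_trans p_ge2. Qed.

Lemma measurable_bands : measurable E.
Proof.
rewrite (_ : E = \bigcup_(j in [set j | (1 <= j <= p)%N]) [set expi t | t in `[x j, y j]%classic] :> set C).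
  by apply: bigcup_measurable => j _; exact: measurable_arc.
apply/seteqP; split => [z [j [t [jp tj ->]]]|z [j jp [t tj <-]]].
  by exists j => //; exists t => //; rewrite /= in_itv.
by exists j, t; split => //; move: tj; rewrite /= in_itv.
Qed.

Lemma bands_norm z : E z -> `|z : R[i]| = 1.
Proof. by move=> [j [t [_ _ ->]]]; exact: norm_expi. Qed.

Lemma cos_sub_sin u v : cos v - cos u = 2 * (sin ((u - v) / 2) * sin ((u + v) / 2)).
Proof.
pose a := (u + v) / 2; pose b := (u - v) / 2.
have -> : v = a - b by rewrite /a /b; lra.
have -> : u = a + b by rewrite /a /b; lra.
have -> : (a + b - (a - b)) / 2 = b by lra.
have -> : (a + b + (a - b)) / 2 = a by lra.
by rewrite cosB cosD; lra.
Qed.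

Section parametrized_bands.
Variables (th : nat -> R -> R) (n : probability C R).
Hypothesis th_measurable : forall j, measurable_fun [set: measurableTypeR R] (th j).
Hypothesis thE : forall j u, (1 <= j <= p)%N -> 0 < u < pi ->
  x j < th j u < y j /\ D (th j u) = 2 * cos u.
Let X j u : C := expi (th j u).
Hypothesis nE : forall f : C -> \bar R, measurable_fun [set: C] f -> (forall z, 0 <= f z)%E ->
  (\int[n]_z f z = ((p%:R * pi)^-1)%:E *
    \sum_(1 <= j < p.+1) \int[mu]_(u in `]0%R, pi[) f (X j u))%E.

Let mX j : measurable_fun [set: measurableTypeR R] (X j : measurableTypeR R -> C).
Proof. exact: (measurableT_comp (@measurable_expi R) (th_measurable j)). Qed.

Let X_bands j u : (1 <= j <= p)%N -> 0 < u < pi -> E (X j u).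
Proof.
move=> jp u0; have [/andP[h1 h2] _] := thE jp u0.
by exists j, (th j u); split => //; rewrite !ltW.
Qed.

Lemma param_measure (A : set C) : measurable A ->
  n A = (((p%:R * pi)^-1)%:E *
    \sum_(1 <= j < p.+1) mu [set u | (0 < u < pi)%R /\ A (X j u)])%E.
Proof.
move=> mA.
transitivity (\int[n]_z (\1_A z)%:E)%E; first by rewrite integral_indic// setIT.
rewrite nE//; last by apply/measurable_EFinP; exact: measurable_indic.
congr (_ * _)%E; apply: eq_bigr => j _.
transitivity (\int[mu]_(u in `]0%R, pi[) (\1_(X j @^-1` A) u)%:E)%E; first by [].
rewrite integral_indic//; last by rewrite -[_ @^-1` _]setTI; exact: mX.
by congr (mu _); apply/seteqP; split => u /=; rewrite in_itv/= => -[].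
Qed.

Lemma param_bands : n E = 1%E.
Proof.
have pi0 := pi_gt0 R; rewrite param_measure; last exact: measurable_bands.
rewrite (_ : (\sum_(1 <= j < p.+1) _)%E = (\sum_(1 <= j < p.+1) (pi : R)%:E)%E).
  rewrite sumEFin sumr_const_nat subn1/= -EFinM -[pi *+ p]mulr_natl mulVf//.
  by rewrite gt_eqF// mulr_gt0// ltr0n.
apply: eq_big_nat => j jp; rewrite (_ : [set u | _] = `]0, pi[%classic).
  by rewrite lebesgue_measure_itv/= lte_fin pi0 oppr0 adde0.
apply/seteqP; split => u /=; rewrite in_itv/=; first by case.
by move=> u0; split => //; exact: X_bands.
Qed.

Lemma param_potential : exists V : R, forall z, E z ->
  (\int[n]_(w in E) - lne (cnorm ((z : R[i]) - (w : R[i])) / 2)%:E = V%:E)%E.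
Proof.
have pi0 := pi_gt0 R.
have [k k0 hk] := disc_factorization p_ge2 p_even alpha_lt1 edges.
(* With D t = 2 cos v, k times the product of the distances is 4 |sin ((u-v)/2) sin ((u+v)/2)|;
   halving each of the [p] distances contributes 2 ^+ p. *)
pose c : R := - ln (4 / (k * 2 ^+ p)).
have k2 : 0 < 4 / (k * 2 ^+ p) by rewrite divr_gt0// mulr_gt0// exprn_gt0.
exists ((p%:R * pi)^-1 * (fine (log_sine_mass R) + c * pi)) => _ [j0 [t [jp0 tj0 ->]]].
have Ez : E (expi t) by exists j0, t.
pose v := acos (D t / 2).
have Dt : D t = 2 * cos v.
  by have h := band_disc_norm p_ge2 p_even alpha_lt1 edges jp0 tj0; rewrite /v acosK ?in_itv/=; lra.
pose g (w : C) : \bar R := (- lne (cnorm ((expi t : R[i]) - (w : R[i])) / 2)%:E)%E.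
have mgE : measurable_fun [set: C] (g \_ E).
  apply/(measurable_restrictT _ measurable_bands).
  exact: (measurable_lne_kernel measurable_bands bands_norm Ez).
have gE0 w : (0 <= (g \_ E) w)%E.
  by rewrite /patch; case: ifPn => // /set_mem Ew; exact: (lne_kernel_ge0 bands_norm).
rewrite integral_mkcond -/g nE//.
have mI : measurable (`]0%R, pi[%classic : set (measurableTypeR R)) by exact: measurable_itv.
have mgX j : measurable_fun (`]0%R, pi[%classic : set (measurableTypeR R)) (fun u : R => (g \_ E) (X j u)).
  by apply: measurable_funTS; exact: (measurableT_comp mgE (mX j)).
rewrite -ge0_integral_sum//.
transitivity (((p%:R * pi)^-1)%:E *
    \int[mu]_(u in `]0%R, pi[) ((log_sine (u - v) + log_sine (u + v)) + c%:E))%E.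
  congr (_ * _)%E; apply: eq_integral => u; rewrite inE/= in_itv/= => u0.
  transitivity (\sum_(1 <= j < p.+1) - lne (cnorm (expi t - expi (th j u)) / 2)%:E)%E.
    by apply: eq_big_nat => j jp; rewrite /patch mem_set//; exact: X_bands.
  rewrite -oppe_lne_prod; last by move=> j; rewrite divr_ge0 ?cnorm_ge0.
  rewrite big_split prodr_const_nat subn1 -[p.+1.-1]/p /log_sine -oppe_lneM ?normr_ge0//.
  have -> : c%:E = (- lne (4 / (k * 2 ^+ p))%:E)%E by rewrite lne_EFin.
  rewrite -oppe_lneM ?(ltW k2)//.
  congr (- lne _%:E)%E.
  have := hk u (th ^~ u) u0 (fun j jp => thE jp u0) t.
  rewrite Dt -mulrBr cos_sub_sin !normrM !normr_nat => h.
  apply: (mulfI (negbT (gt_eqF k0))); rewrite mulrA -h.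
  have k00 := gt_eqF k0; have p20 : (2 ^+ p : R) != 0 by rewrite expf_neq0.
  by rewrite exprVn; field; rewrite k00 p20.
have ml w : measurable_fun (`]0%R, pi[%classic : set (measurableTypeR R)) (fun u => log_sine (u + w)).
  apply: measurable_funTS; apply: (measurableT_comp (@measurable_log_sine R)); exact: measurable_addr.
have mu_pi : mu `]0, pi[%classic = pi%:E.
  by rewrite lebesgue_measure_itv/= lte_fin pi0 oppr0 adde0.
rewrite [X in (_ * X)%E](_ : _ = log_sine_mass R + c%:E * pi%:E)%E.
  by rewrite -[X in (_ * (X + _))%E](fineK (@log_sine_mass_fin R)).
rewrite -mu_pi -(log_sine_pair v); etransitivity.
  apply: ge0_integral_addc => //.
  - by rewrite /= mu_pi ltry.
  - by apply: emeasurable_funD; exact: ml.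
  - by move=> u _; rewrite adde_ge0// log_sine_ge0.
congr (_ + _)%E; apply: ge0_integralD => //.
- by move=> u _; exact: log_sine_ge0.
- by move=> u _; exact: log_sine_ge0.
Qed.

Lemma measurable_open_arc a b : a < b -> b < a + 2 * pi -> measurable (open_arc a b : set C).
Proof.
move=> ab ba.
rewrite (_ : open_arc a b = [set expi t | t in `[a, b]%classic] `\` [set expi a] `\` [set expi b] :> set C).
  by apply: measurableD; [apply: measurableD; [exact: measurable_arc|]|]; exact: measurable_arc1.
apply/seteqP; split => [z [t /= /andP[t1 t2] <-]|z [[[t /= + <-]]]].
  split; first split; first by exists t => //; rewrite /= in_itv/= !ltW.
    move=> /= h; have : t = a by apply: expi_inj => //; rewrite ltr_norml; lra.
    by move=> ta; move: t1; rewrite ta ltxx.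
  move=> /= h; have : t = b by apply: expi_inj => //; rewrite ltr_norml; lra.
  by move=> ta; move: t2; rewrite ta ltxx.
rewrite in_itv/= => /andP[t1 t2] ta tb; exists t => //=; rewrite !lt_neqAle t1 t2 !andbT.
by apply/andP; split; apply/eqP => e; [apply: ta; rewrite e | apply: tb; rewrite -e].
Qed.

Lemma param_arc t : x 1%N < t < x 1%N + 2 * pi ->
  n (E `&` open_arc (x 1%N) t) = (((p%:R * pi)^-1)%:E *
    \sum_(1 <= j < p.+1) mu [set u | (0 < u < pi)%R /\ (th j u < t)%R])%E.
Proof.
move=> /andP[xt tx].
have mA : measurable (E `&` (open_arc (x 1%N) t : set C)).
  by apply: measurableI; [exact: measurable_bands | exact: measurable_open_arc].
rewrite param_measure//; congr (_ * _)%E; apply: eq_big_nat => j jp.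
congr (mu _); apply/seteqP; split => u /= [u0] h; split => //.
  case: h => _ [s /= /andP[s1 s2]] /expi_inj <-//.
  have [/andP[h1 h2] _] := thE jp u0.
  have jp1 : (1 <= j <= p.+1)%N by move/andP: jp => [-> /ltnW].
  have := x_ge_x1 p_ge2 edges jp1; have := y_le_xlast edges jp.
  by rewrite ltr_norml; lra.
split; first exact: X_bands.
exists (th j u) => //=; rewrite h andbT.
have [/andP[h1 h2] _] := thE jp u0.
have jp1 : (1 <= j <= p.+1)%N by move/andP: jp => [-> /ltnW].
by apply: le_lt_trans h1; exact: (x_ge_x1 p_ge2 edges jp1).
Qed.

(** Each earlier band contributes its full parameter length [pi], each later one nothing. *)
Lemma param_arc_band j t : (1 <= j <= p)%N -> x j <= t <= y j -> x 1%N < t < x 1%N + 2 * pi ->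
  n (E `&` open_arc (x 1%N) t) = ((j%:R - 1) / p%:R + band_angle p alpha x j t / (p%:R * pi))%:E.
Proof.
move=> jp tj t0; have pi0 := pi_gt0 R; have /andP[j1 jp'] := jp.
have p0 : (p%:R : R) != 0 by rewrite pnatr_eq0 -lt0n.
rewrite param_arc// (big_cat_nat (n := j))//= ?leqW//.
rewrite (big_cat_nat (m := j) (n := j.+1))//= ?ltnS//.
rewrite big_nat1 (band_below_measure p_ge2 p_even alpha_lt1 edges jp tj); last by move=> u; exact: thE.
rewrite (_ : (\sum_(1 <= i < j) _)%E = (\sum_(1 <= i < j) (pi : R)%:E)%E); last first.
  apply: eq_big_nat => i /andP[i1 ij]; rewrite (_ : [set u | _] = `]0, pi[%classic).
    by rewrite lebesgue_measure_itv/= lte_fin pi0 oppr0 adde0.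
  apply/seteqP; split => u /=; rewrite in_itv/=; first by case.
  move=> u0; split => //.
  have ip : (1 <= i <= p)%N by rewrite i1 (leq_trans (ltnW ij)).
  have [/andP[_ h2] _] := thE ip u0.
  by apply: lt_le_trans h2 _; case/andP: tj => + _; apply: le_trans; apply: (y_le_x_lt edges) => //; exact: leqW.
rewrite (_ : (\sum_(j.+1 <= i < p.+1) _)%E = 0%E); last first.
  rewrite big_nat; apply: big1 => i /andP[ji ip]; rewrite (_ : [set u | _] = set0) ?measure0//.
  apply/seteqP; split => // u /= [u0 h].
  have ip' : (1 <= i <= p)%N by rewrite (leq_ltn_trans (leq0n j) ji) -ltnS.
  have [/andP[h2 _] _] := thE ip' u0.
  have : y j <= x i by apply: (y_le_x_lt edges) => //; exact: ltnW.
  by move: tj h h2; lra.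
rewrite adde0 sumEFin sumr_const_nat -EFinD -EFinM; congr EFin.
rewrite -[pi *+ _]mulr_natl natrB//.
have : (pi : R) != 0 by rewrite gt_eqF.
by generalize (pi : R) => q q0; field; rewrite q0.
Qed.

Lemma param_arc_gap j t : (1 <= j <= p)%N -> y j <= t <= x j.+1 -> t < x 1%N + 2 * pi ->
  n (E `&` open_arc (x 1%N) t) = (j%:R / p%:R)%:E.
Proof.
move=> jp tj t0; have pi0 := pi_gt0 R; have /andP[j1 jp'] := jp.
have p0 : (p%:R : R) != 0 by rewrite pnatr_eq0 -lt0n.
have /andP[x1t _] := gap_sub p_ge2 edges jp tj.
rewrite param_arc ?x1t// (big_cat_nat (n := j.+1))//= ?ltnS//.
rewrite (_ : (\sum_(1 <= i < j.+1) _)%E = (\sum_(1 <= i < j.+1) (pi : R)%:E)%E); last first.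
  apply: eq_big_nat => i /andP[i1 ij]; rewrite (_ : [set u | _] = `]0, pi[%classic).
    by rewrite lebesgue_measure_itv/= lte_fin pi0 oppr0 adde0.
  apply/seteqP; split => u /=; rewrite in_itv/=; first by case.
  move=> u0; split => //.
  have ip : (1 <= i <= p)%N by rewrite i1 (leq_trans _ jp')// -ltnS.
  have [/andP[_ h2] _] := thE ip u0.
  apply: lt_le_trans h2 _; case/andP: tj => + _; apply: le_trans.
  move: ij; rewrite ltnS leq_eqVlt => /predU1P[->//|ij].
  have := x_lt_y edges jp; have : y i <= x j by apply: (y_le_x_lt edges) => //; exact: leqW.
  by lra.
rewrite (_ : (\sum_(j.+1 <= i < p.+1) _)%E = 0%E); last first.
  rewrite big_nat; apply: big1 => i /andP[ji ip]; rewrite (_ : [set u | _] = set0) ?measure0//.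
  apply/seteqP; split => // u /= [u0 h].
  have ip' : (1 <= i <= p)%N by rewrite (leq_ltn_trans (leq0n j) ji) -ltnS.
  have [/andP[h2 _] _] := thE ip' u0.
  have : x j.+1 <= x i.
    move: ji; rewrite leq_eqVlt => /predU1P[->//|ji].
    have jp1 : (1 <= j.+1 <= p)%N by rewrite /= (leq_trans (ltnW ji)).
    have := x_lt_y edges jp1; have : y j.+1 <= x i by apply: (y_le_x_lt edges) => //; exact: ltnW.
    by lra.
  by move: tj h h2; lra.
rewrite adde0 sumEFin sumr_const_nat subn1/= -EFinM; congr EFin.
rewrite -[pi *+ _]mulr_natl.
have : (pi : R) != 0 by rewrite gt_eqF.
by generalize (pi : R) => q q0; field; rewrite p0.
Qed.

End parametrized_bands.

Section equilibrium_arcs.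
Variable dk : probability C R.
Hypothesis dk_equilibrium : equilibrium_measure E dk.

Lemma equilibrium_param : exists (th : nat -> R -> R) (n : probability C R), [/\
  (forall j u, (1 <= j <= p)%N -> 0 < u < pi -> x j < th j u < y j /\ D (th j u) = 2 * cos u),
  (forall j, measurable_fun [set: measurableTypeR R] (th j)),
  (forall f : C -> \bar R, measurable_fun [set: C] f -> (forall z, 0 <= f z)%E ->
    (\int[n]_z f z = ((p%:R * pi)^-1)%:E *
      \sum_(1 <= j < p.+1) \int[mu]_(u in `]0%R, pi[) f (expi (th j u)))%E) &
  forall t, x 1%N < t < x 1%N + 2 * pi -> arc_mass dk (x 1%N) t = n (E `&` open_arc (x 1%N) t)].
Proof.
have [th [mth hth]] := band_param p_ge2 p_even alpha_lt1 edges.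
pose X j u : C := expi (th j u).
have mX j : measurable_fun [set: measurableTypeR R] (X j : measurableTypeR R -> C).
  exact: (measurableT_comp (@measurable_expi R) (mth j)).
have [n hn] := average_distribution p_gt0 mX.
exists th, n; split => // t /andP[t1 t2].
have [V hV] := param_potential mth hth hn.
have nE1 := param_bands mth hth hn.
have ae := cap_measures_ae_eq measurable_bands bands_norm dk_equilibrium nE1 hV.
rewrite -(open_arc_measure_eq measurable_bands bands_norm ae)//.
have mO : measurable (open_arc (x 1%N) t : set C) by exact: measurable_open_arc.
have [dkE _] := dk_equilibrium.
(* [dk] does not charge the complement of the bands, so the arc may be cut down to [E]. *)
rewrite /arc_mass -/(open_arc (x 1%N) t).
rewrite [LHS](measureDI dk mO measurable_bands) setIC.
rewrite [X in (X + _)%E = _](_ : _ = 0%E) ?add0e//.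
have c0 : dk (~` E) = 0%E by rewrite (probability_setC dk measurable_bands) dkE subee.
apply: subset_measure0 c0.
- by apply: measurableD => //; exact: measurable_bands.
- by apply: measurableC; exact: measurable_bands.
- by move=> z [].
Qed.

Lemma equilibrium_arc_start : arc_mass dk (x 1%N) (x 1%N) = 0%E.
Proof.
rewrite /arc_mass (_ : [set expi t | t in _] = set0) ?measure0//.
by apply/seteqP; split => // z [t /= /andP[/lt_trans h /h]]; rewrite ltxx.
Qed.

Lemma equilibrium_arc_band j t : (1 <= j <= p)%N -> x j <= t <= y j -> t < x 1%N + 2 * pi ->
  arc_mass dk (x 1%N) t =
    ((j%:R - 1) / p%:R + band_angle p alpha x j t / (p%:R * pi))%:E.
Proof.
move=> jp tj t2; have /andP[] := band_sub p_ge2 edges jp tj.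
rewrite le_eqVlt => /predU1P[xt _|t1 _]; last first.
  have tt : x 1%N < t < x 1%N + 2 * pi by rewrite t1 t2.
  have [th [n [hth mth hn h]]] := equilibrium_param.
  by rewrite (h _ tt); exact: (param_arc_band mth hth hn jp tj).
(* At t = x 1 the arc is empty, and only the first band contains this angle; its band angle there is
   0. *)
have j1 : j = 1%N.
  case/andP: jp => + jp'; rewrite leq_eqVlt => /predU1P[//|j1].
  have p1 : (1 <= 1 <= p)%N by rewrite (leq_trans _ jp')// ltnW.
  have := x_lt_y edges p1; have : y 1%N <= x j by apply: (y_le_x_lt edges) => //; exact: leqW.
  by case/andP: tj => tj _ h1 h2; move: (lt_le_trans h2 (le_trans h1 tj)); rewrite xt ltxx.
rewrite -xt equilibrium_arc_start j1 subrr mul0r add0r /band_angle (disc_x1 p_even alpha_lt1 edges) eqxx.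
by rewrite divff// acos1 mul0r.
Qed.

Lemma equilibrium_arc_gap j t : (1 <= j <= p)%N -> y j <= t <= x j.+1 -> t < x 1%N + 2 * pi ->
  arc_mass dk (x 1%N) t = (j%:R / p%:R)%:E.
Proof.
move=> jp tj t2; have /andP[t1 _] := gap_sub p_ge2 edges jp tj.
have [th [n [hth mth hn h]]] := equilibrium_param.
have tt : x 1%N < t < x 1%N + 2 * pi by rewrite t1 t2.
rewrite (h _ tt).
exact: (param_arc_gap mth hth hn jp tj).
Qed.

End equilibrium_arcs.

End band_equilibrium.

(** * The points of prescribed equilibrium mass *)

Section quantized_points.
Variables (R : realType) (p : nat) (alpha : nat -> R[i]) (x y : nat -> R).
Hypothesis p_ge2 : (2 <= p)%N.
Hypothesis p_even : ~~ odd p.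
Hypothesis alpha_lt1 : forall n, `|alpha n| < 1.
Hypothesis edges : band_edges alpha p x y.
Variable dk : probability (borelC R) R.
Hypothesis dk_equilibrium : equilibrium_measure (bands p x y : set (borelC R)) dk.
Variable m : nat.
Hypothesis m_gt0 : (0 < m)%N.
Implicit Types (s t u k : R) (i j q : nat).

Local Notation D := (disc alpha p).

Lemma quantum_itv q : (1 <= q <= m.-1)%N -> 0 < (q%:R / m%:R : R) < 1.
Proof.
move=> /andP[q1 qm]; rewrite divr_gt0 ?ltr0n//= ltr_pdivrMr ?ltr0n// mul1r ltr_nat.
by rewrite -(prednK m_gt0) ltnS.
Qed.

Lemma quantum_compl q : (1 <= q <= m.-1)%N -> (1 <= m - q <= m.-1)%N.
Proof.
case: m m_gt0 => // n _ /= /andP[q1 qn]; rewrite subn_gt0 ltnS qn /=.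
by rewrite -ltnS ltn_subLR ?(leq_trans qn)// -[X in (X < _)%N]add0n ltn_add2r.
Qed.

Lemma band_angle_eq j t k : (1 <= j <= p)%N -> x j <= t <= y j -> 0 <= k <= pi ->
  band_angle p alpha x j t = k <-> D t = 2 * cos (if D (x j) == 2 then k else pi - k).
Proof.
move=> jp tj k0; have h := band_disc_norm p_ge2 p_even alpha_lt1 edges jp tj.
have Dt : cos (acos (D t / 2)) = D t / 2 by rewrite acosK ?in_itv/=; lra.
rewrite /band_angle; case: ifP => _; split => [<-|e]; first by rewrite Dt; lra.
- by rewrite e mulrAC divff// mul1r cosK// in_itv.
- by rewrite opprB addrC subrK Dt; lra.
- by rewrite e mulrAC divff// mul1r cosK ?subKr// in_itv/=; lra.
Qed.

(** The value of D at the point of band [j] whose band angle is pi q / m; where D increases, [q] is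
    exchanged with [m - q]. *)
Definition quantum q j : R := 2 * cos (if D (x j) == 2 then q%:R / m%:R * pi else pi - q%:R / m%:R * pi).

Let quantum_pi q : (1 <= q <= m.-1)%N -> 0 < (q%:R / m%:R * pi : R) < pi.
Proof.
move=> /quantum_itv/andP[q0 q1]; have pi0 := pi_gt0 R.
by rewrite mulr_gt0//= gtr_pMl.
Qed.

Let quantum_bound q j : (1 <= q <= m.-1)%N -> -2 < quantum q j < 2.
Proof.
move=> /quantum_pi/andP[q0 q1]; rewrite /quantum; set v := (if _ then _ else _).
have /andP[v0 v1] : 0 < v < pi by rewrite /v; case: ifP => _; lra.
have := cos_open_itv (u := v); rewrite v0 v1 => /(_ isT); lra.
Qed.

(** The prescribed mass lies strictly between (i - 1) / p and i / p. Gaps carry masses j / p and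
    band [j] carries masses from (j - 1) / p to j / p, so [t] must lie in band [i], where the mass
    determines the band angle. *)
Lemma arc_mass_quantum i q t : (1 <= i <= p)%N -> (1 <= q <= m.-1)%N ->
  (x 1%N <= t < x 1%N + 2 * pi /\
   arc_mass dk (x 1%N) t = ((i%:R - 1) / p%:R + q%:R / (m * p)%:R)%:E) <->
  x i < t < y i /\ D t = quantum q i.
Proof.
move=> ip qm; have pi0 := pi_gt0 R; have qm1 := quantum_itv qm; have qpi := quantum_pi qm.
have p0 : 0 < p%:R :> R by rewrite ltr0n (leq_trans _ p_ge2).
have m0 : 0 < m%:R :> R by rewrite ltr0n.
have qE : q%:R / (m * p)%:R = q%:R / m%:R / p%:R :> R by rewrite natrM invfM mulrA.
have close j : (j%:R : R) < i%:R + 1 -> (i%:R : R) < j%:R + 1 -> j = i.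
  by rewrite !natr1 !ltr_nat !ltnS => h1 h2; apply/eqP; rewrite eqn_leq h1.
rewrite qE -mulrDl; split.
  move=> [/andP[xt tx]].
  have xtx : x 1%N <= t <= x 1%N + 2 * pi by rewrite xt ltW.
  have [[j jp /andP[xjt ty]]|[j jp tj]] := circle_cover p_ge2 edges xtx; last first.
    rewrite (equilibrium_arc_gap p_ge2 p_even alpha_lt1 edges dk_equilibrium jp tj tx).
    move=> [/(mulIf (invr_neq0 (lt0r_neq0 p0)))] e.
    have ji : j = i by apply: close; lra.
    by move: e; rewrite ji; lra.
  have tj : x j <= t <= y j by rewrite xjt ltW.
  rewrite (equilibrium_arc_band p_ge2 p_even alpha_lt1 edges dk_equilibrium jp tj tx).
  have kj := band_angle_itv p_ge2 p_even alpha_lt1 edges jp tj.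
  rewrite (_ : band_angle _ _ _ _ _ / _ = band_angle p alpha x j t / pi / p%:R); last first.
    by rewrite -mulrA -invfM [pi * _]mulrC.
  rewrite -mulrDl => -[/(mulIf (invr_neq0 (lt0r_neq0 p0)))] e.
  have kj1 : 0 <= band_angle p alpha x j t / pi <= 1.
    case/andP: kj => k0 k1; apply/andP; split; last by rewrite ler_pdivrMr// mul1r.
    by apply: divr_ge0 => //; exact: ltW.
  have ji : j = i by apply: close; lra.
  move: e; rewrite ji => e.
  have {}e : band_angle p alpha x i t = q%:R / m%:R * pi.
    by apply: (canRL (mulfVK (lt0r_neq0 pi0))); lra.
  rewrite ji in xjt ty tj.
  have /(band_angle_eq ip tj) De : 0 <= q%:R / m%:R * (pi : R) <= pi by lra.
  have Dt := De.1 e; split => //; rewrite ty andbT lt_neqAle xjt andbT.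
  (* The left edge is excluded because |D| >= 2 there, whereas the quantum lies in (-2, 2). *)
  apply/eqP => xt0; have := gap_hyperbolic_x p_ge2 p_even alpha_lt1 edges (j := i).
  have := quantum_bound i qm.
  rewrite /quantum -Dt xt0 => /andP[d1 d2]; rewrite leNgt ltr_norml d1 d2 /=.
  by case/andP: ip => -> /leqW -> /(_ isT).
move=> [/andP[xt ty] Dt].
have tj : x i <= t <= y i by rewrite !ltW.
have /(band_angle_eq ip tj) De : 0 <= q%:R / m%:R * (pi : R) <= pi by lra.
have e := De.2 Dt.
have tx : t < x 1%N + 2 * pi by apply: lt_le_trans ty (y_le_xlast edges ip).
have /andP[xt1 _] := band_sub p_ge2 edges ip tj.
split; first by rewrite xt1.
rewrite (equilibrium_arc_band p_ge2 p_even alpha_lt1 edges dk_equilibrium ip tj tx) e.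
congr EFin; rewrite mulrDl; congr (_ + _).
by rewrite invfM [p%:R^-1 * _]mulrC mulrA mulfK// lt0r_neq0.
Qed.

Lemma quantized_point i q : (1 <= i <= p)%N -> (1 <= q <= m.-1)%N ->
  exists! t, x 1%N <= t < x 1%N + 2 * pi /\
   arc_mass dk (x 1%N) t = ((i%:R - 1) / p%:R + q%:R / (m * p)%:R)%:E.
Proof.
move=> ip qm.
have [t ti Dt] := band_inverse p_ge2 p_even alpha_lt1 edges ip (quantum_bound i qm).
exists t; split; first exact/(arc_mass_quantum _ ip qm).
move=> s /(arc_mass_quantum _ ip qm)[si Ds].
apply: (band_inj p_ge2 p_even alpha_lt1 edges ip); last by rewrite Ds.
- by rewrite in_itv/=; case/andP: ti => /ltW -> /ltW ->.
- by rewrite in_itv/=; case/andP: si => /ltW -> /ltW ->.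
Qed.

Lemma cheb2_quantum i q : (1 <= q <= m.-1)%N -> cheb2 m (quantum q i) = 0.
Proof.
move=> qm; apply/(cheb2_root _ m_gt0); rewrite /quantum; case: ifP => _; first by exists q.
exists (m - q)%N; first exact: quantum_compl.
congr (2 * cos _); rewrite natrB; last by case/andP: qm => _ /leq_trans; apply; exact: leq_pred.
by rewrite mulrBl divff ?mulrBl ?mul1r// pnatr_eq0 -lt0n.
Qed.

Lemma cheb2_disc_root t : x 1%N <= t <= x 1%N + 2 * pi -> cheb2 m (D t) = 0 ->
  exists i q, [/\ (1 <= i <= p)%N, (1 <= q <= m.-1)%N, x i < t < y i & D t = quantum q i].
Proof.
move=> t0 /(cheb2_root _ m_gt0)[q qm Dt].
have c1 := cos_open_itv (quantum_pi qm).
have [|i ip ti] := elliptic_band p_ge2 p_even alpha_lt1 edges t0.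
  by rewrite Dt ltr_norml; lra.
have [Dx|Dx] := boolP (D (x i) == 2).
  by exists i, q; rewrite /quantum Dx.
exists i, (m - q)%N; rewrite /quantum (negbTE Dx); split => //.
  exact: quantum_compl.
rewrite Dt; congr (2 * cos _); rewrite natrB; last by case/andP: qm => _ /leq_trans; apply; exact: leq_pred.
by rewrite mulrBl divff ?mulrBl ?mul1r ?subKr// pnatr_eq0 -lt0n.
Qed.

End quantized_points.

Unset Implicit Arguments.
Set Strict Implicit.
Set Printing Implicit Defensive.

Theorem theorem3p1 (R : realType) (p : nat) (alpha : nat -> R[i])
    (x y : nat -> R) (dk : probability (borelC R) R) (m : nat) :
  (2 <= p)%N -> ~~ odd p ->
  (forall n, `|alpha n| < 1) ->
  (forall n, alpha (n + p)%N = alpha n) ->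
  band_edges alpha p x y ->
  equilibrium_measure (bands p x y) dk ->
  (1 <= m)%N ->
  let is_point i q theta :=
    x 1%N <= theta < x 1%N + 2 * pi /\
    arc_mass dk (x 1%N) theta
      = ((i%:R - 1) / p%:R + q%:R / (m * p)%:R)%:E in
  [/\ (forall j, (1 <= j <= p)%N ->
         exists! z, dirichlet alpha p z /\ closed_gap x y j z),
      (forall z, dirichlet alpha p z ->
         exists2 j, (1 <= j <= p)%N & closed_gap x y j z),
      (forall i q, (1 <= i <= p)%N -> (1 <= q <= m.-1)%N ->
         exists! theta, is_point i q theta) &
      forall z : R[i],
        root (Phi alpha (m * p) - revpoly (m * p) (Phi alpha (m * p))) z <->
        dirichlet alpha p z \/
        exists i q theta,
          [/\ (1 <= i <= p)%N, (1 <= q <= m.-1)%N, is_point i q theta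
            & z = expi theta]].
Proof.
move=> p_ge2 p_even alpha_lt1 alpha_periodic edges dk_equilibrium m_gt0 is_point.
have p_gt0 : (0 < p)%N by exact: leq_trans p_ge2.
split.
- move=> j jp; have [t tj t0] := gap_dirichlet p_ge2 p_even alpha_lt1 edges jp.
  have tg : closed_gap x y j (expi t) by exists t.
  have td : dirichlet alpha p (expi t) by apply/(dirichlet_dirf alpha_lt1).
  exists (expi t); split => // z' [d' g'].
  exact: (dirichlet_unique p_ge2 p_even alpha_lt1 edges jp).
- by move=> z; exact: (dirichlet_gap p_ge2 p_even alpha_lt1 edges).
- by move=> i q; exact: (quantized_point p_ge2 p_even alpha_lt1 edges dk_equilibrium m_gt0).
move=> z; split.
  (* Here [z] is an arbitrary complex number; being on the circle, it has an angle in the window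
     that starts at [x 1]. *)
  move=> zr; have z1 : `|z| = 1.
    move: zr => /(root_Phi alpha_lt1); apply: (phi_eq_phistar alpha_lt1).
    by rewrite muln_gt0 m_gt0.
  have [t tt zt] := unit_expi_period (x1_itv edges) z1.
  move: zr; rewrite zt => /(root_Phi_dirf alpha_lt1).
  rewrite (dirf_mul alpha_lt1 alpha_periodic)// => /eqP; rewrite mulf_eq0 => /orP[/eqP c0|/eqP d0].
    right; have tt' : x 1%N <= t <= x 1%N + 2 * pi by case/andP: tt => -> /ltW ->.
    have [i [q [ip qm ti Dt]]] := cheb2_disc_root p_ge2 p_even alpha_lt1 edges m_gt0 tt' c0.
    exists i, q, t; split => //.
    exact/(arc_mass_quantum p_ge2 p_even alpha_lt1 edges dk_equilibrium m_gt0 _ ip qm).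
  by left; apply/(dirichlet_dirf alpha_lt1).
move=> [zd|[i [q [t [ip qm tp ->]]]]]; last first.
  apply/(root_Phi_dirf alpha_lt1); rewrite (dirf_mul alpha_lt1 alpha_periodic)//.
  move: tp => /(arc_mass_quantum p_ge2 p_even alpha_lt1 edges dk_equilibrium m_gt0 _ ip qm)[_ ->].
  by rewrite cheb2_quantum// mul0r.
have [t tt zt] := unit_expi_period (x1_itv edges) zd.1.
move: zd; rewrite zt => /(dirichlet_dirf alpha_lt1) d0.
apply/(root_Phi_dirf alpha_lt1); rewrite (dirf_mul alpha_lt1 alpha_periodic)//.
by rewrite d0 mulr0.
Qed.
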